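(* Let $n\ge 1$ and $s\in(0,1)$. Let $\Omega\subseteq\mathbb{R}^n$ be a regular open, bounded set whose closure $\overline{\Omega}$ has positive reach $r_\Omega>0$, and let $t\in(0,r_\Omega)$. Let $f:[0,+\infty)\to\mathbb{R}$ satisfy $f\in C^{0,1}_{\mathrm{loc}}([0,+\infty))$. If there exist a weak solution $u\in H^s(\mathbb{R}^n)\cap L^\infty(\mathbb{R}^n)$ of $$(-\Delta)^s u=f(u)\ \text{ in }\Omega,\qquad u=0\ \text{ in }\mathbb{R}^n\setminus\Omega,\qquad u>0\ \text{ in }\Omega,$$ and a constant $c_\flat\in\mathbb{R}$ such that $$\mathcal{N}_su=c_\flat\quad\text{on }\Gamma_t,$$ then $\Omega$ is a ball.
   Context: A set $\Omega\subseteq\mathbb{R}^n$ is regular open if it equals the interior of its closure. $f\in C^{0,1}_{\mathrm{loc}}([0,+\infty))$ means that $f$ is Lipschitz on $[0,M]$ for every $M>0$. Reach: for a non-empty set $E\subseteq\mathbb{R}^n$, let $\mathrm{Unp}(E)$ be the set of $x\in\mathbb{R}^n$ for which $\{y\in E : \mathrm{dist}(x,E)=|x-y|\}$ is a singleton. For $x\in E$, $\mathrm{reach}(E,x)=\sup\{r>0 : B_r(x)\subseteq\mathrm{Unp}(E)\}$, and $\mathrm{reach}(E)=\inf_{x\in E}\mathrm{reach}(E,x)\in[0,+\infty]$. Here $r_\Omega=\mathrm{reach}(\overline\Omega)$ (possibly $+\infty$), and $\Omega$ is non-empty. Outer parallel set: $\Gamma_t=\{x\in\mathbb{R}^n : \mathrm{dist}(x,\Omega)=t\}$.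 Constant: $c_{n,s}=s(1-s)4^s\pi^{-n/2}\,\Gamma(n/2+s)/\Gamma(2-s)$. Function spaces and weak solutions: $H^s(\mathbb{R}^n)$ is the space of $u\in L^2(\mathbb{R}^n)$ with $\iint |u(x)-u(y)|^2|x-y|^{-n-2s}\,dx\,dy<\infty$; $\mathcal{H}^s_0(\Omega)=\{u\in H^s(\mathbb{R}^n): u=0\text{ on }\mathbb{R}^n\setminus\Omega\}$; and $$\mathcal{E}(u,v)=\frac{c_{n,s}}{2}\int_{\mathbb{R}^n}\int_{\mathbb{R}^n}\frac{(u(x)-u(y))(v(x)-v(y))}{|x-y|^{n+2s}}\,dx\,dy .$$ A weak solution of $(-\Delta)^su=f(u)$ in $\Omega$, $u=0$ in $\mathbb{R}^n\setminus\Omega$, is a function $u\in\mathcal{H}^s_0(\Omega)$ with $\mathcal{E}(u,\phi)=\int_\Omega f(u)\phi\,dx$ for all $\phi\in\mathcal{H}^s_0(\Omega)$. Bounded weak solutions are continuous in $\Omega$ by interior regularity, and $u>0$ in $\Omega$ refers to the continuous representative. Nonlocal normal derivative: for $x\in\mathbb{R}^n\setminus\overline\Omega$, $$\mathcal{N}_su(x)=c_{n,s}\int_\Omega\frac{u(x)-u(y)}{|x-y|^{n+2s}}\,dy ,$$ where $u(x)=0$ for such $x$. *)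

(* Defs.v *)
From HB Require Import structures.
From mathcomp Require Import all_boot all_order all_algebra.
From mathcomp Require Import all_classical all_reals all_analysis.
From mathcomp Require Import measurable_realfun.
Set Implicit Arguments.
Unset Strict Implicit.
Unset Printing Implicit Defensive.
Import Order.TTheory GRing.Theory Num.Def Num.Theory.
Import numFieldNormedType.Exports.
Local Open Scope classical_set_scope.
Local Open Scope ring_scope.

(* R^n is 'rV[R]_n.  Its library topology comes from the sup norm, hence is the
   Euclidean one; it is given here its Borel sigma-algebra. *)
Section borel_rV.
Context (R : realType) (n : nat).

HB.instance Definition _ := @isMeasurable.Build
  (sigma_display (@open 'rV[R]_n)) 'rV[R]_n <<s @open 'rV[R]_n >>
  (@sigma_algebra0 _ setT _) (@sigma_algebraC _ _)
  (@sigma_algebra_bigcup _ setT _).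

Lemma measurable_coord (i : 'I_n) :
  measurable_fun [set: 'rV[R]_n] (fun x : 'rV[R]_n => x ord0 i).
Proof.
apply: (measurability _ (RGenOInfty.measurableE R)) => _ [_ [a ->] <-].
rewrite setTI; apply: sub_sigma_algebra.
apply: open_comp => [x _|]; last exact: interval_open.
exact: coord_continuous.
Qed.

Lemma measurable_fun_rV d (T : measurableType d) (f : T -> 'rV[R]_n) :
  (forall i, measurable_fun setT (fun x => f x ord0 i)) -> measurable_fun setT f.
Proof.
move=> mf; apply: (@measurability _ _ _ _ _ _ (@open 'rV[R]_n)) => // _ [U oU <-].
rewrite setTI.
pose B (q : {ffun 'I_n -> rat} * nat) : set 'rV[R]_n :=
  [set x | forall i, `|ratr (q.1 i) - x ord0 i| < q.2.+1%:R^-1].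
have -> : f @^-1` U = \bigcup_(q in [set q | B q `<=` U]) (f @^-1` B q).
  apply/seteqP; split=> [t /= Ut|t [q /= + Bt]]; last exact.
  have /nbhs_ballP[e /= e0 eU] : nbhs (f t) U by exact: open_nbhs_nbhs.
  have [k ke] : exists k, k.+1%:R^-1 < e / 2.
    have e20 : 0 < e / 2 by rewrite divr_gt0.
    have [k _ /(_ k (leqnn k)) /= ke] := near_infty_natSinv_lt (PosNum e20).
    by exists k.
  have /choice[q Hq] : forall i, exists q : rat,
      `|ratr q - f t ord0 i| < k.+1%:R^-1.
    move=> i.
    have /rat_in_itvoo[q] : f t ord0 i - k.+1%:R^-1 < f t ord0 i + k.+1%:R^-1.
      by rewrite ltrD2l -subr_gt0 opprK addr_gt0.
    by rewrite in_itv/= => /andP[q1 q2]; exists q; rewrite ltr_distl q1.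
  exists ([ffun i => q i], k) => /=; last by move=> i /=; rewrite ffunE.
  move=> x Bx; apply: eU; split=> // i j; rewrite (ord1 i) /ball/=.
  have := Bx j; rewrite /= ffunE => xj.
  rewrite (le_lt_trans (ler_distD (ratr (q j)) _ _))// [e]splitr ltrD//.
    by rewrite distrC (lt_trans (Hq j)).
  exact: lt_trans xj ke.
rewrite bigcup_mkcond; apply: countable_bigcupT_measurable => // q.
case: ifPn => // _.
have -> : f @^-1` B q = \bigcap_(i : 'I_n)
    ((fun x => f x ord0 i) @^-1` [set y | `|ratr (q.1 i) - y| < q.2.+1%:R^-1]).
  by apply/seteqP; split=> [x /= Bx i _|x Bx i]; [exact: Bx|exact: (Bx i)].
apply: fin_bigcap_measurable => // i _.
rewrite -[X in measurable X]setTI; apply: mf => //.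
apply: open_measurable.
have -> : [set y : R | `|ratr (q.1 i) - y| < q.2.+1%:R^-1] =
    ball (ratr (q.1 i) : R) q.2.+1%:R^-1 by [].
exact: ball_open.
Qed.

End borel_rV.

(* Lebesgue measure on R^n, by recursion on n through R^(n+1) = R * R^n. *)
Section volume.
Context {R : realType}.

Definition rV_cons n (p : measurableTypeR R * 'rV[R]_n) : 'rV[R]_n.+1 :=
  row_mx (const_mx p.1 : 'rV_1) p.2.

Definition rV_uncons n (x : 'rV[R]_n.+1) : measurableTypeR R * 'rV[R]_n :=
  (x ord0 ord0, rsubmx (x : 'rV_(1 + n))).

Lemma rV_consK n : cancel (@rV_cons n) (@rV_uncons n).
Proof.
move=> [a x]; rewrite /rV_uncons /rV_cons/= row_mxKr; congr pair.
by rewrite mxE; case: splitP => // j _; rewrite mxE.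
Qed.

Lemma measurable_rV_cons n : measurable_fun setT (@rV_cons n).
Proof.
apply: measurable_fun_rV => i.
have -> : (fun p : measurableTypeR R * 'rV[R]_n => rV_cons p ord0 i) =
    fun p => match @fintype.split 1 n i with
             | inl _ => p.1 | inr j => p.2 ord0 j end.
  by apply/funext => p; rewrite mxE; case: fintype.split => j //; rewrite mxE.
case: fintype.split => j; first exact: measurable_fst.
exact: (measurableT_comp (measurable_coord j) measurable_snd).
Qed.

Lemma measurable_rV_uncons n : measurable_fun setT (@rV_uncons n).
Proof.
apply: measurable_fun_pair; first exact: measurable_coord.
apply: measurable_fun_rV => i; under eq_fun do rewrite mxE.
exact: measurable_coord.
Qed.

Section volume_step.
Context n (m : {sigma_finite_measure set 'rV[R]_n -> \bar R}).

Definition volume_step : set 'rV[R]_n.+1 -> \bar R :=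
  pushforward (lebesgue_measure \x m)%E (@rV_cons n).

Let mcons (A : set 'rV[R]_n.+1) :
  measurable A -> measurable (@rV_cons n @^-1` A).
Proof. by move=> mA; rewrite -[X in measurable X]setTI; exact: measurable_rV_cons. Qed.

Let volume_step0 : volume_step set0 = 0%E.
Proof. by rewrite /volume_step /pushforward preimage_set0 measure0. Qed.

Let volume_step_ge0 A : (0 <= volume_step A)%E.
Proof. exact: (measure_ge0 (lebesgue_measure \x m)%E). Qed.

Let volume_step_sigma_additive : semi_sigma_additive volume_step.
Proof.
move=> F mF tF mUF; rewrite /volume_step /pushforward preimage_bigcup.
apply: measure_semi_sigma_additive => [k||].
- exact: mcons.
- apply/trivIsetP => i j _ _ ij; rewrite -preimage_setI.
  by move/trivIsetP : tF => -> //; rewrite preimage_set0.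
- by rewrite -preimage_bigcup; exact: mcons.
Qed.

HB.instance Definition _ := isMeasure.Build _ _ _ volume_step
  volume_step0 volume_step_ge0 volume_step_sigma_additive.

Let volume_step_sigma_finite : sigma_finite setT volume_step.
Proof.
have /sigma_finiteP[F [TF ndF Foo]] := sigma_finiteT (@lebesgue_measure R).
have /sigma_finiteP[G [TG ndG Goo]] := sigma_finiteT m.
exists (fun k => @rV_uncons n @^-1` (F k `*` G k)).
  apply/seteqP; split=> // x _.
  have [i _ Fi] : (\bigcup_k F k) (rV_uncons x).1 by rewrite -TF.
  have [j _ Gj] : (\bigcup_k G k) (rV_uncons x).2 by rewrite -TG.
  exists (maxn i j) => //; split.
  - by move: Fi; exact/subsetPset/ndF/leq_maxl.
  - by move: Gj; exact/subsetPset/ndG/leq_maxr.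
move=> k; have [mF Fk] := Foo k; have [mG Gk] := Goo k; split.
  rewrite -[X in measurable X]setTI; apply: measurable_rV_uncons => //.
  exact: measurableX.
rewrite /volume_step /pushforward -comp_preimage.
rewrite (_ : _ \o _ = id) ?preimage_id; last by apply/funext; exact: rV_consK.
by rewrite product_measure1E// lte_mul_pinfty// ge0_fin_numE.
Qed.

HB.instance Definition _ := Measure_isSigmaFinite.Build _ _ _ volume_step
  volume_step_sigma_finite.

End volume_step.

Fixpoint volume n : {sigma_finite_measure set 'rV[R]_n -> \bar R} :=
  match n with
  | 0 => dirac (0 : 'rV[R]_0)
  | k.+1 => volume_step (volume k)
  end.

Lemma volume_box n (a b : 'rV[R]_n) : (forall i, a ord0 i <= b ord0 i) ->
  volume n [set x | forall i, a ord0 i <= x ord0 i <= b ord0 i] =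
  (\prod_(i < n) (b ord0 i - a ord0 i))%:E.
Proof.
elim: n a b => [|n IH] a b ab.
  by rewrite big_ord0 /= diracE mem_set//= => -[].
pose a' := (rV_uncons a).2; pose b' := (rV_uncons b).2.
pose box := [set x : 'rV[R]_n | forall i, a' ord0 i <= x ord0 i <= b' ord0 i].
have lift0E (x : 'rV[R]_n.+1) i : (rV_uncons x).2 ord0 i = x ord0 (lift ord0 i).
  by rewrite mxE; congr (x _ _); exact/val_inj.
rewrite /= /volume_step /pushforward.
have -> : @rV_cons n @^-1` [set x | forall i, a ord0 i <= x ord0 i <= b ord0 i] =
    `[a ord0 ord0, b ord0 ord0] `*` box.
  have E0 (p : measurableTypeR R * 'rV[R]_n) :
      rV_cons p ord0 (ord0 : 'I_n.+1) = p.1.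
    by have /(congr1 fst) := rV_consK p.
  have ES (p : measurableTypeR R * 'rV[R]_n) i :
      rV_cons p ord0 (lift ord0 i) = p.2 ord0 i.
    by rewrite -lift0E rV_consK.
  apply/seteqP; split=> [p /= H|p /= [H0 H] i].
    split; first by rewrite in_itv/= -E0.
    by move=> i; rewrite !lift0E -ES.
  case: (unliftP ord0 i) => [j|] ->; last by rewrite E0; move: H0; rewrite in_itv.
  by rewrite ES -!lift0E.
rewrite product_measure1E//; last first.
  have -> : box = \bigcap_(i : 'I_n)
      ((fun x => x ord0 i) @^-1` `[a' ord0 i, b' ord0 i]).
    by apply/seteqP; split=> [x /= H i _|x H i]; [rewrite /= in_itv/=|
      have := H i I; rewrite /= in_itv].
  apply: fin_bigcap_measurable => // i _.
  by rewrite -[X in measurable X]setTI; exact: measurable_coord.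
rewrite IH; last by move=> i; rewrite !lift0E.
have -> : (\prod_(i < n) (b' ord0 i - a' ord0 i) =
    \prod_(i < n) (b ord0 (lift ord0 i) - a ord0 (lift ord0 i))).
  by apply: eq_bigr => i _; rewrite !lift0E.
rewrite big_ord_recl EFinM; congr (_ * _)%E.
have := lebesgue_measure_itv `[a ord0 ord0, b ord0 ord0]; rewrite /= => ->.
rewrite lte_fin; case: ltP => [_|ba]; first by rewrite EFinB.
by have -> : a ord0 ord0 = b ord0 ord0; [apply/eqP; rewrite eq_le ab|rewrite subrr].
Qed.

End volume.

Section euclidean.
Context {R : realType} {n : nat}.
Implicit Types (x y : 'rV[R]_n) (E : set 'rV[R]_n).

Definition enorm x : R := Num.sqrt (\sum_(i < n) x ord0 i ^+ 2).

Definition eball x (r : R) : set 'rV[R]_n := [set y | enorm (x - y) < r].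

Definition edist x E : R := inf [set enorm (x - y) | y in E].

Definition nearest_points x E : set 'rV[R]_n :=
  [set y | E y /\ edist x E = enorm (x - y)].

Definition Unp E : set 'rV[R]_n :=
  [set x | exists y, nearest_points x E = [set y]].

(* The maximum with 0 makes the supremum of the empty set of radii 0. *)
Definition reach_at E x : \bar R :=
  maxe 0%E (ereal_sup [set r%:E | r in [set r | 0 < r /\ eball x r `<=` Unp E]]).

Definition reach E : \bar R := ereal_inf [set reach_at E x | x in E].

Definition outer_parallel E (t : R) : set 'rV[R]_n := [set x | edist x E = t].

End euclidean.

Definition Gamma {R : realType} (a : R) : R :=
  \int[lebesgue_measure]_(t in `]0, +oo[) (t `^ (a - 1) * expR (- t)).

Definition c_ns {R : realType} (n : nat) (s : R) : R :=
  s * (1 - s) * 4 `^ s * pi `^ (- (n%:R / 2)) * Gamma (n%:R / 2 + s) / Gamma (2 - s).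

Section fractional_laplacian.
Context {R : realType} {n : nat}.
Local Notation vol := (volume n : {measure set 'rV[R]_n -> \bar R}).
Implicit Types (s : R) (Omega : set 'rV[R]_n) (u v phi : 'rV[R]_n -> R).

(* By the convention 0^-1 = 0 the kernel vanishes on the diagonal, which is a
   null set when n >= 1. *)
Definition frac_kernel s (x y : 'rV[R]_n) : R := (enorm (x - y) `^ (n%:R + 2 * s))^-1.

Definition Hs s : set ('rV[R]_n -> R) :=
  [set u | u \in Lfun vol 2%:E /\
    (\int[vol]_y \int[vol]_x (`|u x - u y| ^+ 2 * frac_kernel s x y)%:E < +oo)%E].

(* Elements of H^s are considered up to null sets, hence the a.e. condition. *)
Definition Hs0 s Omega : set ('rV[R]_n -> R) :=
  [set u | Hs s u /\ {ae vol, forall x, ~ Omega x -> u x = 0}].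

Definition energy s u v : R :=
  c_ns n s / 2 *
  \int[vol]_y \int[vol]_x ((u x - u y) * (v x - v y) * frac_kernel s x y).

(* Only the values of f on [0, +oo[ matter for u positive a.e. in Omega. *)
Definition weak_solution s (f : R -> R) Omega u : Prop :=
  Hs0 s Omega u /\
  forall phi, Hs0 s Omega phi ->
    energy s u phi = \int[vol]_(x in Omega) (f (u x) * phi x).

(* Positivity of the continuous representative of u in Omega. *)
Definition positive_in Omega u : Prop :=
  exists v, [/\ {within Omega, continuous v},
    {ae vol, forall x, Omega x -> u x = v x} &
    forall x, Omega x -> 0 < v x].

(* Meant for a representative u that vanishes at every point outside Omega. *)
Definition nonlocal_normal_derivative s Omega u (x : 'rV[R]_n) : R :=
  c_ns n s * \int[vol]_(y in Omega) ((u x - u y) * frac_kernel s x y).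

End fractional_laplacian.

(* Main.v *)
Require Import Defs.
From mathcomp Require Import all_boot all_order all_algebra.
From mathcomp Require Import all_classical all_reals all_analysis.
From mathcomp Require Import measurable_realfun ess_sup_inf ring lra.

(** The proof moves planes for the solution, in its weak form.

    Fix a unit vector [e].  The midpoints of the chords of the parallel set in
    direction [e] have bounded heights; let [critical_height] be the supremum.
    In hyperplanes above it, the cap of [Omega] is reflected into [Omega]
    ([cap_reflected]): a point of the [t]-neighbourhood of [Omega] reflected out
    of that neighbourhood would give a higher chord, and a closed set of reach
    larger than [t] contains the centre of every ball of radius [t] inside its
    [t]-neighbourhood ([eroded_neighbourhood]).

    The solution agrees almost everywhere with a bounded function [U] that is
    positive and continuous in [Omega] and vanishes outside, and the nonlinearity
    may be truncated to a globally Lipschitz one.  Hyperplanes come down from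
    infinity as long as [U] dominates its reflection on the lower side
    ([ordered_at]).  On that side the negative part of the difference, the defect,
    is an admissible test function.  Testing with it and with its mirror image,
    and averaging over the reflections of either point of a pair, bounds the
    energy of the defect plus a repulsion term by a multiple of its squared norm
    ([defect_energy_bound]).  At a hyperplane that is not one of symmetry, [U]
    exceeds its reflection by a positive constant on some ball; for slightly lower
    hyperplanes the repulsion from this ball dominates the squared norm except on
    a set of small volume, where a Poincare inequality takes over
    ([small_set_poincare]).  Hence the defect vanishes ([plane_step]), and the
    hyperplanes descend until they meet one of symmetry or the critical height.

    At the critical height there is a chord of the parallel set bisected by the
    hyperplane, or a point of the hyperplane to which chords shrink
    ([critical_chord]).  On the parallel set the nonlocal normal derivative is a
    fixed negative multiple of the potential of [U], which is therefore constant
    there.  Comparing its values at the two ends of the chord, or differentiating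
    along the shrinking chords, shows that [U] is orthogonal to an odd weight that
    is positive below the hyperplane; being ordered, [U] must be symmetric
    ([chord_symmetric], [tangent_symmetric]).

    In every direction [Omega] thus has a hyperplane of symmetry beyond which caps
    are reflected inside, and such a set is a ball ([symmetric_ball]). *)

Set Implicit Arguments.
Unset Strict Implicit.
Unset Printing Implicit Defensive.
Import Order.TTheory GRing.Theory Num.Def Num.Theory.
Import numFieldNormedType.Exports.
Local Open Scope classical_set_scope.
Local Open Scope ring_scope.
(* Uniform spaces have an extended distance of the same name. *)
Local Notation edist := Defs.edist.

(** * Euclidean geometry *)

Section euclidean_geometry.
Context {R : realType} {n : nat}.
Implicit Types (x y z e : 'rV[R]_n) (a b l r : R).

Definition dot x y : R := \sum_(i < n) x ord0 i * y ord0 i.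

Lemma dotC x y : dot x y = dot y x.
Proof. by apply: eq_bigr => i _; rewrite mulrC. Qed.

Lemma dotDl x y z : dot (x + y) z = dot x z + dot y z.
Proof.
by rewrite /dot -big_split; apply: eq_bigr => i _; rewrite mxE mulrDl.
Qed.

Lemma dotZl a x z : dot (a *: x) z = a * dot x z.
Proof.
by rewrite /dot mulr_sumr; apply: eq_bigr => i _; rewrite mxE mulrA.
Qed.

Lemma dotDr x y z : dot x (y + z) = dot x y + dot x z.
Proof. by rewrite dotC dotDl dotC (dotC x z). Qed.

Lemma dotZr a x z : dot x (a *: z) = a * dot x z.
Proof. by rewrite dotC dotZl dotC. Qed.

Lemma dotNl x z : dot (- x) z = - dot x z.
Proof. by rewrite -scaleN1r dotZl mulN1r. Qed.

Lemma dotNr x z : dot x (- z) = - dot x z.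
Proof. by rewrite -scaleN1r dotZr mulN1r. Qed.

Lemma dot0l z : dot 0 z = 0.
Proof. by rewrite -(scale0r z) dotZl mul0r. Qed.

Definition dotE := (dotDl, dotDr, dotZl, dotZr, dotNl, dotNr).

Lemma dot_ge0 x : 0 <= dot x x.
Proof. by apply: sumr_ge0 => i _; rewrite -expr2 sqr_ge0. Qed.

Lemma dot_eq0 x : (dot x x == 0) = (x == 0).
Proof.
apply/idP/eqP => [|->]; last by rewrite dot0l.
rewrite psumr_eq0 => [/allP h|i _]; last by rewrite -expr2 sqr_ge0.
apply/rowP => i; have := h i (mem_index_enum i).
by rewrite mxE mulf_eq0 orbb => /eqP.
Qed.

Lemma dot_gt0 x : x != 0 -> 0 < dot x x.
Proof. by move=> x0; rewrite lt_def dot_eq0 x0 dot_ge0. Qed.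

Lemma enormE x : enorm x = Num.sqrt (dot x x).
Proof. by congr Num.sqrt; apply: eq_bigr => i _; rewrite expr2. Qed.

Lemma sqr_enorm x : enorm x ^+ 2 = dot x x.
Proof. by rewrite enormE sqr_sqrtr // dot_ge0. Qed.

Lemma enorm_ge0 x : 0 <= enorm x.
Proof. exact: sqrtr_ge0. Qed.

Lemma enorm_eq0 x : (enorm x == 0) = (x == 0).
Proof. by rewrite -sqrf_eq0 sqr_enorm dot_eq0. Qed.

Lemma enorm_gt0 x : (0 < enorm x) = (x != 0).
Proof. by rewrite lt_def enorm_ge0 andbT enorm_eq0. Qed.

Lemma enorm0 : enorm (0 : 'rV[R]_n) = 0.
Proof. by apply/eqP; rewrite enorm_eq0. Qed.

Lemma enormZ a x : enorm (a *: x) = `|a| * enorm x.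
Proof.
apply: (@pexpIrn R 2); rewrite ?nnegrE ?mulr_ge0 ?enorm_ge0//.
by rewrite exprMn !sqr_enorm !dotE real_normK ?num_real// mulrA expr2.
Qed.

Lemma enormN x : enorm (- x) = enorm x.
Proof. by rewrite -scaleN1r enormZ normrN1 mul1r. Qed.

Lemma enorm_distC x y : enorm (x - y) = enorm (y - x).
Proof. by rewrite -enormN opprB. Qed.

Lemma ler_enorm x y : (enorm x <= enorm y) = (dot x x <= dot y y).
Proof. by rewrite -!sqr_enorm ler_sqr ?nnegrE ?enorm_ge0. Qed.

Lemma cauchy_schwarz x y : dot x y <= enorm x * enorm y.
Proof.
have [->|y0] := eqVneq y 0; first by rewrite dotC dot0l enorm0 mulr0.
have yy := dot_gt0 y0; set c := dot x y / dot y y.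
have := dot_ge0 (x - c *: y).
rewrite !dotE (dotC y x) => h.
have h1 : dot x y ^+ 2 <= dot x x * dot y y.
  rewrite -subr_ge0 -(pmulr_lge0 _ (x := (dot y y)^-1)) ?invr_gt0//.
  apply: le_trans h _; rewrite le_eqVlt; apply/orP; left; apply/eqP.
  by rewrite /c; field; rewrite gt_eqF.
apply: le_trans (ler_norm _) _.
rewrite -(@ler_pXn2r R 2) ?nnegrE ?mulr_ge0 ?enorm_ge0//.
by rewrite exprMn !sqr_enorm real_normK ?num_real.
Qed.

Lemma ler_enormD x y : enorm (x + y) <= enorm x + enorm y.
Proof.
rewrite -(@ler_pXn2r R 2) ?nnegrE ?addr_ge0 ?enorm_ge0//.
rewrite sqrrD !sqr_enorm !dotE (dotC y x).
by have := cauchy_schwarz x y; lra.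
Qed.

Lemma ler_edistD z x y : enorm (x - y) <= enorm (x - z) + enorm (z - y).
Proof. by apply: le_trans (ler_enormD _ _); rewrite addrA subrK. Qed.

Lemma normr_dot x y : `|dot x y| <= enorm x * enorm y.
Proof.
rewrite ler_norml cauchy_schwarz andbT lerNl -dotNl -(enormN x).
exact: cauchy_schwarz.
Qed.

Lemma coord_le_enorm x i : `|x ord0 i| <= enorm x.
Proof.
rewrite -(@ler_pXn2r R 2) ?nnegrE ?enorm_ge0// sqr_enorm real_normK ?num_real//.
rewrite /dot (bigD1 i)//= expr2 lerDl.
by apply: sumr_ge0 => j _; rewrite -expr2 sqr_ge0.
Qed.

Lemma mx_norm_le_enorm x : `|x| <= enorm x.
Proof.
rewrite /normr /= mx_normrE; apply: bigmax_le => [|[i j] _ /=].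
  exact: enorm_ge0.
by rewrite ord1 coord_le_enorm.
Qed.

Lemma enorm_le_mx_norm x : enorm x <= n%:R * `|x|.
Proof.
have coordle i : `|x ord0 i| <= `|x|.
  by rewrite [leRHS]/normr /= mx_normrE; apply/bigmax_geP; right => /=; exists (ord0, i).
have [->|x0] := eqVneq x 0; first by rewrite enorm0 normr0 mulr0.
have h0 : 0 < enorm x by rewrite enorm_gt0.
rewrite -(ler_pM2r h0) -expr2 sqr_enorm.
apply: (@le_trans _ _ (\sum_(i < n) `|x| * enorm x)).
  apply: ler_sum => i _; apply: le_trans (ler_norm _) _.
  by rewrite normrM ler_pM ?coordle ?coord_le_enorm.
by rewrite sumr_const card_ord -mulrA mulr_natl.
Qed.

(** The sup norm defines the topology, the Euclidean norm the geometry. *)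
Lemma nbhs_eballP x (A : set 'rV[R]_n) :
  nbhs x A <-> exists2 r : R, 0 < r & eball x r `<=` A.
Proof.
split=> [/nbhs_ballP[r /= r0 rA]|[r r0 rA]].
  exists r => // y xy; apply: rA; rewrite -ball_normE /=.
  exact: le_lt_trans (mx_norm_le_enorm _) xy.
apply/nbhs_ballP; exists (r / n.+1%:R) => [|y]; first by rewrite /= divr_gt0.
rewrite -ball_normE /= => xy.
apply: rA; rewrite /eball /=; apply: le_lt_trans (enorm_le_mx_norm _) _.
move: xy; rewrite ltr_pdivlMr// mulrC; apply: le_lt_trans.
by rewrite ler_wpM2r// ler_nat.
Qed.

Lemma open_eballP (A : set 'rV[R]_n) :
  open A <-> forall x, A x -> exists2 r : R, 0 < r & eball x r `<=` A.
Proof.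
rewrite openE; split=> [h x /h /nbhs_eballP//|h x /h hx].
exact/nbhs_eballP.
Qed.

Lemma closure_eballP (A : set 'rV[R]_n) x :
  closure A x <-> forall r : R, 0 < r -> exists2 y, A y & enorm (x - y) < r.
Proof.
split=> [h r r0|h B /nbhs_eballP[r r0 rB]].
  have /h[y [Ay xy]] : nbhs x (eball x r) by apply/nbhs_eballP; exists r.
  by exists y.
by have [y Ay xy] := h r r0; exists y; split=> //; apply: rB.
Qed.

Lemma ler_enorm_sub x y : `|enorm x - enorm y| <= enorm (x - y).
Proof.
rewrite ler_norml; apply/andP; split.
  have := ler_enormD x (y - x); rewrite addrC subrK (enorm_distC x); lra.
have := ler_enormD y (x - y); rewrite addrC subrK; lra.
Qed.

Lemma continuous_enorm : continuous (fun x : 'rV[R]_n => enorm x).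
Proof.
move=> x; apply/(@cvgrPdist_lt _ _ _ (nbhs x)) => e e0.
apply/nbhs_eballP; exists e => // y xy.
exact: le_lt_trans (ler_enorm_sub _ _) xy.
Qed.

Lemma closed_sublevel (f : 'rV[R]_n -> R) a :
  continuous f -> closed [set x | f x <= a].
Proof.
move=> cf; have := @preimage_closed 'rV[R]_n R f [set z | z <= a].
by apply; [move=> x _; exact: cf|exact: closed_le].
Qed.

Lemma closed_superlevel (f : 'rV[R]_n -> R) a :
  continuous f -> closed [set x | a <= f x].
Proof.
move=> cf; have := @preimage_closed 'rV[R]_n R f [set z | a <= z].
by apply; [move=> x _; exact: cf|exact: closed_ge].
Qed.

Lemma open_sublevel (f : 'rV[R]_n -> R) a :
  continuous f -> open [set x | f x < a].
Proof.
move=> cf; rewrite -closedC; rewrite (_ : ~` _ = [set x | a <= f x]).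
  exact: closed_superlevel.
by apply/seteqP; split=> x /=; rewrite leNgt => /negP.
Qed.

Lemma continuous_enorm_dist x : continuous (fun y : 'rV[R]_n => enorm (x - y)).
Proof.
move=> y; apply/(@cvgrPdist_lt _ _ _ (nbhs y)) => e e0.
apply/nbhs_eballP; exists e => // z yz.
apply: le_lt_trans (ler_enorm_sub _ _) _.
by rewrite opprB addrC addrA subrK enorm_distC.
Qed.

Lemma open_eball x r : open (eball x r).
Proof. by apply: open_sublevel; exact: continuous_enorm_dist. Qed.

Lemma continuous_dot z : continuous (fun x : 'rV[R]_n => dot x z).
Proof.
move=> x; apply/(@cvgrPdist_lt _ _ _ (nbhs x)) => e e0; apply/nbhs_eballP.
have z1 : 0 < 1 + enorm z by rewrite ltr_pwDl ?enorm_ge0.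
exists (e / (1 + enorm z)) => [|y xy]; first by rewrite divr_gt0.
rewrite -dotNl -dotDl; apply: le_lt_trans (normr_dot _ _) _.
apply: (@le_lt_trans _ _ (enorm (x - y) * (1 + enorm z))).
  by rewrite ler_wpM2l ?enorm_ge0// lerDr.
by rewrite -ltr_pdivlMr.
Qed.

(** * Reflections *)

(** For a unit vector [e], the reflection in the hyperplane [dot x e = l]. *)
Definition refl e l x : 'rV[R]_n := x + (2 * (l - dot x e)) *: e.

Lemma dot_refl e l x : enorm e = 1 -> dot (refl e l x) e = 2 * l - dot x e.
Proof. by move=> e1; rewrite /refl !dotE -sqr_enorm e1; ring. Qed.

Lemma reflK e l : enorm e = 1 -> involutive (refl e l).
Proof.
move=> e1 x; rewrite /refl -addrA -scalerDl -/(refl e l x) dot_refl//.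
have -> : 2 * (l - dot x e) + 2 * (l - (2 * l - dot x e)) = 0 by ring.
by rewrite scale0r addr0.
Qed.

Lemma refl_shift e l l' x : refl e l' x = refl e l x + (2 * (l' - l)) *: e.
Proof. by rewrite /refl -addrA -scalerDl; congr (_ + _ *: _); ring. Qed.

(** The identity behind every comparison of the kernel with its reflection. *)
Lemma dot_sub_refl e l x y : enorm e = 1 ->
  dot (refl e l x - y) (refl e l x - y) =
  dot (x - y) (x - y) + 4 * (l - dot x e) * (l - dot y e).
Proof.
move=> e1; rewrite /refl !dotE -(sqr_enorm e) e1 (dotC y x) !(dotC e); ring.
Qed.

Lemma enorm_refl e l x y : enorm e = 1 ->
  enorm (refl e l x - refl e l y) = enorm (x - y).
Proof.
move=> e1; rewrite !enormE; congr Num.sqrt.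
rewrite /refl !dotE -(sqr_enorm e) e1 (dotC y x) !(dotC e); ring.
Qed.

Lemma enorm_refl_swap e l x y : enorm e = 1 ->
  enorm (refl e l x - y) = enorm (x - refl e l y).
Proof. by move=> e1; rewrite -[in RHS](reflK l e1 x) enorm_refl. Qed.

Lemma refl_fix e l x : dot x e = l -> refl e l x = x.
Proof. by move=> <-; rewrite /refl subrr mulr0 scale0r addr0. Qed.

End euclidean_geometry.

(** * Distance to a set and reach *)

Section distance_and_reach.
Context {R : realType} {n : nat}.
Implicit Types (x y z : 'rV[R]_n) (E : set 'rV[R]_n) (r t : R).

Lemma edist_le E x y : E y -> edist x E <= enorm (x - y).
Proof.
move=> Ey; apply: ge_inf; last by exists y.
by exists 0 => _ [z _ <-]; exact: enorm_ge0.
Qed.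

Lemma edist_ge E x r : E !=set0 -> (forall y, E y -> r <= enorm (x - y)) ->
  r <= edist x E.
Proof.
by move=> [y Ey] h; apply: lb_le_inf => [|_ [z Ez <-]]; [exists (enorm (x - y)), y|exact: h].
Qed.

Lemma edist_ge0 E x : E !=set0 -> 0 <= edist x E.
Proof. by move=> E0; apply: edist_ge => // y _; exact: enorm_ge0. Qed.

Lemma edist_lt E x r : E !=set0 -> edist x E < r ->
  exists2 y, E y & enorm (x - y) < r.
Proof.
move=> E0 xr; apply: contrapT => h.
have : r <= edist x E.
  by apply: edist_ge => // y Ey; rewrite leNgt; apply/negP => ?; apply: h; exists y.
by rewrite leNgt xr.
Qed.

Lemma edist_lipschitz E x y : E !=set0 -> edist x E <= edist y E + enorm (x - y).
Proof.
move=> E0; rewrite -lerBlDr; apply: edist_ge => // z Ez; rewrite lerBlDr addrC.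
exact: le_trans (edist_le _ Ez) (ler_edistD y x z).
Qed.

Lemma edist_closure E x : E !=set0 -> edist x (closure E) = edist x E.
Proof.
move=> E0; have cE0 : closure E !=set0.
  by have [y Ey] := E0; exists y; exact: subset_closure.
apply/eqP; rewrite eq_le; apply/andP; split.
  by apply: edist_ge => // y Ey; apply: edist_le; exact: subset_closure.
apply: edist_ge => // y /closure_eballP yE.
apply/ler_addgt0Pr => r /yE[z Ez yz].
apply: le_trans (edist_le _ Ez) _; apply: le_trans (ler_edistD y _ _) _.
by rewrite lerD2l ltW.
Qed.

Lemma continuous_edist E : E !=set0 -> continuous (fun x => edist x E).
Proof.
move=> E0 x; apply/(@cvgrPdist_lt _ _ _ (nbhs x)) => e e0; apply/nbhs_eballP.
exists e => // y xy; apply: le_lt_trans xy; rewrite ler_norml; apply/andP; split.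
  by have := edist_lipschitz y x E0; rewrite enorm_distC; lra.
by have := edist_lipschitz x y E0; lra.
Qed.

Lemma edist_eq0 E x : E !=set0 -> closed E -> edist x E = 0 -> E x.
Proof.
move=> E0 cE x0; apply: cE; apply/closure_eballP => r r0.
by apply: edist_lt => //; rewrite x0.
Qed.

Lemma compact_eball x r : compact [set y | enorm (x - y) <= r].
Proof.
apply: bounded_closed_compact.
  exists (enorm x + r); split; first exact: num_real.
  move=> M hM y /= yr; apply/ltW; apply: le_lt_trans hM.
  apply: le_trans (mx_norm_le_enorm _) _.
  by have := ler_enormD x (y - x); rewrite addrC subrK (enorm_distC y); lra.
exact/closed_sublevel/continuous_enorm_dist.
Qed.

(** Compactness forces the nearest point to depend continuously on [y] wherever
    it is unique. *)
Lemma nearest_point_continuous E y z r : closed E -> nearest_points y E = [set z] ->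
  0 < r -> exists2 d : R, 0 < d & forall y' z', enorm (y - y') < d ->
    nearest_points y' E z' -> enorm (z - z') < r.
Proof.
move=> cE yz r0; have [Ez dz] : nearest_points y E z by rewrite yz.
have E0 : E !=set0 by exists z.
pose K : set 'rV[R]_n := [set w | enorm (y - w) <= edist y E + 2] `&` (E `&` [set w | r <= enorm (z - w)]).
have crz : closed [set w : 'rV[R]_n | r <= enorm (z - w)].
  exact/closed_superlevel/continuous_enorm_dist.
have cK : compact K by apply: compact_closedI; [exact: compact_eball|exact: closedI].
have [K0|/set0P/negP/negPn/eqP K0] := pselect (K !=set0); last first.
  exists 1 => // y' z' yy' [Ez' dz']; rewrite ltNge; apply/negP => rz'.
  suff : K z' by rewrite K0.
  split=> //=; apply: le_trans (ler_edistD y' _ _) _; rewrite -dz'.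
  by have := edist_lipschitz y' y E0; rewrite enorm_distC; lra.
have [c] := @compact_EVT_min _ _ (fun w : 'rV[R]_n => enorm (y - w)) K K0 cK
  (continuous_subspaceT (@continuous_enorm_dist _ _ y)).
rewrite inE => -[_ [Ec rc]] cmin.
have yc : edist y E < enorm (y - c).
  rewrite lt_def edist_le// andbT; apply/negP => /eqP ec.
  have : nearest_points y E c by [].
  rewrite yz => /= cz'; move: rc; rewrite /= cz' subrr enorm0 leNgt; exact/negP/negPn.
exists (Num.min 1 ((enorm (y - c) - edist y E) / 2)).
  by rewrite lt_min ltr01 divr_gt0// subr_gt0.
move=> y' z'; rewrite lt_min => /andP[yy1 yy2] [Ez' dz'].
rewrite ltNge; apply/negP => rz'.
have h1 : enorm (y - z') <= edist y E + 2 * enorm (y - y').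
  apply: le_trans (ler_edistD y' _ _) _; rewrite -dz'.
  by have := edist_lipschitz y' y E0; rewrite enorm_distC; lra.
have /cmin : z' \in K by rewrite inE; split=> //=; lra.
by lra.
Qed.

(** Away from [E] the distance has slope one at points with a unique nearest
    point [z]: moving by [h] in the direction [y - z] hardly changes the nearest
    point, so that the distance grows by nearly [h]. *)
Lemma edist_slope E y r eps : closed E -> E !=set0 -> 0 < edist y E ->
  edist y E < r -> (forall x, edist x E < r -> Unp E x) ->
  0 < eps -> eps < 1 -> forall h, 0 < h -> exists y',
    [/\ 0 < enorm (y' - y), enorm (y' - y) <= h &
        (1 - eps) * enorm (y' - y) <= edist y' E - edist y E].
Proof.
move=> cE E0 dy0 dyr unp eps0 eps1 h h0.
have [z yz] := unp _ dyr.
have [Ez dz] : nearest_points y E z by rewrite yz.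
set d := edist y E in dy0 dyr dz *.
have ed0 : 0 < eps * d / 2 by rewrite divr_gt0// mulr_gt0.
have [eta eta0 near] := nearest_point_continuous cE yz ed0.
pose k := Num.min h (Num.min (eta / 2) ((r - d) / 2)).
have k0 : 0 < k by rewrite !lt_min h0 !divr_gt0// subr_gt0.
have [kh keta kr] : [/\ k <= h, k <= eta / 2 & k <= (r - d) / 2].
  by rewrite /k; split; rewrite !ge_min lexx ?orbT.
pose nu := d^-1 *: (y - z).
have nu1 : enorm nu = 1 by rewrite /nu enormZ -dz gtr0_norm ?invr_gt0// mulVf// gt_eqF.
pose y' := y + k *: nu.
have yy' : enorm (y' - y) = k by rewrite /y' addrC addKr enormZ nu1 mulr1 gtr0_norm.
exists y'; rewrite yy'; split=> //.
have [z' yz'] : Unp E y'.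
  apply: unp; apply: le_lt_trans (edist_lipschitz _ y E0) _; rewrite yy' -/d.
  by move: kr; lra.
have nz' : nearest_points y' E z' by rewrite yz'.
have zz' : enorm (z - z') < eps * d / 2.
  by apply: (near y') => //; rewrite enorm_distC yy'; lra.
have [Ez' ->] := nz'.
pose a := y - z'.
have -> : y' - z' = a + k *: nu by rewrite /y' /a addrAC.
have da : d <= enorm a by exact: edist_le.
have ad : enorm a <= d + eps * d / 2.
  by apply: le_trans (ler_edistD z _ _) _; rewrite -dz lerD2l ltW.
have a0 : 0 < enorm a by exact: lt_le_trans da.
have anu : d - eps * d / 2 <= dot a nu.
  have -> : a = (y - z) + (z - z') by rewrite addrA subrK.
  rewrite dotDl.
  have -> : dot (y - z) nu = d.
    by rewrite dotZr -sqr_enorm -dz; field; rewrite gt_eqF.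
  by have := normr_dot (z - z') nu; rewrite nu1 mulr1 ler_norml => /andP[+ _]; lra.
(* Cauchy-Schwarz: the norm lies above its tangent at [a]. *)
have := cauchy_schwarz a (a + k *: nu); rewrite dotDr dotZr -sqr_enorm => cs.
have h1 : (1 - eps) * enorm a <= dot a nu.
  apply: le_trans anu; apply: (@le_trans _ _ ((1 - eps) * (d + eps * d / 2))).
    by rewrite ler_wpM2l// subr_ge0 ltW.
  have : 0 <= eps * (eps * d) by rewrite !mulr_ge0 ?ltW.
  by lra.
have h2 : k * ((1 - eps) * enorm a) <= k * dot a nu by rewrite ler_pM2l.
have h3 : enorm a * d <= enorm a * enorm a by rewrite ler_pM2l.
rewrite -(ler_pM2l a0); lra.
Qed.

(** If every point closer to [E] than [t] has a unique nearest point, then the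
    only balls of radius [t] inside the open [t]-neighbourhood of [E] are those
    centred in [E]: from any other centre the distance can be increased at unit
    speed, by an Ekeland-type maximality argument, until it reaches [t]. *)
Lemma eroded_neighbourhood E x t : closed E -> E !=set0 -> 0 < t ->
  (forall y, edist y E < t -> Unp E y) ->
  (forall y, enorm (x - y) < t -> edist y E < t) -> E x.
Proof.
move=> cE E0 t0 unp ball_t; apply: edist_eq0 => //; apply/eqP.
rewrite eq_le edist_ge0// andbT leNgt; apply/negP => dx0.
set d := edist x E in dx0 *.
have dt : d < t by apply: ball_t; rewrite subrr enorm0.
pose rho := t - d / 2; pose eps := d / (2 * t).
have eps0 : 0 < eps by rewrite divr_gt0// mulr_gt0.
have eps1 : eps < 1 by rewrite ltr_pdivrMr ?mulr_gt0// mul1r; lra.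
have rho0 : 0 < rho by rewrite /rho; lra.
pose S : set 'rV[R]_n := [set y | enorm (x - y) <= rho] `&`
  [set y | 0 <= edist y E - d - (1 - eps) * enorm (x - y)].
have cS : compact S.
  apply: compact_closedI; first exact: compact_eball.
  apply: closed_superlevel => y; apply: (@cvgB _ _ _ (nbhs y)).
    by apply: (@cvgB _ _ _ (nbhs y)); [exact: continuous_edist|exact: cvg_cst].
  by apply: (@cvgM _ _ (nbhs y)); [exact: cvg_cst|exact: continuous_enorm_dist].
have Sx : S x by split; rewrite /= (subrr x) enorm0 ?mulr0 ?subr0 ?subrr// ltW.
have [y] := @compact_EVT_max _ _ (fun y : 'rV[R]_n => edist y E) S (ex_intro _ x Sx) cS
  (continuous_subspaceT (continuous_edist E0)).
rewrite inE => -[/= yrho yS] ymax.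
have yt : edist y E < t by apply: ball_t; rewrite /rho in yrho; lra.
have dy : d <= edist y E.
  have : 0 <= (1 - eps) * enorm (x - y) by rewrite mulr_ge0 ?enorm_ge0// subr_ge0 ltW.
  by lra.
have [yr|yr] := ltP (enorm (x - y)) rho; last first.
  have : (1 - eps) * rho <= edist y E - d.
    have : (1 - eps) * rho <= (1 - eps) * enorm (x - y).
      by rewrite ler_wpM2l// subr_ge0 ltW.
    by lra.
  have -> : (1 - eps) * rho = rho - d / 2 + eps * (d / 2).
    by rewrite /eps /rho; field; rewrite gt_eqF.
  have : 0 <= eps * (d / 2) by rewrite mulr_ge0 ?ltW// divr_gt0.
  by rewrite /rho; lra.
have h0 : 0 < rho - enorm (x - y) by rewrite subr_gt0.
have dy0 : 0 < edist y E by exact: lt_le_trans dy.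
have [y' [yy0 yy' slope]] := edist_slope cE E0 dy0 yt unp eps0 eps1 h0.
have xy' : enorm (x - y') <= enorm (x - y) + enorm (y' - y).
  by apply: le_trans (ler_edistD y _ _) _; rewrite (enorm_distC y).
have eps10 : 0 < 1 - eps by rewrite subr_gt0.
have : edist y' E <= edist y E.
  apply: ymax; rewrite inE; split=> /=; first by lra.
  have : (1 - eps) * enorm (x - y') <= (1 - eps) * (enorm (x - y) + enorm (y' - y)).
    by rewrite ler_pM2l.
  by lra.
by have := mulr_gt0 eps10 yy0; lra.
Qed.

Lemma lt_reach_Unp E t : closed E -> E !=set0 -> 0 < t -> (t%:E < reach E)%E ->
  forall y, edist y E < t -> Unp E y.
Proof.
move=> cE E0 t0 tE y /(edist_lt E0)[x Ex yx].
have : (t%:E < reach_at E x)%E.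
  by apply: lt_le_trans tE _; apply: ereal_inf_lbound; exists x.
rewrite /reach_at lt_max => /orP[|h]; first by rewrite lte_fin ltNge (ltW t0).
have [_ [r [r0 rU] <-]] := ereal_sup_gt h.
by rewrite lte_fin => tr; apply: rU; rewrite /eball /= enorm_distC; exact: lt_trans yx tr.
Qed.

End distance_and_reach.

(** * Measure-preserving maps *)

Section measure_preserving.
Local Open Scope ereal_scope.

Definition mpres d (T : measurableType d) (R : realType)
    (mu : {measure set T -> \bar R}) (f : T -> T) : Prop :=
  measurable_fun setT f /\ forall A, measurable A -> mu (f @^-1` A) = mu A.

Lemma measurable_preimageT d d' (T : measurableType d) (T' : measurableType d')
    (f : T -> T') A : measurable_fun setT f -> measurable A -> measurable (f @^-1` A).
Proof. by move=> mf mA; rewrite -[X in measurable X]setTI; exact: mf. Qed.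

Lemma mpres_ge0_integral d (T : measurableType d) (R : realType)
    (mu : {measure set T -> \bar R}) (f : T -> T) (h : T -> \bar R) :
  mpres mu f -> measurable_fun setT h -> (forall x, 0 <= h x) ->
  \int[mu]_x h (f x) = \int[mu]_x h x.
Proof.
move=> [mf pf] mh h0; transitivity (\int[pushforward mu f]_x h x).
  by rewrite ge0_integral_pushforward// => x _; exact: h0.
by apply: eq_measure_integral => A mA _; rewrite -[RHS]pf.
Qed.

Lemma mpres_integral d (T : measurableType d) (R : realType)
    (mu : {measure set T -> \bar R}) (f : T -> T) (h : T -> \bar R) :
  mpres mu f -> measurable_fun setT h ->
  \int[mu]_x h (f x) = \int[mu]_x h x.
Proof.
move=> pf mh; rewrite -[fun x => h (f x)]/(h \o f) integralE [RHS]integralE.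
rewrite funepos_comp funeneg_comp; congr (_ - _).
- exact: (mpres_ge0_integral pf (measurable_funepos mh)).
- exact: (mpres_ge0_integral pf (measurable_funeneg mh)).
Qed.

Lemma mpres_comp d (T : measurableType d) (R : realType)
    (mu : {measure set T -> \bar R}) (f g : T -> T) :
  mpres mu f -> mpres mu g -> mpres mu (f \o g).
Proof.
move=> [mf pf] [mg pg]; split; first exact: measurableT_comp.
by move=> A mA; rewrite comp_preimage pg ?pf//; exact: measurable_preimageT.
Qed.

Lemma mpres_pair d1 d2 (T1 : measurableType d1) (T2 : measurableType d2) (R : realType)
    (m1 : {sigma_finite_measure set T1 -> \bar R})
    (m2 : {sigma_finite_measure set T2 -> \bar R}) (f : T1 -> T1) (g : T2 -> T2) :
  mpres m1 f -> mpres m2 g -> mpres (m1 \x m2) (fun p => (f p.1, g p.2)).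
Proof.
move=> pf [mg pg]; have [mf _] := pf.
have mfg : measurable_fun setT (fun p : T1 * T2 => (f p.1, g p.2)).
  by apply: measurable_fun_pair; exact: measurableT_comp.
split => // A mA.
suff : \int[m1]_x (m2 \o xsection ((fun p => (f p.1, g p.2)) @^-1` A)) x =
  \int[m1]_x (m2 \o xsection A) x by [].
rewrite -[RHS](mpres_ge0_integral pf (measurable_fun_xsection m2 mA))//.
apply: eq_integral => x _ /=; rewrite -[RHS]pg; last exact: measurable_xsection.
by congr (m2 _); apply/seteqP; split=> y; rewrite /= !xsectionE.
Qed.

End measure_preserving.

(** * Invariance of the volume under translations and reflections *)

Section volume_invariance.
Context {R : realType}.

Lemma open_measurable_rV n (A : set 'rV[R]_n) : open A -> measurable A.
Proof. exact: sub_sigma_algebra. Qed.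

Lemma closed_measurable_rV n (A : set 'rV[R]_n) : closed A -> measurable A.
Proof.
move=> cA; rewrite -(setCK A); apply: measurableC; apply: open_measurable_rV.
by rewrite openC.
Qed.

Lemma continuous_measurable_rV n (f : 'rV[R]_n -> R) :
  continuous f -> measurable_fun setT f.
Proof.
move=> cf; apply: (measurability _ (RGenOInfty.measurableE R)) => _ [_ [a ->] <-].
rewrite setTI; apply: open_measurable_rV.
by apply: open_comp => [x _|]; [exact: cf|exact: interval_open].
Qed.

Lemma measurable_addr n (a : 'rV[R]_n) : measurable_fun setT (fun x : 'rV[R]_n => x + a).
Proof.
apply: measurable_fun_rV => i; under eq_fun do rewrite mxE.
by apply: measurable_funD => //; exact: measurable_coord.
Qed.

Lemma lebesgue_addr (a : R) :
  mpres (@lebesgue_measure R) (fun x : measurableTypeR R => x + a).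
Proof.
pose f (x : measurableTypeR R) : measurableTypeR R := x + a.
have mf : measurable_fun setT f by exact: measurable_funD.
split => // A mA.
rewrite [RHS](@lebesgue_measure_unique _ (pushforward (@lebesgue_measure R) f))//.
move=> _ [[x y] _ <-] /=.
rewrite /pushforward (_ : _ @^-1` _ = `]x - a, y - a]%classic); last first.
  by apply/seteqP; split=> z; rewrite /= !in_itv /= ltrBlDr lerBrDr.
by rewrite !lebesgue_measure_itv/= !lte_fin ltrD2r -!EFinD opprB addrA subrK.
Qed.

Lemma volume_addr n (a : 'rV[R]_n) : mpres (volume n) (fun x : 'rV[R]_n => x + a).
Proof.
elim: n a => [|n IH] a.
  by split=> [|A _]; [exact: measurable_addr|
    congr (_ _); apply/seteqP; split=> x; rewrite /= (thinmx0 a) addr0].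
split=> [|A mA]; first exact: measurable_addr.
have mA' : measurable (@rV_cons R n @^-1` A).
  by apply: measurable_preimageT => //; exact: measurable_rV_cons.
rewrite /= /volume_step /pushforward.
rewrite -[RHS](mpres_pair (lebesgue_addr (rV_uncons a).1) (IH (rV_uncons a).2)).2//.
congr (_ _); apply/seteqP.
have E (p : measurableTypeR R * 'rV[R]_n) : rV_cons p + a =
    rV_cons (p.1 + (rV_uncons a).1, p.2 + (rV_uncons a).2).
  apply/rowP => i; rewrite !mxE; case: splitP => j ji; rewrite !mxE.
    by congr (_ + a _ _); apply/val_inj; rewrite /= ji (ord1 j).
  by congr (_ + a _ _); exact/val_inj.
by split=> p; rewrite /preimage /= -E.
Qed.

Lemma measurable_box n (a b : 'rV[R]_n) :
  measurable [set x : 'rV[R]_n | forall i, a ord0 i <= x ord0 i <= b ord0 i].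
Proof.
rewrite [X in measurable X](_ : _ =
    \bigcap_(i : 'I_n) ((fun x : 'rV[R]_n => x ord0 i) @^-1` `[a ord0 i, b ord0 i])).
  apply: fin_bigcap_measurable => // i _.
  by apply: measurable_preimageT => //; exact: measurable_coord.
by apply/seteqP; split=> [x /= H i _|x H i]; [rewrite /= in_itv/=|
  have := H i I; rewrite /= in_itv].
Qed.

Lemma volume_bounded_lty n (A : set 'rV[R]_n) r : measurable A ->
  (forall x, A x -> enorm x <= r) -> (volume n A < +oo)%E.
Proof.
move=> mA Ar.
have [r0|r0] := leP 0 r; last first.
  have -> : A = set0.
    by apply/seteqP; split=> // x /Ar; rewrite leNgt (lt_le_trans r0 (enorm_ge0 _)).
  by rewrite measure0.
pose b : 'rV[R]_n := const_mx r.
apply: (@le_lt_trans _ _ (volume n [set x | forall i, (- b) ord0 i <= x ord0 i <= b ord0 i])).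
  apply: le_measure; rewrite ?inE//; first exact: measurable_box.
  move=> x /Ar xr i; rewrite !mxE -ler_norml.
  exact: le_trans (coord_le_enorm _ _) xr.
by rewrite volume_box ?ltry// => i; rewrite !mxE; lra.
Qed.

Lemma volume_open_gt0 n (A : set 'rV[R]_n) : open A -> A !=set0 -> (0 < volume n A)%E.
Proof.
move=> oA [x Ax]; have [r r0 rA] := (open_eballP A).1 oA x Ax.
pose c := r / n.+1%:R; have c0 : 0 < c by rewrite divr_gt0.
pose b : 'rV[R]_n := const_mx c.
pose box := [set y : 'rV[R]_n | forall i, (x - b) ord0 i <= y ord0 i <= (x + b) ord0 i].
apply: (@lt_le_trans _ _ (volume n box)).
  rewrite volume_box; last by move=> i; rewrite !mxE; lra.
  by rewrite lte_fin; apply: prodr_gt0 => i _; rewrite !mxE; lra.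
apply: le_measure; rewrite ?inE//.
- exact: measurable_box.
- exact: open_measurable_rV.
move=> y yb; apply: rA; apply: le_lt_trans (enorm_le_mx_norm _) _.
apply: (@le_lt_trans _ _ (n%:R * c)).
  rewrite ler_wpM2l// /normr /= mx_normrE; apply: bigmax_le => [|[i j] _ /=]; first exact: ltW.
  by have := yb j; rewrite (ord1 i) !mxE ler_norml; lra.
by rewrite /c mulrA ltr_pdivrMr// mulrC ltr_pM2l// ltr_nat.
Qed.

Lemma measurable_eball n (x : 'rV[R]_n) r : measurable (eball x r).
Proof. by apply: open_measurable_rV; exact: open_eball. Qed.

Lemma mule_injr (a b c : \bar R) : c \is a fin_num -> (0 < c)%E ->
  (a * c = b * c)%E -> a = b.
Proof.
move=> cfin c0 abc; apply/eqP; rewrite eq_le.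
by rewrite -(lee_pmul2r cfin c0) abc lexx -(lee_pmul2r cfin c0) abc lexx.
Qed.

(** The unit ball [B] is its own mirror image and [refl e 0] is linear.  Hence
    Tonelli's theorem evaluates the integral of the indicator of [A x] and
    [B (x - refl e 0 z)] as [mu A * mu B] and, after translating the first
    variable by [refl e 0 z], also as [mu B * mu (refl e 0 @^-1` A)]. *)
Lemma translation_invariant_refl n (mu : {sigma_finite_measure set 'rV[R]_n -> \bar R})
    (e : 'rV[R]_n) : enorm e = 1 -> (forall a, mpres mu (fun x : 'rV[R]_n => x + a)) ->
  (0 < mu (eball 0%R 1))%E -> (mu (eball 0%R 1) < +oo)%E -> mpres mu (refl e 0).
Proof.
move=> e1 mu_addr B0 Boo.
have mr : measurable_fun setT (refl e 0).
  apply: measurable_fun_rV => i; under eq_fun do rewrite !mxE.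
  apply: measurable_funD; first exact: measurable_coord.
  apply: measurable_funM => //; apply: measurable_funM => //.
  apply: measurable_funB => //; apply: continuous_measurable_rV.
  exact: continuous_dot.
split=> // A mA; set rho := refl e 0.
pose B := eball (0 : 'rV[R]_n) 1; have mB : measurable B by exact: measurable_eball.
have mrA : measurable (rho @^-1` A) by exact: measurable_preimageT.
have rhoD x y : rho (x + y) = rho x + rho y.
  by rewrite /rho /refl dotDl !sub0r opprD mulrDr scalerDl addrACA.
have rhoK x : rho (rho x) = x by exact: reflK.
pose f (p : 'rV[R]_n * 'rV[R]_n) : \bar R := (\1_A p.1 * \1_B (p.1 - rho p.2))%:E.
pose g (p : 'rV[R]_n * 'rV[R]_n) : \bar R := (\1_A (p.1 + rho p.2) * \1_B p.1)%:E.
have mprho : measurable_fun setT (fun p : 'rV[R]_n * 'rV[R]_n => rho p.2).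
  exact: measurableT_comp mr measurable_snd.
have coordp i : measurable_fun setT (fun p : 'rV[R]_n * 'rV[R]_n => p.1 ord0 i).
  exact: (measurableT_comp (measurable_coord i) measurable_fst).
have coordr i : measurable_fun setT (fun p : 'rV[R]_n * 'rV[R]_n => (rho p.2) ord0 i).
  exact: (measurableT_comp (measurable_coord i) mprho).
have mi (C : set 'rV[R]_n) d (T : measurableType d) (h : T -> 'rV[R]_n) :
    measurable C -> measurable_fun setT h ->
    measurable_fun setT (fun x => \1_C (h x) : R).
  by move=> mC mh; apply: (measurableT_comp (measurable_indic mC) mh).
have mf : measurable_fun setT f.
  apply/measurable_EFinP; apply: measurable_funM; apply: mi => //.
  apply: measurable_fun_rV => i; under eq_fun do rewrite mxE.
  apply: measurable_funD => //; under eq_fun do rewrite mxE.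
  exact: measurable_funN.
have mg : measurable_fun setT g.
  apply/measurable_EFinP; apply: measurable_funM; apply: mi => //.
  apply: measurable_fun_rV => i; under eq_fun do rewrite mxE.
  exact: measurable_funD.
have f0 p : (0 <= f p)%E by rewrite lee_fin mulr_ge0.
have g0 p : (0 <= g p)%E by rewrite lee_fin mulr_ge0.
have step1 : (\int[mu]_x \int[mu]_z f (x, z) = mu A * mu B)%E.
  transitivity (\int[mu]_x ((mu B) * (\1_A x)%:E))%E.
    apply: eq_integral => x _.
    transitivity (\int[mu]_z ((\1_A x)%:E * (\1_(eball (rho x) 1) z)%:E))%E.
      apply: eq_integral => z _; rewrite /f -EFinM; congr (_ * _)%:E.
      rewrite !indicE; congr (_ : bool)%:R; apply/idP/idP; rewrite !inE /B /eball /=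
         sub0r enormN /rho -enorm_refl_swap//.
    rewrite ge0_integralZl_EFin//; last first.
      by apply/measurable_EFinP; apply: measurable_indic; exact: measurable_eball.
    rewrite integral_indic//; last exact: measurable_eball.
    rewrite setIT muleC; congr (_ * _)%E.
    rewrite -((mu_addr (rho x)).2 (eball (rho x) 1)); last exact: measurable_eball.
    congr (_ _); apply/seteqP.
    by split=> y; rewrite /B /eball /= sub0r -opprB addrK.
  rewrite (@ge0_integralZl _ _ _ _ _ measurableT (fun x => (\1_A x)%:E))//.
    by rewrite integral_indic// setIT muleC.
  by apply/measurable_EFinP; exact: measurable_indic.
have step2 : (\int[mu]_x \int[mu]_z g (x, z) = mu (rho @^-1` A) * mu B)%E.
  transitivity (\int[mu]_x ((mu (rho @^-1` A)) * (\1_B x)%:E))%E.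
    apply: eq_integral => x _.
    transitivity (\int[mu]_z ((\1_B x)%:E * (\1_(rho @^-1` A) (z + rho x))%:E))%E.
      apply: eq_integral => z _; rewrite /g -EFinM mulrC; congr (_ * _)%:E.
      rewrite !indicE; congr (_ : bool)%:R; apply/idP/idP; rewrite !inE /=
         rhoD rhoK addrC//.
    rewrite ge0_integralZl_EFin//; last by apply/measurable_EFinP/mi => //; exact: measurable_addr.
    rewrite (mpres_ge0_integral (mu_addr (rho x)) (h := fun z => (\1_(rho @^-1` A) z)%:E))//; last first.
      by apply/measurable_EFinP; exact: measurable_indic.
    by rewrite integral_indic// setIT muleC.
  rewrite (@ge0_integralZl _ _ _ _ _ measurableT (fun x => (\1_B x)%:E))//.
    by rewrite integral_indic// setIT.
  by apply/measurable_EFinP; exact: measurable_indic.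
have fg : (\int[mu]_x \int[mu]_z f (x, z) = \int[mu]_x \int[mu]_z g (x, z))%E.
  have FT h : measurable_fun setT h -> (forall p, 0 <= h p)%E ->
      (\int[mu]_x \int[mu]_z h (x, z) = \int[mu]_z \int[mu]_x h (x, z))%E.
    by move=> mh h0; exact: (@fubini_tonelli _ _ _ _ R mu mu h mh h0).
  apply: (etrans (FT f mf f0)); apply: (etrans _ (esym (FT g mg g0))).
  apply: eq_integral => z _.
  have mfz : measurable_fun setT (fun x => f (x, z)).
    exact: (measurableT_comp mf (measurable_pair2 z)).
  apply: (etrans (esym (mpres_ge0_integral (mu_addr (rho z)) mfz (fun x => f0 (x, z))))).
  by apply: eq_integral => x _; rewrite /f /g /= addrK.
have Bfin : mu B \is a fin_num by rewrite ge0_fin_numE.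
apply: (mule_injr Bfin B0).
exact: (etrans (esym step2) (etrans (esym fg) step1)).
Qed.

Lemma volume_refl n (e : 'rV[R]_n) l : enorm e = 1 -> mpres (volume n) (refl e l).
Proof.
move=> e1.
rewrite (_ : refl e l = (fun x => x + (2 * l) *: e) \o refl e 0).
  apply: mpres_comp; first exact: volume_addr.
  apply: translation_invariant_refl => //; first exact: volume_addr.
    apply: volume_open_gt0; first exact: open_eball.
    by exists 0; rewrite /eball /= subrr enorm0.
  apply: (volume_bounded_lty (r := 1)); first exact: measurable_eball.
  by move=> x; rewrite /eball /= sub0r enormN => /ltW.
by apply/funext => x; rewrite (refl_shift e 0 l) /= subr0.
Qed.
End volume_invariance.

(** * The critical position of the moving plane *)

Section critical_position.
Context {R : realType} {n : nat}.
Implicit Types (x y q e : 'rV[R]_n) (t l d m : R).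

Lemma continuous_edist_line (Omega : set 'rV[R]_n) x e : Omega !=set0 ->
  enorm e = 1 -> continuous (fun b : R => edist (x + b *: e) Omega).
Proof.
move=> O0 e1 b; apply/cvgrPdist_lt => eps eps0; exists eps => //= b' bb'.
apply: le_lt_trans bb'; rewrite ler_norml; apply/andP.
have E c c' : enorm (x + c *: e - (x + c' *: e)) = `|c - c'|.
  by rewrite opprD addrACA subrr add0r -scalerBl enormZ e1 mulr1.
have := edist_lipschitz (x + b *: e) (x + b' *: e) O0.
have := edist_lipschitz (x + b' *: e) (x + b *: e) O0.
by rewrite !E (distrC b'); split; lra.
Qed.

(** Along the half-line the distance is continuous, and it is large far away
    because [Omega] is bounded. *)
Lemma exit_point (Omega : set 'rV[R]_n) t e x M : Omega !=set0 ->
  (forall y, Omega y -> enorm y <= M) -> enorm e = 1 -> edist x Omega < t ->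
  exists2 b : R, 0 < b & outer_parallel Omega t (x + b *: e).
Proof.
move=> O0 OM e1 xt.
pose B := enorm x + M + `|t|.
have B0 : 0 <= B.
  have [y Oy] := O0.
  by rewrite /B !addr_ge0 ?enorm_ge0// (le_trans (enorm_ge0 y)) ?OM.
have tB : t <= edist (x + B *: e) Omega.
  apply: edist_ge => // y Oy.
  have := ler_enormD (x + B *: e - y) (y - x).
  rewrite (_ : _ + (y - x) = B *: e); last first.
    by rewrite addrA subrK addrAC subrr add0r.
  rewrite enormZ e1 mulr1 ger0_norm// => h.
  have := ler_enormD y (- x); rewrite enormN => h'.
  by have := OM y Oy; have := ler_norm t; rewrite /B in h *; lra.
have [||b] := @IVT R (fun b : R => edist (x + b *: e) Omega) 0 B t B0.
- exact/continuous_subspaceT/continuous_edist_line.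
- by rewrite scale0r addr0 ge_min (ltW xt) /= le_max tB orbT.
rewrite in_itv /= => /andP[b0 _] bt; exists b => //.
rewrite lt_def b0 andbT; apply/eqP => b00.
by move: xt; rewrite -bt b00 scale0r addr0 ltxx.
Qed.

(** A hyperplane orthogonal to [e] above all these heights bisects no chord of the
    parallel set in direction [e]. *)
Definition chord_heights (Omega : set 'rV[R]_n) t e : set R :=
  [set m | exists q d, [/\ 0 < d, outer_parallel Omega t q,
    outer_parallel Omega t (q + d *: e) & m = dot q e + d / 2]].

Definition critical_height (Omega : set 'rV[R]_n) t e : R :=
  sup (chord_heights Omega t e).

Section fixed_direction.
Context (Omega : set 'rV[R]_n) (t : R) (e : 'rV[R]_n) (M : R).
Context (O0 : Omega !=set0) (OM : forall y, Omega y -> enorm y <= M)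
  (t0 : 0 < t) (e1 : enorm e = 1).
Local Notation Gamma := (outer_parallel Omega t).
Local Notation crit := (critical_height Omega t e).

Lemma parallel_bounded q : Gamma q -> enorm q <= M + t + 1.
Proof.
move=> qt; have [y Oy yt] : exists2 y, Omega y & enorm (q - y) < t + 1.
  by apply: edist_lt => //; rewrite qt; lra.
by have := ler_enormD (q - y) y; rewrite subrK; have := OM Oy; lra.
Qed.

Lemma closed_parallel : closed Gamma.
Proof.
have -> : Gamma = [set x | edist x Omega <= t] `&` [set x | t <= edist x Omega].
  apply/seteqP; split=> x /=; first by rewrite /outer_parallel /= => ->.
  by move=> [? ?]; apply/eqP; rewrite eq_le; apply/andP.
by apply: closedI; [apply: closed_sublevel|apply: closed_superlevel]; exact: continuous_edist.
Qed.

Lemma chord_heights_has_sup : has_sup (chord_heights Omega t e).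
Proof.
split; last first.
  exists (M + t + 1) => m [q [d [d0 Gq Gp ->]]].
  have := parallel_bounded Gq; have := parallel_bounded Gp.
  have := cauchy_schwarz q e; have := cauchy_schwarz (q + d *: e) e.
  rewrite e1 !mulr1 !dotE -sqr_enorm e1; lra.
have [x Ox] := O0.
have xt : edist x Omega < t.
  by apply: le_lt_trans (edist_le _ Ox) _; rewrite subrr enorm0.
have [b b0 Gb] := exit_point O0 OM e1 xt.
have e1' : enorm (- e) = 1 by rewrite enormN.
have [a a0 Ga] := exit_point O0 OM e1' xt.
eexists; exists (x + a *: - e), (a + b); split; [lra|by []| |by []].
by rewrite scalerN scalerDl addrA subrK.
Qed.

Lemma chord_height_le_crit q d : 0 < d -> Gamma q -> Gamma (q + d *: e) ->
  dot q e + d / 2 <= crit.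
Proof.
move=> d0 Gq Gp; apply: ub_le_sup; first by case: chord_heights_has_sup.
by exists q, d.
Qed.

(** Otherwise the segment from the mirror image up to [y] meets the parallel set,
    and so does the half-line above [y]; the midpoint of the chord in between is
    higher than [l]. *)
Lemma neighbourhood_reflected l y : crit <= l -> l < dot y e ->
  edist y Omega < t -> edist (refl e l y) Omega < t.
Proof.
move=> critl ly yt; rewrite ltNge; apply/negP => y't.
pose y' := refl e l y; pose D := 2 * (dot y e - l).
have D0 : 0 <= D by rewrite /D; lra.
have yE : y = y' + D *: e.
  by rewrite /y' /refl -addrA -scalerDl (_ : _ + D = 0) ?scale0r ?addr0// /D; ring.
have [||a] := @IVT R (fun b : R => edist (y' + b *: e) Omega) 0 D t D0.
- exact/continuous_subspaceT/continuous_edist_line.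
- by rewrite scale0r addr0 -yE ge_min (ltW yt) orbT /= le_max y't.
rewrite in_itv /= => /andP[a0 aD] Ga.
have [b b0 Gb] := exit_point O0 OM e1 yt.
have d0 : 0 < D - a + b by lra.
have Gp : Gamma (y' + a *: e + (D - a + b) *: e).
  rewrite (_ : _ + _ = y + b *: e)// yE -(addrA y') -(addrA y') -!scalerDl.
  by congr (_ + _ *: _); ring.
have := chord_height_le_crit d0 Ga Gp.
rewrite dotDl dotZl -(sqr_enorm e) e1 /y' dot_refl//.
by move: critl b0 a0; rewrite /D; lra.
Qed.

(** Let [z] be a point of the cap and [y] a point closer than [t] to its mirror
    image.  If [y] is above the hyperplane, it is closer to [z] than to the mirror
    image; if it is below, its mirror image is closer than [t] to [z], so that
    [neighbourhood_reflected] applies to it.  In both cases [y] is closer than [t]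
    to [Omega], and the reach puts the mirror image of [z] in the closure of
    [Omega].  Passing to interiors concludes, because the cap is open. *)
Lemma cap_reflected l x : regopen Omega -> (t%:E < reach (closure Omega))%E ->
  crit <= l -> Omega x -> l < dot x e -> Omega (refl e l x).
Proof.
move=> rO tr critl.
have O1 : Omega = (closure Omega)^° by rewrite -[LHS]rO.
have oO : open Omega by rewrite O1; exact: open_interior.
have cO0 : closure Omega !=set0.
  by have [z Oz] := O0; exists z; exact: subset_closure.
have cap z : Omega z -> l < dot z e -> closure Omega (refl e l z).
  move=> Oz lz.
  apply: (eroded_neighbourhood _ cO0 t0); first exact: closed_closure.
    by apply: lt_reach_Unp => //; exact: closed_closure.
  move=> y yz; rewrite edist_closure//.
  have [yl|ly] := leP (dot y e) l.
    have [yl'|yl'] := ltP (dot y e) l; last first.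
      (* on the hyperplane [y] is its own mirror image *)
      have yE : dot y e = l by apply/eqP; rewrite eq_le yl.
      apply: le_lt_trans (edist_le _ Oz) _.
      by rewrite -(refl_fix yE) enorm_refl_swap // enorm_distC.
    rewrite -(reflK l e1 y); apply: neighbourhood_reflected => //.
      by rewrite dot_refl//; lra.
    apply: le_lt_trans (edist_le _ Oz) _.
    by rewrite enorm_refl_swap // enorm_distC.
  apply: le_lt_trans (edist_le _ Oz) _.
  apply: le_lt_trans yz; rewrite enorm_distC ler_enorm dot_sub_refl//.
  have : 0 <= (dot z e - l) * (dot y e - l) by rewrite mulr_ge0 ?subr_ge0 ?ltW.
  by lra.
move=> Ox lx; rewrite O1.
have [r r0 rO'] : exists2 r, 0 < r & eball x r `<=` Omega `&` [set z | l < dot z e].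
  apply: (open_eballP _).1 => //; apply: openI => //.
  have := @open_sublevel R n (fun z => - dot z e) (- l).
  rewrite (_ : [set z | - dot z e < - l] = [set z | l < dot z e]); last first.
    by apply/seteqP; split=> z /=; rewrite ltrN2.
  by apply => z; apply: (@cvgN _ _ _ (nbhs z)); exact: continuous_dot.
apply/nbhs_eballP; exists r => // y; rewrite /eball /= enorm_refl_swap// => yr.
have [Oy ly] := rO' _ yr.
by rewrite -(reflK l e1 y); exact: cap.
Qed.

(** Chords with heights tending to the critical one accumulate at a chord, or
    at a point in case their lengths tend to zero. *)
Lemma critical_chord : exists q d (q_ : nat -> 'rV[R]_n) (d_ : nat -> R),
  [/\ Gamma q, Gamma (q + d *: e), 0 <= d & dot q e + d / 2 = crit] /\
  forall k, [/\ 0 < d_ k, Gamma (q_ k), Gamma (q_ k + d_ k *: e),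
    enorm (q - q_ k) < k.+1%:R^-1 & `|d - d_ k| < k.+1%:R^-1].
Proof.
have hs := chord_heights_has_sup.
have approx (k : nat) : exists p : 'rV[R]_n * R, [/\ 0 < p.2, Gamma p.1,
    Gamma (p.1 + p.2 *: e) & crit - k.+1%:R^-1 < dot p.1 e + p.2 / 2].
  have k0 : 0 < (k.+1%:R^-1 : R) by rewrite invr_gt0.
  have [_ [q [d [d0 Gq Gp ->]]] h] := sup_adherent k0 hs.
  by exists (q, d).
have [z zP] := choice approx.
pose L := M + t + 1.
have dle q d : 0 < d -> Gamma q -> Gamma (q + d *: e) -> d <= L + L.
  move=> d0 Gq Gp; have := parallel_bounded Gq; have := parallel_bounded Gp.
  have := ler_enormD (q + d *: e) (- q).
  rewrite addrAC subrr add0r enormN enormZ e1 mulr1 gtr0_norm// /L; lra.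
pose K : set ('rV[R]_n * R) := [set y | enorm (0 - y) <= L] `*` `[0, L + L].
have cK : compact K.
  by apply: compact_setX; [exact: compact_eball|exact: segment_compact].
have FK : (z @ \oo) K.
  exists 0%N => // k _; have [d0 Gq Gp _] := zP k; split => /=.
    by rewrite sub0r enormN; exact: parallel_bounded.
  by rewrite in_itv /= ltW// (dle _ _ _ Gq Gp).
have [[q d] [[_ /=]]] := cK _ _ FK; rewrite in_itv /= => /andP[d0 _] qd.
have near (k : nat) : exists j, [/\ (k <= j)%N, enorm (q - (z j).1) < k.+1%:R^-1 &
    `|d - (z j).2| < k.+1%:R^-1].
  have k0 : 0 < (k.+1%:R^-1 : R) by rewrite invr_gt0.
  have nqd : nbhs (q, d) (eball q k.+1%:R^-1 `*` ball d k.+1%:R^-1).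
    exists (eball q k.+1%:R^-1, ball d k.+1%:R^-1) => //; split => /=.
      by apply/nbhs_eballP; exists k.+1%:R^-1.
    exact: nbhsx_ballx.
  have Fk : (z @ \oo) [set z j | j in [set j | (k <= j)%N]].
    by exists k => // j kj; exists j.
  by have [_ [[j kj <-] [qj dj]]] := qd _ _ Fk nqd; exists j.
have [j jP] := choice near.
pose q_ k := (z (j k)).1; pose d_ k := (z (j k)).2.
have qdP k : [/\ 0 < d_ k, Gamma (q_ k), Gamma (q_ k + d_ k *: e),
    enorm (q - q_ k) < k.+1%:R^-1 & `|d - d_ k| < k.+1%:R^-1].
  by have [d0' Gq Gp _] := zP (j k); have [_ ? ?] := jP k.
have ckP k : crit - k.+1%:R^-1 < dot (q_ k) e + d_ k / 2.
  have [_ _ _ ck] := zP (j k); apply: le_lt_trans ck; rewrite lerD2l lerN2.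
  by rewrite lef_pV2 ?posrE// ler_nat ltnS; have [] := jP k.
move: q_ d_ qdP ckP => {z zP FK qd near j jP} q_ d_ qdP ckP.
have close (r : R) : 0 < r -> exists k, [/\ 0 < d_ k, Gamma (q_ k),
    Gamma (q_ k + d_ k *: e), enorm (q - q_ k) < r & `|d - d_ k| < r] /\
    crit - r < dot (q_ k) e + d_ k / 2.
  move=> r0; have [k _ /(_ k (leqnn k)) /= kr] := near_infty_natSinv_lt (PosNum r0).
  exists k; have [? ? ? qk dk] := qdP k; split; first split => //.
  - exact: lt_trans kr.
  - exact: lt_trans kr.
  - by apply: lt_trans (ckP k); rewrite ltrD2l ltrN2.
exists q, d, q_, d_; split=> //; split=> //.
- apply: closed_parallel; apply/closure_eballP => r /close[k [[_ Gq _ qk _] _]].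
  by exists (q_ k).
- apply: closed_parallel; apply/closure_eballP => r r0.
  have r2 : 0 < r / 2 by lra.
  have [k [[_ _ Gp qk dk] _]] := close _ r2; exists (q_ k + d_ k *: e) => //.
  rewrite opprD addrACA -scalerBl; apply: le_lt_trans (ler_enormD _ _) _.
  by rewrite enormZ e1 mulr1; lra.
apply/eqP; rewrite eq_le; apply/andP; split; apply/ler_addgt0Pr => r r0.
  have r2 : 0 < r / 2 by lra.
  have [k [[dk0 Gq Gp qk dk] _]] := close _ r2.
  have := chord_height_le_crit dk0 Gq Gp.
  have := normr_dot (q - q_ k) e; rewrite e1 mulr1 dotDl dotNl.
  move: dk; rewrite ltr_norml ler_norml => /andP[_ dk] /andP[_ qe]; lra.
have r3 : 0 < r / 3 by lra.
have [k [[dk0 Gq Gp qk dk] ck]] := close _ r3.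
have := normr_dot (q - q_ k) e; rewrite e1 mulr1 dotDl dotNl.
move: dk ck; rewrite ltr_norml ler_norml => /andP[dk _] ck /andP[qe _]; lra.
Qed.

End fixed_direction.
End critical_position.

(** * Sets symmetric in every direction *)

Section symmetric_sets.
Context {R : realType} {n : nat}.
Implicit Types (x y c e : 'rV[R]_n) (l r : R).

Definition symmetric_at (Omega : set 'rV[R]_n) e l : Prop :=
  forall x, Omega x -> Omega (refl e l x).

Lemma enorm_delta (i : 'I_n) : enorm (delta_mx 0 i : 'rV[R]_n) = 1.
Proof.
rewrite enormE /dot (bigD1 i)//= big1 ?addr0 => [|j ji].
  by rewrite mxE !eqxx mulr1 sqrtr1.
by rewrite mxE (negPf ji) mulr0.
Qed.

Lemma dot_delta x (i : 'I_n) : dot x (delta_mx 0 i) = x ord0 i.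
Proof.
rewrite /dot (bigD1 i)//= big1 ?addr0 => [|j ji]; rewrite mxE ?eqxx ?mulr1//.
by rewrite (negPf ji) mulr0.
Qed.

(** The reflections in the coordinate hyperplanes through [c] compose to the
    reflection in the point [c]. *)
Lemma coordinate_symmetric_central (Omega : set 'rV[R]_n) c :
  (forall i, symmetric_at Omega (delta_mx 0 i) (c ord0 i)) ->
  forall x, Omega x -> Omega (2 *: c - x).
Proof.
move=> sym x Ox.
have step (s : seq 'I_n) : uniq s ->
    Omega (x + \sum_(i <- s) (2 * (c ord0 i - x ord0 i)) *: delta_mx 0 i).
  elim: s => [_|i s IH /= /andP[iNs us]]; first by rewrite big_nil addr0.
  have := sym i _ (IH us); rewrite /refl big_cons dot_delta.
  have -> : (x + \sum_(j <- s) (2 * (c ord0 j - x ord0 j)) *: delta_mx 0 j :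
      'rV[R]_n) ord0 i = x ord0 i.
    rewrite mxE summxE big_seq big1 ?addr0// => j js.
    rewrite !mxE (_ : i == j = false) ?andbF ?mulr0//.
    by apply/negP => /eqP ij; move: iNs; rewrite ij js.
  by rewrite -addrA (addrC (\sum_(_ <- _) _)).
have := step (index_enum 'I_n) (index_enum_uniq _).
rewrite (_ : x + _ = 2 *: c - x)//.
apply/rowP => j; rewrite !mxE summxE (bigD1 j)//= big1 ?addr0 => [|i ij].
  by rewrite !mxE !eqxx mulr1 ; ring.
by rewrite !mxE eq_sym (negPf ij) mulr0.
Qed.

(** Two parallel hyperplanes of symmetry would make a bounded set invariant
    under a translation. *)
Lemma symmetric_through_center (Omega : set 'rV[R]_n) c e l M : Omega !=set0 ->
  (forall x, Omega x -> enorm x <= M) -> (forall x, Omega x -> Omega (2 *: c - x)) ->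
  enorm e = 1 -> symmetric_at Omega e l -> l = dot c e.
Proof.
move=> [x Ox] OM symc e1 syml.
have trans y : Omega y -> Omega (y + (4 * (l - dot c e)) *: e).
  move=> Oy.
  suff <- : refl e l (2 *: c - refl e l (2 *: c - y)) = y + (4 * (l - dot c e)) *: e.
    by apply/syml/symc/syml/symc.
  apply/rowP => i; rewrite /refl !dotE -(sqr_enorm e) e1 !mxE; ring.
have transk k : Omega (x + k%:R *: ((4 * (l - dot c e)) *: e)).
  elim: k => [|k IH]; first by rewrite scale0r addr0.
  by rewrite -natr1 scalerDl scale1r addrA; exact: trans.
apply/eqP; rewrite -subr_eq0; apply: contrapT => /negP lc.
have d0 : 0 < `|4 * (l - dot c e)| by rewrite normr_gt0 mulf_neq0// pnatr_eq0.
have bnd k : k%:R * `|4 * (l - dot c e)| <= M + M.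
  have := ler_enormD (x + k%:R *: ((4 * (l - dot c e)) *: e)) (- x).
  rewrite addrAC subrr add0r enormN !enormZ e1 mulr1 normr_nat.
  by have := OM _ (transk k); have := OM _ Ox; lra.
have := bnd (Num.truncn ((M + M) / `|4 * (l - dot c e)|)).+1.
rewrite leNgt -ltr_pdivrMr// truncnS_gt//.
Qed.

(** The reflections in the coordinate directions give a centre of symmetry [c],
    through which all the hyperplanes of symmetry pass.  The reflections through
    [c] make [Omega] a union of spheres about [c] ([rot]); the reflections of caps
    in hyperplanes beyond [c] bring a point of [Omega] to any smaller distance
    from [c] ([shrink]); openness excludes a largest distance ([up]). *)
Lemma symmetric_ball (Omega : set 'rV[R]_n) M : (0 < n)%N -> Omega !=set0 ->
  open Omega -> (forall x, Omega x -> enorm x <= M) ->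
  (forall e, enorm e = 1 -> exists2 l, symmetric_at Omega e l &
    forall l' x, l <= l' -> Omega x -> l' < dot x e -> Omega (refl e l' x)) ->
  exists (x0 : 'rV[R]_n) (r : R), 0 < r /\ Omega = eball x0 r.
Proof.
move=> n0 O0 oO OM sym.
have /choice[l_ l_P] : forall i : 'I_n, exists l, symmetric_at Omega (delta_mx 0 i) l.
  move=> i.
  by have [l syml _] := sym _ (enorm_delta i); exists l.
pose c : 'rV[R]_n := \row_i l_ i.
have symc : forall x, Omega x -> Omega (2 *: c - x).
  by apply: coordinate_symmetric_central => i; rewrite mxE.
have {}sym e : enorm e = 1 -> symmetric_at Omega e (dot c e) /\
    forall l' x, dot c e <= l' -> Omega x -> l' < dot x e -> Omega (refl e l' x).
  move=> e1; have [l syml cap] := sym _ e1.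
  by have <- := symmetric_through_center O0 OM symc e1 syml.
have unit (z : 'rV[R]_n) : z != 0 -> enorm ((enorm z)^-1 *: z) = 1.
  move=> z0; rewrite enormZ ger0_norm ?invr_ge0 ?enorm_ge0//.
  by rewrite mulVf// enorm_eq0.
have rot x y : Omega x -> enorm (x - c) = enorm (y - c) -> Omega y.
  move=> Ox xy; have [<-//|nxy] := eqVneq x y.
  have xy0 : x - y != 0 by rewrite subr_eq0.
  have N0 : enorm (x - y) != 0 by rewrite enorm_eq0.
  have [syme _] := sym _ (unit _ xy0); have := syme _ Ox.
  have E : dot x x - 2 * dot c x = dot y y - 2 * dot c y.
    have := congr1 (fun a => a ^+ 2) xy.
    rewrite !sqr_enorm !dotE (dotC x c) (dotC y c); lra.
  have E2 : enorm (x - y) ^+ 2 = 2 * (dot x (x - y) - dot c (x - y)).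
    rewrite sqr_enorm !dotE (dotC y x); lra.
  move: (enorm (x - y)) N0 E2 => N N0 E2.
  have -> : refl (N^-1 *: (x - y)) (dot c (N^-1 *: (x - y))) x = y; last by [].
  rewrite /refl scalerA !dotZr.
  have -> : 2 * (N^-1 * dot c (x - y) - N^-1 * dot x (x - y)) * N^-1 = -1.
    move: (dot x (x - y)) (dot c (x - y)) E2 => P Q E2.
    have -> : 2 * (N^-1 * Q - N^-1 * P) * N^-1 = - (2 * (P - Q)) / N ^+ 2 by field.
    by rewrite -E2 mulNr divff// expf_neq0.
  by rewrite scaleN1r opprB addrCA subrr addr0.
have shrink x r : Omega x -> 0 <= r -> r < enorm (x - c) ->
    exists2 y, Omega y & enorm (y - c) = r.
  move=> Ox r0 rx.
  have xc0 : x - c != 0 by rewrite -enorm_gt0; exact: le_lt_trans rx.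
  have N0 : enorm (x - c) != 0 by rewrite enorm_eq0.
  pose e := (enorm (x - c))^-1 *: (x - c).
  have e1 : enorm e = 1 by exact: unit.
  have xe : x - c = enorm (x - c) *: e by rewrite scalerA divff// scale1r.
  have xce : dot x e = dot c e + enorm (x - c).
    apply/eqP; rewrite addrC -subr_eq -dotNl -dotDl.
    by rewrite {1}xe dotZl -sqr_enorm e1 expr1n mulr1.
  pose l' := dot c e + (enorm (x - c) + r) / 2.
  exists (refl e l' x).
    by apply: (sym _ e1).2 => //; rewrite /l' ?xce; lra.
  rewrite /refl addrAC {1}xe -scalerDl enormZ e1 mulr1 /l' xce.
  by rewrite ger0_norm; lra.
have down x y : Omega x -> enorm (y - c) <= enorm (x - c) -> Omega y.
  move=> Ox; rewrite le_eqVlt => /orP[/eqP yx|yx]; first exact: rot Ox (esym yx).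
  have [z Oz zy] := shrink _ _ Ox (enorm_ge0 (y - c)) yx.
  exact: rot Oz zy.
have up y : Omega y -> exists2 x, Omega x & enorm (y - c) < enorm (x - c).
  move=> Oy; have [d d0 dO] := (open_eballP Omega).1 oO y Oy.
  pose e : 'rV[R]_n := if y == c then delta_mx 0 (Ordinal n0) else (enorm (y - c))^-1 *: (y - c).
  have e1 : enorm e = 1.
    rewrite /e; case: eqVneq => yc; first exact: enorm_delta.
    by apply: unit; rewrite subr_eq0.
  have ye : y - c = enorm (y - c) *: e.
    rewrite /e; case: eqVneq => [->|yc]; first by rewrite subrr enorm0 scale0r.
    by rewrite scalerA divff ?scale1r// enorm_eq0 subr_eq0.
  exists (y + (d / 2) *: e).
    apply: dO; rewrite /eball /= opprD addrA subrr add0r enormN enormZ e1.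
    by rewrite mulr1 ger0_norm; lra.
  rewrite addrAC {2}ye -scalerDl enormZ e1 mulr1 ger0_norm.
    by rewrite ltrDl divr_gt0.
  by rewrite addr_ge0 ?enorm_ge0// divr_ge0// ltW.
pose r := sup [set enorm (x - c) | x in Omega].
have ubr : has_ubound [set enorm (x - c) | x in Omega].
  exists (M + enorm c) => _ [x Ox <-].
  by apply: le_trans (ler_enormD _ _) _; rewrite enormN lerD2r OM.
have hsr : has_sup [set enorm (x - c) | x in Omega].
  by split=> //; have [x Ox] := O0; exists (enorm (x - c)), x.
have ltr x : Omega x -> enorm (x - c) < r.
  move=> /up[y Oy xy]; apply: lt_le_trans xy _; apply: ub_le_sup => //.
  by exists y.
exists c, r; split.
  by have [x Ox] := O0; exact: le_lt_trans (enorm_ge0 _) (ltr _ Ox).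
apply/seteqP; split=> [x Ox|y]; first by rewrite /eball /= enorm_distC; exact: ltr.
rewrite /eball /= enorm_distC => yr.
have d0 : 0 < r - enorm (y - c) by rewrite subr_gt0.
have [_ [x Ox <-]] := sup_adherent d0 hsr.
by rewrite subKr => /ltW; exact: down.
Qed.
End symmetric_sets.

(** * Integrals and null sets *)

Section integral_facts.
Context d (T : measurableType d) (R : realType) (mu : {measure set T -> \bar R}).
Local Open Scope ereal_scope.
Import HBNNSimple.

(** The integral of a nonnegative function is a supremum over simple functions
    below it, and setting a simple function to zero on a null set preserves its
    integral.  The nonlinearity of the equation is arbitrary on negative numbers,
    so that its composition with the solution may fail to be measurable. *)
Lemma ge0_ae_le_integral_any (f g : T -> \bar R) :
  (forall x, 0 <= f x) -> (forall x, 0 <= g x) ->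
  {ae mu, forall x, f x <= g x} -> \int[mu]_x f x <= \int[mu]_x g x.
Proof.
move=> f0 g0 [N [mN N0 fgN]].
rewrite !ge0_integralTE//; apply: ge_ereal_sup => _ [h hf <-].
have mN' : measurable (~` N) by exact: measurableC.
apply: (@le_trans _ _ (sintegral mu (proj_nnsfun h mN'))).
  rewrite -!integralT_nnsfun le_eqVlt; apply/orP; left; apply/eqP.
  apply: ge0_ae_eq_integral => //; try (by move=> x _; rewrite lee_fin);
    try exact/measurable_EFinP.
  exists N; split=> // x /= /not_implyP[_ hx].
  apply: contrapT => xN; apply: hx.
  by rewrite /= mindicE mem_set ?mulr1.
apply: ereal_sup_ubound; exists (proj_nnsfun h mN') => //= x.
rewrite mindicE; have [xN|xN] := boolP (x \in ~` N); last by rewrite mulr0.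
rewrite mulr1; apply: le_trans (hf x) _; apply: contrapT => /negP fg.
move: xN; rewrite inE => xN; apply: xN; apply: fgN => /=; exact/negP.
Qed.

Lemma ae_eq_integral_any (D : set T) (f g : T -> \bar R) :
  {ae mu, forall x, D x -> f x = g x} -> \int[mu]_(x in D) f x = \int[mu]_(x in D) g x.
Proof.
move=> fg; rewrite integral_mkcond [RHS]integral_mkcond.
have {}fg : {ae mu, forall x, (f \_ D) x = (g \_ D) x}.
  by apply: filterS fg => x fg; rewrite !patchE; case: ifPn => // /set_mem /fg.
move: (f \_ D) (g \_ D) fg => {}f {}g fg.
rewrite integralE [RHS]integralE; congr (_ - _); apply/eqP; rewrite eq_le;
  apply/andP; split; apply: ge0_ae_le_integral_any => //; apply: filterS fg => x;
  by rewrite ?funeposE ?funenegE => ->.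
Qed.

Lemma ae_eq_Rintegral_any (D : set T) (f g : T -> R) :
  {ae mu, forall x, D x -> f x = g x} ->
  (\int[mu]_(x in D) f x = \int[mu]_(x in D) g x)%R.
Proof.
move=> fg; congr fine; apply: ae_eq_integral_any.
by apply: filterS fg => x fg Dx; rewrite fg.
Qed.

Lemma ae_conj (P Q : T -> Prop) :
  {ae mu, forall x, P x} -> {ae mu, forall x, Q x} -> {ae mu, forall x, P x /\ Q x}.
Proof. by move=> hP hQ; apply: filterS2 hP hQ => x; split. Qed.

(** Continuity from above, applied to the unions of the tails of [A]. *)
Lemma eventually_left_measure (D : set T) (A : (set T)^nat) :
  measurable D -> mu D < +oo -> (forall k, measurable (A k)) ->
  (forall k, A k `<=` D) ->
  (forall x, D x -> exists k, forall j, (k <= j)%N -> ~ A j x) ->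
  forall eps : R, (0 < eps)%R -> exists k, forall j, (k <= j)%N -> mu (A j) <= eps%:E.
Proof.
move=> mD Doo mA AD leave eps eps0.
pose B k := \bigcup_(j in [set j | (k <= j)%N]) A j.
have mB k : measurable (B k) by exact: bigcup_measurable.
have BD k : B k `<=` D by move=> x [j _ /AD].
have B0 : \bigcap_k B k = set0.
  apply/seteqP; split=> // x Bx.
  have [j _ Ajx] := Bx 0%N I; have [k kP] := leave _ (AD _ _ Ajx).
  by have [i ki Aix] := Bx k I; exact: kP Aix.
have : mu \o B @ \oo --> mu (\bigcap_k B k).
  apply: nonincreasing_cvg_mu => //.
  - by apply: le_lt_trans Doo; apply: le_measure; rewrite ?inE.
  - by rewrite B0.
  - move=> i j ij; apply/subsetPset => x [k /= jk Ak]; exists k => //=.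
    exact: leq_trans jk.
rewrite B0 measure0 => /fine_cvgP[_ /cvgrPdist_le/(_ _ eps0)].
move=> [k _ kP]; exists k => j kj.
apply: (@le_trans _ _ (mu (B j))).
  by apply: le_measure; rewrite ?inE// => x Ax; exists j => /=.
have Bfin : mu (B j) \is a fin_num.
  by rewrite ge0_fin_numE//; apply: le_lt_trans Doo; apply: le_measure; rewrite ?inE.
have := kP _ kj; rewrite /= sub0r normrN ger0_norm ?fine_ge0//.
by rewrite -lee_fin fineK.
Qed.

Lemma Rintegral_eq0_ae (f : T -> R) : mu.-integrable setT (EFin \o f) ->
  (forall x, (0 <= f x)%R) -> (\int[mu]_x f x <= 0)%R -> {ae mu, forall x, f x = 0%R}.
Proof.
move=> intf f0 If.
have : \int[mu]_x `|(EFin \o f) x| = 0.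
  rewrite (eq_integral (EFin \o f)); last by move=> x _; rewrite /= ger0_norm.
  apply/eqP; rewrite eq_le integral_ge0 ?andbT => [|x _]; last by rewrite lee_fin.
  by move: If; rewrite /Rintegral -lee_fin fineK//; exact: integrable_fin_num.
move/(ae_eq_integral_abs mu measurableT (measurable_int mu intf)).
by apply: filterS => x /(_ I)[].
Qed.

End integral_facts.

(** * The fractional kernel *)

Section kernel.
Context {R : realType} {n : nat} (s : R) (s0 : 0 < s).
Implicit Types (x y e : 'rV[R]_n) (l : R).
Local Notation K := (@frac_kernel R n s).
Local Notation p := (n%:R + 2 * s).

Lemma kernel_exponent_gt0 : 0 < p :> R.
Proof. by rewrite ltr_wpDl// mulr_gt0. Qed.

Lemma kernelE x y : K x y = enorm (x - y) `^ (- p).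
Proof. by rewrite powRN. Qed.

Lemma kernel_ge0 x y : 0 <= K x y.
Proof. by rewrite kernelE powR_ge0. Qed.

Lemma kernelC x y : K x y = K y x.
Proof. by rewrite !kernelE enorm_distC. Qed.

Lemma kernel_refl e l x y : enorm e = 1 -> K (refl e l x) (refl e l y) = K x y.
Proof. by move=> e1; rewrite !kernelE enorm_refl. Qed.

Lemma kernel_refl_swap e l x y : enorm e = 1 -> K (refl e l x) y = K x (refl e l y).
Proof. by move=> e1; rewrite !kernelE enorm_refl_swap. Qed.

Lemma ler_kernel x y x' y' : x != y -> enorm (x - y) <= enorm (x' - y') ->
  K x' y' <= K x y.
Proof.
move=> xy h; have xy0 : 0 < enorm (x - y) by rewrite enorm_gt0 subr_eq0.
rewrite /frac_kernel; move: (enorm (x - y)) (enorm (x' - y')) xy0 h => a b a0 ab.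
have b0 := lt_le_trans a0 ab; rewrite lef_pV2 ?posrE; try exact: powR_gt0.
by apply: (ge0_ler_powR (ltW kernel_exponent_gt0)); rewrite ?nnegrE ?(ltW a0) ?(ltW b0).
Qed.

Lemma ltr_kernel x y x' y' : x != y -> enorm (x - y) < enorm (x' - y') ->
  K x' y' < K x y.
Proof.
move=> xy h; have xy0 : 0 < enorm (x - y) by rewrite enorm_gt0 subr_eq0.
rewrite /frac_kernel; move: (enorm (x - y)) (enorm (x' - y')) xy0 h => a b a0 ab.
have b0 := lt_trans a0 ab; rewrite ltf_pV2 ?posrE; try exact: powR_gt0.
by apply: (gt0_ltr_powR kernel_exponent_gt0); rewrite ?nnegrE ?(ltW a0) ?(ltW b0).
Qed.

Lemma ler_kernel_refl e l x y : enorm e = 1 -> x != y ->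
  0 <= (l - dot x e) * (l - dot y e) -> K (refl e l x) y <= K x y.
Proof.
move=> e1 xy h; apply: ler_kernel => //; rewrite ler_enorm dot_sub_refl//.
by rewrite -mulrA; lra.
Qed.

Lemma ltr_kernel_refl e l x y : enorm e = 1 -> x != y ->
  0 < (l - dot x e) * (l - dot y e) -> K (refl e l x) y < K x y.
Proof.
move=> e1 xy h; apply: ltr_kernel => //.
by rewrite -[ltLHS]ger0_norm ?enorm_ge0// -[ltRHS]ger0_norm ?enorm_ge0//
  -ltr_sqr ?nnegrE ?normr_ge0// !real_normK ?num_real// !sqr_enorm dot_sub_refl// -mulrA; lra.
Qed.

Lemma measurable_frac_kernel d (T : measurableType d) (f g : T -> 'rV[R]_n) :
  measurable_fun setT f -> measurable_fun setT g ->
  measurable_fun setT (fun z => K (f z) (g z)).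
Proof.
move=> mf mg; under eq_fun do rewrite kernelE.
apply: (measurableT_comp (@measurable_powR R _)).
apply: (measurableT_comp (continuous_measurable_rV (@continuous_enorm R n))).
apply: measurable_fun_rV => i; under eq_fun do rewrite !mxE.
by apply: measurable_funB; exact: (measurableT_comp (measurable_coord i)).
Qed.

End kernel.

(* Unification would otherwise unfold the kernel at every failed match. *)
Opaque frac_kernel refl.

(** * The energy form under a reflection *)

Section reflected_energy.
Context {R : realType} {n : nat} (s : R) (s0 : 0 < s).
Context (mu : {sigma_finite_measure set 'rV[R]_n -> \bar R}).
Implicit Types (x y : 'rV[R]_n) (a b : 'rV[R]_n -> R).
Local Notation K := (@frac_kernel R n s).
Local Notation mu2 := (mu \x mu)%E.

Definition energy_density a b (z : 'rV[R]_n * 'rV[R]_n) : R :=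
  (a z.1 - a z.2) * (b z.1 - b z.2) * K z.1 z.2.

Definition finite_energy a : Prop :=
  measurable_fun setT a /\ (\int[mu2]_z (energy_density a a z)%:E < +oo)%E.

Lemma energy_density_ge0 a z : 0 <= energy_density a a z.
Proof. by rewrite mulr_ge0 ?kernel_ge0// -expr2 sqr_ge0. Qed.

Lemma measurable_energy_density a b : measurable_fun setT a -> measurable_fun setT b ->
  measurable_fun setT (energy_density a b).
Proof.
move=> ma mb; apply: measurable_funM; last first.
  by apply: measurable_frac_kernel; [exact: measurable_fst|exact: measurable_snd].
by apply: measurable_funM; apply: measurable_funB;
  apply: measurableT_comp => //; (exact: measurable_fst || exact: measurable_snd).
Qed.

Lemma finite_energy_integrable a : finite_energy a ->
  mu2.-integrable setT (EFin \o energy_density a a).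
Proof.
move=> [ma fa]; apply/integrableP; split.
  by apply/measurable_EFinP; exact: measurable_energy_density.
apply: le_lt_trans fa; rewrite le_eqVlt; apply/orP; left; apply/eqP.
by apply: eq_integral => z _ /=; rewrite ger0_norm ?energy_density_ge0.
Qed.

Lemma finite_energyP a g : measurable_fun setT a ->
  mu2.-integrable setT (EFin \o g) -> (forall z, energy_density a a z <= g z) ->
  finite_energy a.
Proof.
move=> ma ig ag; split=> //.
have /integrableP[_] : mu2.-integrable setT (EFin \o energy_density a a).
  apply: le_integrable ig => //.
    by apply/measurable_EFinP; exact: measurable_energy_density.
  move=> z _; rewrite /= lee_fin ger0_norm ?energy_density_ge0//.
  exact: le_trans (ag z) (ler_norm _).
apply: le_lt_trans; rewrite le_eqVlt; apply/orP; left; apply/eqP.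
by apply: eq_integral => z _ /=; rewrite ger0_norm ?energy_density_ge0.
Qed.

Lemma energy_density_integrable a b : finite_energy a -> finite_energy b ->
  mu2.-integrable setT (EFin \o energy_density a b).
Proof.
move=> fa fb; have [ma _] := fa; have [mb _] := fb.
apply: (le_integrable measurableT) (integrableD measurableT
  (finite_energy_integrable fa) (finite_energy_integrable fb)).
  by apply/measurable_EFinP; exact: measurable_energy_density.
move=> z _; rewrite /= lee_fin [leRHS]ger0_norm; last first.
  by rewrite addr_ge0 ?energy_density_ge0.
rewrite /energy_density normrM [X in _ * X]ger0_norm ?kernel_ge0//.
rewrite -mulrDl ler_wpM2r ?kernel_ge0//.
set c := a _ - _; set d := b _ - _.
by rewrite ler_norml; apply/andP; split; nra.
Qed.

Lemma finite_energyB a b : finite_energy a -> finite_energy b ->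
  finite_energy (fun x => a x - b x).
Proof.
move=> fa fb; have [ma _] := fa; have [mb _] := fb.
have i2 := integrableD measurableT (finite_energy_integrable fa) (finite_energy_integrable fb).
apply: (finite_energyP _ (integrableZl measurableT 2 i2)).
  exact: measurable_funB.
move=> z; rewrite /= /energy_density -mulrDl mulrA ler_wpM2r ?kernel_ge0//.
by have := sqr_ge0 (a z.1 - a z.2 + (b z.1 - b z.2)); rewrite expr2; lra.
Qed.

Section reflection.
Context (e : 'rV[R]_n) (l : R) (e1 : enorm e = 1) (mu_refl : mpres mu (refl e l)).
Local Notation rho := (refl e l).

Lemma finite_energy_refl a : finite_energy a -> finite_energy (a \o rho).
Proof.
move=> [ma fa]; split; first exact: measurableT_comp ma (mu_refl.1).
apply: le_lt_trans fa; rewrite le_eqVlt; apply/orP; left; apply/eqP.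
have m2 : measurable_fun setT (EFin \o energy_density a a).
  by apply/measurable_EFinP; exact: measurable_energy_density.
apply: etrans (mpres_integral (mpres_pair mu_refl mu_refl) m2).
by apply: eq_integral => z _; rewrite /energy_density /= kernel_refl.
Qed.

Lemma Rintegral_mpres d (T : measurableType d) (nu : {measure set T -> \bar R})
    (f : T -> T) (h : T -> R) : mpres nu f -> measurable_fun setT h ->
  \int[nu]_x h (f x) = \int[nu]_x h x.
Proof.
move=> pf mh; congr fine; apply: (mpres_integral (h := EFin \o h)) => //.
exact/measurable_EFinP.
Qed.

Lemma integrable_mpres d (T : measurableType d) (nu : {measure set T -> \bar R})
    (f : T -> T) (h : T -> R) : mpres nu f -> nu.-integrable setT (EFin \o h) ->
  nu.-integrable setT (EFin \o (h \o f)).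
Proof.
move=> pf /integrableP[mh ih]; apply/integrableP; split.
  exact: measurableT_comp mh pf.1.
have mh' : measurable_fun setT (abse \o (EFin \o h)) by exact: measurableT_comp.
by apply: le_lt_trans ih; have := mpres_ge0_integral pf mh' (fun t => abse_ge0 _) => /= ->.
Qed.

Definition orbit_density a b (z : 'rV[R]_n * 'rV[R]_n) : R :=
  energy_density a b z + energy_density a b (rho z.1, z.2) +
  (energy_density a b (z.1, rho z.2) + energy_density a b (rho z.1, rho z.2)).

(** Reflecting either point of a pair preserves the product measure. *)
Lemma Rintegral_orbit_density a b : finite_energy a -> finite_energy b ->
  mu2.-integrable setT (EFin \o orbit_density a b) /\
  \int[mu2]_z orbit_density a b z = 4 * \int[mu2]_z energy_density a b z.
Proof.
move=> fa fb; have i0 := energy_density_integrable fa fb.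
have [ma _] := fa; have [mb _] := fb.
have m0 := measurable_energy_density ma mb.
have idp : mpres mu id by split=> //; exact: measurable_id.
have p1 := mpres_pair mu_refl idp; have p2 := mpres_pair idp mu_refl.
have p3 := mpres_pair mu_refl mu_refl.
have i1 := integrable_mpres p1 i0; have i2 := integrable_mpres p2 i0.
have i3 := integrable_mpres p3 i0.
have i01 := integrableD measurableT i0 i1; have i23 := integrableD measurableT i2 i3.
split; first exact: (integrableD measurableT i01 i23).
have I1 := Rintegral_mpres p1 m0; have I2 := Rintegral_mpres p2 m0.
have I3 := Rintegral_mpres p3 m0.
apply: (etrans (RintegralD measurableT i01 i23)).
have J1 := RintegralD measurableT i0 i1; have J2 := RintegralD measurableT i2 i3.
apply: (etrans (congr2 +%R J1 J2)).
apply: (etrans (congr2 +%R (congr1 (+%R _) I1) (congr2 +%R I2 I3))).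
by move: (\int[mu2]_z _) => I; ring.
Qed.

Context (U : 'rV[R]_n -> R).

Definition mirror_diff x : R := U x - U (rho x).

(** The negative part of [mirror_diff], cut off at the hyperplane: it vanishes
    outside [Omega] as soon as the caps above [l] are reflected into [Omega],
    which makes it a test function. *)
Definition mirror_defect x : R :=
  if dot x e <= l then Num.max 0 (U (rho x) - U x) else 0.

Local Notation v := mirror_diff.
Local Notation psi := mirror_defect.

Lemma mirror_diff_refl x : v (rho x) = - v x.
Proof. by rewrite /v reflK// opprB. Qed.

Lemma mirror_defect_below x : dot x e <= l -> psi x = Num.max 0 (- v x).
Proof. by move=> xl; rewrite /psi xl opprB. Qed.

Lemma mirror_defect_above x : l < dot x e -> psi x = 0.
Proof. by move=> xl; rewrite /psi leNgt xl. Qed.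

Lemma mirror_defect_refl_below x : dot x e <= l -> psi (rho x) = 0.
Proof.
rewrite le_eqVlt => /orP[/eqP xl|xl].
  by rewrite mirror_defect_below refl_fix// ?xl// /v refl_fix// subrr oppr0 maxxx.
by apply: mirror_defect_above; rewrite dot_refl//; lra.
Qed.

Lemma mirror_defect_refl_above x : l < dot x e -> psi (rho x) = Num.max 0 (v x).
Proof.
move=> xl; rewrite mirror_defect_below ?mirror_diff_refl ?opprK// dot_refl//; lra.
Qed.

Lemma mirror_defect_ge0 x : 0 <= psi x.
Proof. by rewrite /psi; case: ifP => // _; rewrite le_max lexx. Qed.

Lemma max_sub (a : R) : Num.max a 0 - Num.max 0 (- a) = a.
Proof. by rewrite !maxEle; do 2 case: ifPn; rewrite -?ltNge; lra. Qed.

Lemma max_mul (a : R) : Num.max a 0 * Num.max 0 (- a) = 0.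
Proof. by rewrite !maxEle; do 2 case: ifPn; rewrite -?ltNge; nra. Qed.

(** Minus [orbit_density] of [mirror_diff] and the defect at a pair below the
    hyperplane: [k] and [k'] are the kernel at the pair and at the pair with one
    point reflected, [a] and [b] the values of [mirror_diff]. *)
Lemma parts_form (k k' a b : R) :
  let P := Num.max 0 (- a) in let Q := Num.max 0 (- b) in
  - (k * ((a - b) * (P - Q)) + k' * ((a + b) * (P + Q))) =
  k * (P - Q) ^+ 2 + k' * (P + Q) ^+ 2 +
  (k - k') * (Num.max a 0 * Q + Num.max b 0 * P).
Proof.
move=> P Q; have := max_mul a; have := max_mul b.
have := max_sub a; have := max_sub b.
rewrite -/P -/Q; move: P Q (Num.max a 0) (Num.max b 0) => P Q a' b'.
move=> <- <- bQ aP.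
have -> : - (k * ((a' - P - (b' - Q)) * (P - Q)) + k' * ((a' - P + (b' - Q)) * (P + Q))) =
   k * (P - Q) ^+ 2 + k' * (P + Q) ^+ 2 + (k - k') * (a' * Q + b' * P)
   - (k + k') * (a' * P) - (k + k') * (b' * Q) by ring.
by rewrite aP bQ !mulr0 !subr0.
Qed.

Lemma max_dist_le (a b : R) :
  (Num.max 0 (- a) - Num.max 0 (- b)) ^+ 2 <= (a - b) ^+ 2.
Proof.
rewrite !maxEle !expr2.
have [a0|a0] := leP 0 (- a); have [b0|b0] := leP 0 (- b).
- by lra.
- have ab : 0 <= - a * b by rewrite mulr_ge0//; lra.
  by have := sqr_ge0 b; rewrite expr2; lra.
- have ab : 0 <= a * - b by rewrite mulr_ge0//; lra.
  by have := sqr_ge0 a; rewrite expr2; lra.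
- by have := sqr_ge0 (a - b); rewrite expr2; lra.
Qed.

(** Interaction of the defect with the positive part of [mirror_diff]. *)
Definition repulsion (z : 'rV[R]_n * 'rV[R]_n) : R :=
  if (dot z.1 e <= l) && (dot z.2 e <= l) then
    (K z.1 z.2 - K (rho z.1) z.2) * (Num.max (v z.1) 0 * psi z.2) else 0.

Lemma orbit_density_mirror z : orbit_density v psi z =
  K z.1 z.2 * ((v z.1 - v z.2) * (psi z.1 - psi (rho z.1) - (psi z.2 - psi (rho z.2)))) +
  K (rho z.1) z.2 * ((v z.1 + v z.2) * (psi z.1 - psi (rho z.1) + (psi z.2 - psi (rho z.2)))).
Proof.
case: z => x y; rewrite /orbit_density /energy_density /= !mirror_diff_refl.
rewrite kernel_refl// -kernel_refl_swap//.
move: (K x y) (K (rho x) y) (v x) (v y) (psi x) (psi y) (psi (rho x)) (psi (rho y)).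
by move=> k k' a b p q p' q'; ring.
Qed.

Lemma dot_refl_ge x : dot x e <= l -> l <= dot (rho x) e.
Proof. by move=> xl; rewrite dot_refl//; lra. Qed.

Lemma dot_refl_lt x : l < dot x e -> dot (rho x) e < l.
Proof. by move=> xl; rewrite dot_refl//; lra. Qed.

Lemma mulr_ge0_below (a b : R) : a <= l -> b <= l -> 0 <= (l - a) * (l - b).
Proof. by move=> al bl; rewrite mulr_ge0// subr_ge0. Qed.

Lemma mulr_ge0_above (a b : R) : l <= a -> l <= b -> 0 <= (l - a) * (l - b).
Proof. by move=> al bl; rewrite mulr_le0// subr_le0. Qed.

(** Testing against the defect gains, besides the energy of the defect, the
    interaction of the defect with the positive part of the difference: points
    on the same side are closer to each other than to the mirror images. *)
Lemma orbit_density_le z :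
  energy_density psi psi z + repulsion z <= - orbit_density v psi z.
Proof.
rewrite orbit_density_mirror /repulsion /energy_density; case: z => x y /=.
have k0 := kernel_ge0 s x y; have k'0 := kernel_ge0 s (rho x) y.
have [xl|xl] := leP (dot x e) l; have [yl|yl] := leP (dot y e) l => /=.
- rewrite !mirror_defect_refl_below// !subr0 !mirror_defect_below// parts_form.
  set P := Num.max 0 (- v x); set Q := Num.max 0 (- v y).
  have P0 : 0 <= P by rewrite le_max lexx.
  have Q0 : 0 <= Q by rewrite le_max lexx.
  set a' := Num.max (v x) 0; set b' := Num.max (v y) 0.
  have a'0 : 0 <= a' by rewrite le_max lexx orbT.
  have b'0 : 0 <= b' by rewrite le_max lexx orbT.
  have h1 : 0 <= (K x y - K (rho x) y) * (b' * P).
    have [xy|xy] := eqVneq x y; first by rewrite /b' /P -xy max_mul mulr0.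
    rewrite mulr_ge0 ?mulr_ge0// subr_ge0 ler_kernel_refl//.
    exact: mulr_ge0_below.
  have h2 : 0 <= K (rho x) y * (P + Q) ^+ 2 by exact: mulr_ge0 k'0 (sqr_ge0 _).
  clear k0 k'0; clearbody P Q a' b'.
  move: (K x y) (K (rho x) y) h1 h2 => k k' h1 h2.
  by rewrite mulrDr; lra.
- rewrite (mirror_defect_refl_below xl) (mirror_defect_above yl) (mirror_defect_refl_above yl).
  rewrite (mirror_defect_below xl) !subr0 sub0r opprK.
  have := parts_form (K (rho x) y) (K x y) (v x) (- v y); rewrite /= opprK.
  set P := Num.max 0 (- v x); set Q := Num.max 0 (v y) => pf.
  have P0 : 0 <= P by rewrite le_max lexx.
  have Q0 : 0 <= Q by rewrite le_max lexx.
  set a' := Num.max (v x) 0 in pf; set b' := Num.max (- v y) 0 in pf.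
  have a'0 : 0 <= a' by rewrite le_max lexx orbT.
  have b'0 : 0 <= b' by rewrite le_max lexx orbT.
  have h1 : 0 <= (K (rho x) y - K x y) * (a' * Q + b' * P).
    have [xy|xy] := eqVneq (rho x) y.
      rewrite (_ : a' * Q + b' * P = 0) ?mulr0// /a' /b' /P /Q -xy mirror_diff_refl opprK.
      by rewrite max_mul addr0.
    apply: mulr_ge0; last by rewrite addr_ge0 ?mulr_ge0.
    rewrite subr_ge0 -[X in K X _ <= _](reflK l e1).
    rewrite ler_kernel_refl//; apply: mulr_ge0_above; last exact: ltW.
    exact: dot_refl_ge.
  have h2 : 0 <= K (rho x) y * (P - Q) ^+ 2 by exact: mulr_ge0 k'0 (sqr_ge0 _).
  have h3 : 0 <= K x y * (2 * (P * Q) + Q ^+ 2).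
    apply: (mulr_ge0 k0); apply: addr_ge0; last exact: sqr_ge0.
    exact: mulr_ge0 (ler0n _ _) (mulr_ge0 P0 Q0).
  clear k0 k'0; clearbody P Q a' b'.
  move: (K x y) (K (rho x) y) (v x) (v y) pf h1 h2 h3 => k k' a b pf h1 h2 h3.
  by lra.
- rewrite (mirror_defect_refl_below yl) (mirror_defect_above xl) (mirror_defect_refl_above xl).
  rewrite (mirror_defect_below yl) !subr0 !sub0r.
  have := parts_form (K (rho x) y) (K x y) (v y) (- v x); rewrite /= opprK.
  set P := Num.max 0 (- v y); set Q := Num.max 0 (v x) => pf.
  have P0 : 0 <= P by rewrite le_max lexx.
  have Q0 : 0 <= Q by rewrite le_max lexx.
  set a' := Num.max (v y) 0 in pf; set b' := Num.max (- v x) 0 in pf.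
  have a'0 : 0 <= a' by rewrite le_max lexx orbT.
  have b'0 : 0 <= b' by rewrite le_max lexx orbT.
  have h1 : 0 <= (K (rho x) y - K x y) * (a' * Q + b' * P).
    have [xy|xy] := eqVneq (rho x) y.
      rewrite (_ : a' * Q + b' * P = 0) ?mulr0// /a' /b' /P /Q -xy mirror_diff_refl opprK.
      by have := max_mul (- v x); rewrite opprK => ->; rewrite addr0.
    apply: mulr_ge0; last by rewrite addr_ge0 ?mulr_ge0.
    rewrite subr_ge0 -[X in K X _ <= _](reflK l e1).
    rewrite ler_kernel_refl//; apply: mulr_ge0_below => //.
    exact/ltW/dot_refl_lt.
  have h2 : 0 <= K (rho x) y * (P - Q) ^+ 2 by exact: mulr_ge0 k'0 (sqr_ge0 _).
  have h3 : 0 <= K x y * (2 * (P * Q) + Q ^+ 2).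
    apply: (mulr_ge0 k0); apply: addr_ge0; last exact: sqr_ge0.
    exact: mulr_ge0 (ler0n _ _) (mulr_ge0 P0 Q0).
  clear k0 k'0; clearbody P Q a' b'.
  move: (K x y) (K (rho x) y) (v x) (v y) pf h1 h2 h3 => k k' a b pf h1 h2 h3.
  by lra.
rewrite (mirror_defect_above xl) (mirror_defect_above yl).
rewrite (mirror_defect_refl_above xl) (mirror_defect_refl_above yl).
rewrite !(sub0r, subr0, oppr0, mul0r, add0r, addr0, opprK).
have := parts_form (K x y) (K (rho x) y) (- v x) (- v y); rewrite /= !opprK.
set P := Num.max 0 (v x); set Q := Num.max 0 (v y) => pf.
have P0 : 0 <= P by rewrite le_max lexx.
have Q0 : 0 <= Q by rewrite le_max lexx.
set a' := Num.max (- v x) 0 in pf; set b' := Num.max (- v y) 0 in pf.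
have a'0 : 0 <= a' by rewrite le_max lexx orbT.
have b'0 : 0 <= b' by rewrite le_max lexx orbT.
have h1 : 0 <= (K x y - K (rho x) y) * (a' * Q + b' * P).
  have [xy|xy] := eqVneq x y.
    rewrite (_ : a' * Q + b' * P = 0) ?mulr0// /a' /b' /P /Q -xy.
    by have := max_mul (- v x); rewrite opprK => ->; rewrite addr0.
  apply: mulr_ge0; last by rewrite addr_ge0 ?mulr_ge0.
  rewrite subr_ge0 ler_kernel_refl//.
  by apply: mulr_ge0_above; exact: ltW.
have h2 : 0 <= K x y * (P - Q) ^+ 2 by exact: mulr_ge0 k0 (sqr_ge0 _).
have h3 : 0 <= K (rho x) y * (P + Q) ^+ 2 by exact: mulr_ge0 k'0 (sqr_ge0 _).
clear k0 k'0; clearbody P Q a' b'.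
move: (K x y) (K (rho x) y) (v x) (v y) pf h1 h2 h3 => k k' a b pf h1 h2 h3.
by lra.
Qed.

End reflection.
End reflected_energy.

(** * The energy inequality for the defect *)

Section defect_estimate.
Context {R : realType} {n : nat} (s : R) (s0 : 0 < s).
Context (mu : {sigma_finite_measure set 'rV[R]_n -> \bar R}).
Context (e : 'rV[R]_n) (l : R) (e1 : enorm e = 1) (mu_refl : mpres mu (refl e l)).
Context (U : 'rV[R]_n -> R) (mU : measurable_fun setT U).
Implicit Types (x y : 'rV[R]_n).
Local Notation K := (@frac_kernel R n s).
Local Notation mu2 := (mu \x mu)%E.
Local Notation rho := (refl e l).
Local Notation v := (mirror_diff e l U).
Local Notation psi := (mirror_defect e l U).

Lemma measurable_halfspace : measurable [set x | dot x e <= l].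
Proof. by apply: closed_measurable_rV; apply: closed_sublevel; exact: continuous_dot. Qed.

Lemma measurable_halfspace_bool : measurable_fun setT (fun x => dot x e <= l).
Proof.
apply: (measurable_fun_bool true); rewrite setTI.
by rewrite (_ : _ @^-1` _ = [set x | dot x e <= l])//; exact: measurable_halfspace.
Qed.

Lemma measurable_mirror_diff : measurable_fun setT v.
Proof. by apply: measurable_funB => //; exact: measurableT_comp mU mu_refl.1. Qed.

Lemma measurable_mirror_defect : measurable_fun setT psi.
Proof.
apply: measurable_fun_ifT => //; first exact: measurable_halfspace_bool.
apply: measurable_maxr => //; apply: measurable_funB => //.
exact: measurableT_comp mU mu_refl.1.
Qed.

Lemma negative_part_sqr_le (k k' a b : R) : 0 <= k -> 0 <= k' ->
  (a < 0 -> b < 0 -> k <= k') ->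
  Num.max 0 (- a) ^+ 2 * k <= (a - b) ^+ 2 * k + (a + b) ^+ 2 * k'.
Proof.
move=> k0 k'0 kk'; have [a0|a0] := leP 0 a.
  rewrite (_ : Num.max 0 (- a) = 0); last by rewrite max_l ?oppr_le0.
  by rewrite expr0n /= mul0r addr_ge0// mulr_ge0 ?sqr_ge0.
rewrite max_r ?oppr_ge0 ?(ltW a0)// sqrrN; have [b0|b0] := leP 0 b.
  have h : a ^+ 2 <= (a - b) ^+ 2 by nra.
  by apply: le_trans (ler_wpM2r k0 h) _; rewrite lerDl mulr_ge0 ?sqr_ge0.
have h : a ^+ 2 <= (a + b) ^+ 2 by nra.
apply: le_trans (ler_pM (sqr_ge0 _) k0 h (kk' a0 b0)) _.
by rewrite lerDr mulr_ge0 ?sqr_ge0.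
Qed.

Lemma kernel_opposite_le x y : dot x e <= l -> l < dot y e -> rho x != y ->
  K x y <= K (rho x) y.
Proof.
move=> xl yl xy; rewrite -[X in K X y <= _](reflK l e1 x).
apply: ler_kernel_refl => //; apply: mulr_ge0_above; last exact: ltW.
exact: dot_refl_ge.
Qed.

(** The cut-off at the hyperplane is paid for by the pairs with one point
    reflected: two points on opposite sides are farther apart than one of them is
    from the mirror image of the other. *)
Lemma mirror_defect_density_le z : energy_density s psi psi z <=
  energy_density s v v z + energy_density s v v (z.1, rho z.2).
Proof.
rewrite /energy_density; case: z => x y /=; rewrite mirror_diff_refl// opprK.
rewrite -(kernel_refl_swap s l x y e1).
have k0 := kernel_ge0 s x y; have k'0 := kernel_ge0 s (rho x) y.
have [xl|xl] := leP (dot x e) l; have [yl|yl] := leP (dot y e) l.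
- rewrite (mirror_defect_below _ xl) (mirror_defect_below _ yl) -!expr2.
  apply: le_trans (ler_wpM2r k0 (max_dist_le (v x) (v y))) _.
  by rewrite lerDl; exact: mulr_ge0 (sqr_ge0 _) k'0.
- rewrite (mirror_defect_above _ yl) (mirror_defect_below _ xl) subr0 -!expr2.
  apply: (negative_part_sqr_le k0 k'0) => vx vy; apply: (kernel_opposite_le xl yl).
  by apply/eqP => xy; move: vy; rewrite -xy mirror_diff_refl// oppr_lt0 ltNge (ltW vx).
- rewrite (mirror_defect_above _ xl) (mirror_defect_below _ yl) sub0r -!expr2 sqrrN.
  have -> : (v x - v y) ^+ 2 = (v y - v x) ^+ 2 by rewrite -sqrrN opprB.
  have -> : v x + v y = v y + v x by rewrite addrC.
  apply: (negative_part_sqr_le k0 k'0) => vy vx.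
  rewrite (kernelC s x y) (kernel_refl_swap s l x y e1) (kernelC s x (rho y)).
  apply: (kernel_opposite_le yl xl).
  by apply/eqP => yx; move: vx; rewrite -yx mirror_diff_refl// oppr_lt0 ltNge (ltW vy).
rewrite (mirror_defect_above _ xl) (mirror_defect_above _ yl) subrr !mul0r -!expr2.
exact: addr_ge0 (mulr_ge0 (sqr_ge0 _) k0) (mulr_ge0 (sqr_ge0 _) k'0).
Qed.

Lemma finite_energy_mirror_diff : finite_energy s mu U -> finite_energy s mu v.
Proof.
by move=> fU; apply: (finite_energyB fU); exact: (finite_energy_refl e1 mu_refl fU).
Qed.

Lemma finite_energy_mirror_defect : finite_energy s mu U -> finite_energy s mu psi.
Proof.
move=> /finite_energy_mirror_diff fv; have iv := finite_energy_integrable fv.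
have idp : mpres mu id by split=> //; exact: measurable_id.
have iv' := integrable_mpres (mpres_pair idp mu_refl) iv.
apply: (finite_energyP _ (integrableD measurableT iv iv')).
  exact: measurable_mirror_defect.
by move=> z; exact: mirror_defect_density_le.
Qed.

Lemma repulsion_ge0 z : 0 <= repulsion s e l U z.
Proof.
rewrite /repulsion; case: z => x y /=; case: ifPn => // /andP[xl yl].
rewrite (mirror_defect_below _ yl).
have [xy|xy] := eqVneq x y; first by rewrite -xy max_mul mulr0.
rewrite mulr_ge0 ?mulr_ge0 ?le_max ?lexx ?orbT// subr_ge0 ler_kernel_refl//.
exact: mulr_ge0_below.
Qed.

Lemma measurable_repulsion : measurable_fun setT (repulsion s e l U).
Proof.
apply: measurable_fun_ifT => //.
  by apply: measurable_and; apply: (measurableT_comp measurable_halfspace_bool);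
    (exact: measurable_fst || exact: measurable_snd).
have m1 : measurable_fun setT (fun z : 'rV[R]_n * 'rV[R]_n => z.1) by exact: measurable_fst.
have m2 : measurable_fun setT (fun z : 'rV[R]_n * 'rV[R]_n => z.2) by exact: measurable_snd.
have m3 : measurable_fun setT (fun z : 'rV[R]_n * 'rV[R]_n => rho z.1).
  exact: measurableT_comp mu_refl.1 m1.
apply: measurable_funM.
  by apply: measurable_funB; [exact: (measurable_frac_kernel s m1 m2)|exact: (measurable_frac_kernel s m3 m2)].
apply: measurable_funM.
  apply: measurable_maxr => //; exact: measurableT_comp measurable_mirror_diff measurable_fst.
exact: measurableT_comp measurable_mirror_defect measurable_snd.
Qed.

Lemma defect_arithmetic (c A B C D Q L : R) : 0 < c -> c / 2 * A = C -> c / 2 * B = D ->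
  D - C <= L * Q -> - (4 * (A - B)) <= 8 * L / c * Q.
Proof.
move=> c0 <- <- h; have -> : - (4 * (A - B)) = 8 / c * (c / 2 * B - c / 2 * A).
  by field; rewrite gt_eqF.
have -> : 8 * L / c * Q = 8 / c * (L * Q) by ring.
by rewrite ler_wpM2l// divr_ge0// ltW.
Qed.

(** [h] stands for the right-hand side of the equation: the identities
    [eq1] and [eq2] are the weak formulation tested with the defect and with its
    mirror image.  Subtracting them gives the energy of the antisymmetric
    difference against the defect. *)
Lemma defect_estimate (c L : R) (h : 'rV[R]_n -> R) : 0 < c ->
  finite_energy s mu U -> measurable_fun setT h ->
  mu.-integrable setT (EFin \o (fun x => h x * psi x)) ->
  mu.-integrable setT (EFin \o (fun x => h (rho x) * psi x)) ->
  mu.-integrable setT (EFin \o (fun x => psi x ^+ 2)) ->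
  c / 2 * (\int[mu2]_z energy_density s U psi z) = \int[mu]_x (h x * psi x) ->
  c / 2 * (\int[mu2]_z energy_density s U (psi \o rho) z) =
    \int[mu]_x (h x * psi (rho x)) ->
  (forall x, (h (rho x) - h x) * psi x <= L * psi x ^+ 2) ->
  (\int[mu2]_z (energy_density s psi psi z + repulsion s e l U z)%:E <=
   (8 * L / c * \int[mu]_x psi x ^+ 2)%:E)%E.
Proof.
move=> c0 fU mh i1 i2 i3 eq1 eq2 hL.
have fpsi := finite_energy_mirror_defect fU.
have fv := finite_energy_mirror_diff fU.
have fUr := finite_energy_refl e1 mu_refl fU.
have fpr := finite_energy_refl e1 mu_refl fpsi.
have [iorb Iorb] := Rintegral_orbit_density mu_refl fv fpsi.
have Iv : \int[mu2]_z energy_density s v psi z =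
    \int[mu2]_z energy_density s U psi z - \int[mu2]_z energy_density s U (psi \o rho) z.
  have j1 := energy_density_integrable fU fpsi.
  have j2 := energy_density_integrable fUr fpsi.
  have mpr : measurable_fun setT (energy_density s U (psi \o rho)).
    by apply: measurable_energy_density => //; exact: fpr.1.
  have I : \int[mu2]_z energy_density s (U \o rho) psi z =
      \int[mu2]_z energy_density s U (psi \o rho) z.
    apply: etrans (Rintegral_mpres (mpres_pair mu_refl mu_refl) mpr).
    by apply: eq_Rintegral => z _; rewrite /energy_density /= kernel_refl// !reflK.
  rewrite -I; apply: etrans (RintegralB measurableT j1 j2).
  by apply: eq_Rintegral => z _; rewrite /energy_density /= /mirror_diff; ring.
have Ih : \int[mu]_x (h x * psi (rho x)) = \int[mu]_x (h (rho x) * psi x).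
  have mhp : measurable_fun setT (fun x => h x * psi (rho x)).
    apply: measurable_funM => //.
    exact: measurableT_comp measurable_mirror_defect mu_refl.1.
  apply: etrans (esym (Rintegral_mpres mu_refl mhp)) _.
  by apply: eq_Rintegral => x _; rewrite reflK.
have Idiff : \int[mu]_x (h (rho x) * psi x) - \int[mu]_x (h x * psi x) <=
    L * \int[mu]_x psi x ^+ 2.
  have J1 := RintegralB measurableT i2 i1; have J2 := RintegralZl L measurableT i3.
  have : \int[mu]_x (h (rho x) * psi x - h x * psi x) <= \int[mu]_x (L * psi x ^+ 2).
    apply: le_Rintegral => //.
    - exact: (integrableB measurableT i2 i1).
    - exact: (integrableZl measurableT L i3).
    - by move=> x _; rewrite -mulrBl.
  by move=> J; apply: le_trans (le_trans J _); rewrite le_eqVlt ?J1 ?J2 eqxx.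
have iopp : mu2.-integrable setT (EFin \o (fun z => - orbit_density s e l v psi z)).
  exact: (integrableN iorb).
apply: (@le_trans _ _ (\int[mu2]_z (- orbit_density s e l v psi z)%:E)%E).
  apply: ge0_le_integral => //.
  - by move=> z _; rewrite lee_fin addr_ge0 ?energy_density_ge0 ?repulsion_ge0.
  - apply/measurable_EFinP; apply: measurable_funD; last exact: measurable_repulsion.
    by apply: measurable_energy_density; exact: measurable_mirror_defect.
  - exact: measurable_int iopp.
  - by move=> z _; rewrite lee_fin orbit_density_le.
have E : (\int[mu2]_z (- orbit_density s e l v psi z)%:E)%E =
   (- (4 * \int[mu2]_z energy_density s v psi z))%:E.
  rewrite -Iorb EFinN /Rintegral fineK; last exact: integrable_fin_num.
  exact: integralN (integrable_add_def measurableT iorb).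
rewrite E lee_fin Iv; rewrite Ih in eq2.
move: (\int[mu2]_z energy_density s U psi z)
  (\int[mu2]_z energy_density s U (psi \o rho) z)
  (\int[mu]_x (h x * psi x)) (\int[mu]_x (h (rho x) * psi x))
  (\int[mu]_x psi x ^+ 2) eq1 eq2 Idiff => A B C D Q; move: c0.
exact: defect_arithmetic.
Qed.

End defect_estimate.

(** * Absorption of a defect concentrated on a small set *)

Section absorption.
Context {R : realType} {n : nat} (s : R) (s0 : 0 < s).
Context (mu : {sigma_finite_measure set 'rV[R]_n -> \bar R}).
Implicit Types (x y : 'rV[R]_n).
Local Notation K := (@frac_kernel R n s).
Local Notation mu2 := (mu \x mu)%E.
Local Notation p := (n%:R + 2 * s).

Lemma integral_prodM (f g : 'rV[R]_n -> R) :
  measurable_fun setT f -> measurable_fun setT g ->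
  (forall x, 0 <= f x) -> (forall x, 0 <= g x) ->
  (\int[mu2]_z (f z.1 * g z.2)%:E = (\int[mu]_x (f x)%:E) * (\int[mu]_x (g x)%:E))%E.
Proof.
move=> mf mg f0 g0.
have mfg : measurable_fun setT (fun z : 'rV[R]_n * 'rV[R]_n => (f z.1 * g z.2)%:E).
  apply/measurable_EFinP; apply: measurable_funM.
    exact: measurableT_comp mf measurable_fst.
  exact: measurableT_comp mg measurable_snd.
have fg0 (z : 'rV[R]_n * 'rV[R]_n) : (0 <= (f z.1 * g z.2)%:E)%E.
  by rewrite lee_fin mulr_ge0.
apply: (etrans (fubini_tonelli1 _ mfg fg0)); rewrite /fubini_F /=.
have Eg : (0 <= \int[mu]_x (g x)%:E)%E by apply: integral_ge0 => x _; rewrite lee_fin.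
transitivity (\int[mu]_x ((\int[mu]_x (g x)%:E) * (f x)%:E))%E.
  apply: eq_integral => x _; rewrite muleC -ge0_integralZl_EFin//.
  - by move=> y _; rewrite lee_fin.
  - exact/measurable_EFinP.
rewrite (@ge0_integralZl _ _ _ mu _ measurableT (fun x => (f x)%:E))//.
- by rewrite muleC.
- exact/measurable_EFinP.
- by move=> x _; rewrite lee_fin.
Qed.

Lemma integralZl_indic (a : R) (C : set 'rV[R]_n) : measurable C -> 0 <= a ->
  (\int[mu]_x (a * \1_C x)%:E = a%:E * mu C)%E.
Proof.
move=> mC a0; rewrite -(setIT C) -(integral_indic mu measurableT mC) setIT.
rewrite -(ge0_integralZl_EFin mu measurableT)//.
by apply/measurable_EFinP; exact: measurable_indic.
Qed.

Lemma kernel_ge_near (r : R) x y : x != y -> enorm (x - y) < r -> r `^ (- p) <= K x y.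
Proof.
move=> xy xyr; have a0 : 0 < enorm (x - y) by rewrite enorm_gt0 subr_eq0.
rewrite kernelE; move: (enorm (x - y)) a0 xyr => a a0 ar.
have r0 := lt_trans a0 ar; rewrite !powRN lef_pV2 ?posrE; try exact: powR_gt0.
by apply: (ge0_ler_powR (ltW (kernel_exponent_gt0 s0))); rewrite ?nnegrE ?(ltW a0) ?(ltW r0) ?(ltW ar).
Qed.

Context (psi : 'rV[R]_n -> R) (mpsi : measurable_fun setT psi)
  (ipsi : mu.-integrable setT (EFin \o (fun x => psi x ^+ 2))).
Context (A : set 'rV[R]_n) (mA : measurable A).

Lemma measurable_sqr_on (C : set 'rV[R]_n) : measurable C ->
  measurable_fun setT (fun x => \1_C x * psi x ^+ 2 : R).
Proof.
move=> mC; apply: measurable_funM; first exact: measurable_indic.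
exact: measurable_funX.
Qed.

Lemma integrable_sqr_on (C : set 'rV[R]_n) : measurable C ->
  mu.-integrable setT (EFin \o (fun x => \1_C x * psi x ^+ 2)).
Proof.
move=> mC; apply: (le_integrable measurableT) ipsi.
  by apply/measurable_EFinP; exact: measurable_sqr_on.
move=> x _; rewrite /= lee_fin indicE (ger0_norm (sqr_ge0 _)).
case: (_ \in _); first by rewrite mul1r ger0_norm ?sqr_ge0.
by rewrite mul0r normr0 sqr_ge0.
Qed.

(** A Poincare inequality on a set [A] filling at most half of every ball of
    radius [r]: pairs of a point of [A] and a nearby point outside [A]
    already carry much energy, unless the values outside [A] are large. *)
Lemma small_set_poincare (r W : R) : 0 < r -> 0 < W ->
  (forall x, W%:E <= mu (eball x r))%E -> (mu A <= (W / 2)%:E)%E ->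
  ((r `^ (- p) * W / 4 * \int[mu]_x (\1_A x * psi x ^+ 2))%:E <=
   \int[mu2]_z (energy_density s psi psi z)%:E +
   (r `^ (- p) * W / 2 * \int[mu]_x (\1_(~` A) x * psi x ^+ 2))%:E)%E.
Proof.
move=> r0 W0 Wball AW; set k := r `^ (- p).
have k0 : 0 < k by exact: powR_gt0.
have mA' : measurable (~` A) by exact: measurableC.
have iA := integrable_sqr_on mA; have iA' := integrable_sqr_on mA'.
pose F (z : 'rV[R]_n * 'rV[R]_n) : R :=
  k / 2 * (\1_A z.1 * psi z.1 ^+ 2) * \1_(eball z.1 r `\` A) z.2.
have ind01 (C : set 'rV[R]_n) x : 0 <= (\1_C x : R) <= 1.
  by rewrite indicE; case: (_ \in _); rewrite /= ?lexx ler01.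
have mball : measurable_fun setT (fun z : 'rV[R]_n * 'rV[R]_n => \1_(eball z.1 r `\` A) z.2 : R).
  have mD : measurable [set z : 'rV[R]_n * 'rV[R]_n | (eball z.1 r `\` A) z.2].
    rewrite (_ : mkset _ = [set z | enorm (z.1 - z.2) < r] `&` (snd @^-1` (~` A))).
      apply: measurableI; last first.
        by apply: measurable_preimageT => //; exact: measurable_snd.
      have -> : [set z : 'rV[R]_n * 'rV[R]_n | enorm (z.1 - z.2) < r] =
          (fun z => enorm (z.1 - z.2)) @^-1` `]-oo, r[%classic.
        by apply/seteqP; split=> z /=; rewrite in_itv.
      apply: measurable_preimageT => //.
      apply: (measurableT_comp (continuous_measurable_rV (@continuous_enorm R n))).
      apply: measurable_fun_rV => i; under eq_fun do rewrite !mxE.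
      apply: measurable_funB.
        exact: (measurableT_comp (measurable_coord i) measurable_fst).
      exact: (measurableT_comp (measurable_coord i) measurable_snd).
    by [].
  apply: eq_measurable_fun (measurable_indic mD) => z _.
  by rewrite !indicE; congr (_ : bool)%:R; apply/idP/idP; rewrite !inE.
have mF : measurable_fun setT F.
  apply: measurable_funM => //; apply: measurable_funM => //.
  exact: (measurableT_comp (measurable_sqr_on mA) measurable_fst).
have F0 z : 0 <= F z.
  have [h1 _] := andP (ind01 A z.1); have [h2 _] := andP (ind01 (eball z.1 r `\` A) z.2).
  exact: mulr_ge0 (mulr_ge0 (divr_ge0 (ltW k0) (ler0n _ _)) (mulr_ge0 h1 (sqr_ge0 _))) h2.
have lower : ((k * W / 4 * \int[mu]_x (\1_A x * psi x ^+ 2))%:E <= \int[mu2]_z (F z)%:E)%E.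
  apply: le_trans (_ : \int[mu]_x (k * W / 4 * (\1_A x * psi x ^+ 2))%:E <= _)%E.
    rewrite -(RintegralZl _ measurableT iA) /Rintegral fineK//.
    by apply: integrable_fin_num => //; exact: (integrableZl measurableT (k * W / 4) iA).
  have mF' : measurable_fun setT (EFin \o F) by exact/measurable_EFinP.
  apply: (@le_trans _ _ (\int[mu]_x \int[mu]_y (F (x, y))%:E)%E); last first.
    rewrite le_eqVlt; apply/orP; left; apply/eqP; apply: esym.
    by apply: (fubini_tonelli1 _ mF') => z; rewrite lee_fin.
  apply: ge0_le_integral => //.
  - move=> x _; rewrite lee_fin; have [h1 _] := andP (ind01 A x).
    exact: mulr_ge0 (divr_ge0 (mulr_ge0 (ltW k0) (ltW W0)) (ler0n _ _)) (mulr_ge0 h1 (sqr_ge0 _)).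
  - exact: measurable_int (integrableZl measurableT (k * W / 4) iA).
  - by apply: (measurable_fun_fubini_tonelli_F _ mF') => z; rewrite lee_fin.
  move=> x _; rewrite /F /=.
  have mBA : measurable (eball x r `\` A) by apply: measurableD => //; exact: measurable_eball.
  pose w := \1_A x * psi x ^+ 2; rewrite -/w.
  have w0 : 0 <= w by have [h1 _] := andP (ind01 A x); exact: mulr_ge0 h1 (sqr_ge0 _).
  have h0 : 0 <= k / 2 * w by exact: mulr_ge0 (divr_ge0 (ltW k0) (ler0n _ _)) w0.
  have -> : k * W / 4 * w = k / 2 * w * (W / 2).
    by clearbody w k; field.
  rewrite (integralZl_indic mBA h0) EFinM; apply: lee_wpmul2l; first by rewrite lee_fin.
  have : (W%:E <= mu (eball x r `\` A) + (W / 2)%:E)%E.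
    apply: le_trans (Wball x) _; apply: (@le_trans _ _ (mu ((eball x r `\` A) `|` A))).
      apply: le_measure; rewrite ?inE; first exact: measurable_eball.
        exact: measurableU.
      by move=> y yr; have [yA|yA] := pselect (A y); [right|left].
    by apply: (le_trans (measureU2 mu mBA mA)); exact: leeD2l.
  rewrite [W in (W%:E)%E]splitr EFinD leeD2rE//.
apply: le_trans lower _.
have iprod : (\int[mu2]_z (k * \1_A z.1 * (\1_(~` A) z.2 * psi z.2 ^+ 2))%:E <=
    (k * W / 2 * \int[mu]_x (\1_(~` A) x * psi x ^+ 2))%:E)%E.
  have m1 : measurable_fun setT (fun x => k * \1_A x : R).
    by apply: measurable_funM => //; exact: measurable_indic.
  have m2 : measurable_fun setT (fun x => \1_(~` A) x * psi x ^+ 2 : R).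
    exact: measurable_sqr_on.
  have p1 x : 0 <= k * \1_A x by have [h1 _] := andP (ind01 A x); exact: mulr_ge0 (ltW k0) h1.
  have p2 x : 0 <= \1_(~` A) x * psi x ^+ 2.
    by have [h1 _] := andP (ind01 (~` A) x); exact: mulr_ge0 h1 (sqr_ge0 _).
  rewrite (integral_prodM m1 m2 p1 p2) EFinM /Rintegral fineK; last exact: integrable_fin_num.
  apply: lee_wpmul2r; first by apply: integral_ge0 => x _; rewrite lee_fin.
  rewrite (integralZl_indic mA (ltW k0)) -mulrA EFinM.
  by apply: lee_wpmul2l; rewrite ?lee_fin// ltW.
have md : measurable_fun setT (fun z => (energy_density s psi psi z)%:E).
  by apply/measurable_EFinP; exact: measurable_energy_density.
apply: le_trans (leeD2l _ iprod).
have d0 (z : 'rV[R]_n * 'rV[R]_n) : setT z -> (0 <= (energy_density s psi psi z)%:E)%E.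
  by move=> _; rewrite lee_fin energy_density_ge0.
pose q (z : 'rV[R]_n * 'rV[R]_n) : R := k * \1_A z.1 * (\1_(~` A) z.2 * psi z.2 ^+ 2).
have q0 (z : 'rV[R]_n * 'rV[R]_n) : setT z -> (0 <= (q z)%:E)%E.
  move=> _; rewrite lee_fin; have [h1 _] := andP (ind01 A z.1).
  have [h2 _] := andP (ind01 (~` A) z.2).
  exact: mulr_ge0 (mulr_ge0 (ltW k0) h1) (mulr_ge0 h2 (sqr_ge0 _)).
have mq : measurable_fun setT (fun z => (q z)%:E).
  apply/measurable_EFinP; apply: measurable_funM.
    apply: measurable_funM => //.
    exact: (measurableT_comp (measurable_indic mA) measurable_fst).
  exact: (measurableT_comp (measurable_sqr_on mA') measurable_snd).
apply: le_trans (_ : \int[mu2]_z ((energy_density s psi psi z)%:E + (q z)%:E) <= _)%E; last first.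
  by rewrite le_eqVlt (ge0_integralD _ measurableT d0 md q0 mq) eqxx.
apply: ge0_le_integral => //.
- by move=> z _; rewrite lee_fin.
- exact/measurable_EFinP.
- exact: emeasurable_funD.
move=> [x y] _; rewrite -EFinD lee_fin /F /q /energy_density /=.
have Kxy := kernel_ge0 s x y.
have D0 : 0 <= (psi x - psi y) * (psi x - psi y) * K x y by rewrite -expr2; exact: mulr_ge0 (sqr_ge0 _) Kxy.
rewrite !indicE; have [xA|xA] := boolP (x \in A); last first.
  by rewrite !mul0r mulr0 !mul0r mulr0 mul0r addr0.
have [yA|yA] := boolP (y \in eball x r `\` A); last first.
  rewrite mulr0; apply: addr_ge0 => //.
  exact: mulr_ge0 (mulr_ge0 (ltW k0) (ler0n _ _)) (mulr_ge0 (ler0n _ _) (sqr_ge0 _)).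
rewrite inE in yA; have [yr yA'] := yA.
have -> : y \in ~` A by rewrite inE.
rewrite !mulr1 !mul1r.
have xy : x != y by apply/eqP => xy; apply: yA'; rewrite -xy; exact: set_mem.
have kK := kernel_ge_near xy yr.
rewrite -/k -expr2 in kK D0 *; move: (K x y) (psi x) (psi y) Kxy kK => c a b c0 kc.
have h : a ^+ 2 / 2 <= (a - b) ^+ 2 + b ^+ 2 by have := sqr_ge0 (a - 2 * b); rewrite !expr2; lra.
apply: (@le_trans _ _ (k * ((a - b) ^+ 2 + b ^+ 2))).
  by rewrite -mulrA ler_pM2l// mulrC.
by rewrite mulrDr lerD2r [leRHS]mulrC; exact: ler_wpM2r (sqr_ge0 _) _ _ kc.
Qed.
End absorption.

Section defect_vanishes.
Context {R : realType} {n : nat} (s : R) (s0 : 0 < s).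
Context (mu : {sigma_finite_measure set 'rV[R]_n -> \bar R}).
Implicit Types (x y : 'rV[R]_n).
Local Notation mu2 := (mu \x mu)%E.
Local Notation p := (n%:R + 2 * s).

Lemma measurable_contact_set (psi g : 'rV[R]_n -> R) (w a : R) :
  measurable_fun setT psi -> measurable_fun setT g ->
  measurable [set y | 0 < psi y /\ w * g y <= a * psi y].
Proof.
move=> mpsi mg.
have mAb : measurable_fun setT (fun y => (0 < psi y) && (w * g y <= a * psi y)).
  by apply: measurable_and; [exact: measurable_fun_ltr|
    apply: measurable_fun_ler; exact: measurable_funM].
have -> : [set y | 0 < psi y /\ w * g y <= a * psi y] =
    (fun y => (0 < psi y) && (w * g y <= a * psi y)) @^-1` [set true].
  by apply/seteqP; split=> y /=; [move=> [-> ->]|move=> /andP].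
exact: measurable_preimageT.
Qed.

(** The energy inequality [est] forces [psi] to vanish: the repulsion
    dominates [L * psi ^+ 2] wherever [psi] is small compared with [g], and the
    Poincare inequality takes care of the small set where it is not. *)
Lemma defect_vanishes (psi g : 'rV[R]_n -> R) (q : 'rV[R]_n * 'rV[R]_n -> R)
    (B : set 'rV[R]_n) (w r W L : R) :
  measurable_fun setT psi -> (forall x, 0 <= psi x) ->
  mu.-integrable setT (EFin \o (fun x => psi x ^+ 2)) ->
  measurable_fun setT g -> (forall x, 0 <= g x) ->
  measurable_fun setT q -> (forall z, 0 <= q z) ->
  measurable B -> 0 < w -> mu B = w%:E ->
  0 < r -> 0 < W -> 0 <= L -> (forall x, W%:E <= mu (eball x r))%E ->
  L + 1 <= r `^ (- p) * W / 4 ->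
  (\int[mu2]_z (energy_density s psi psi z + q z)%:E <=
    (L * \int[mu]_x psi x ^+ 2)%:E)%E ->
  (forall z, \1_B z.1 * (g z.2 * psi z.2) <= q z) ->
  (mu [set y | (0 < psi y /\ w * g y <= (L + r `^ (- p) * W / 2) * psi y)%R] <=
    (W / 2)%:E)%E ->
  {ae mu, forall x, psi x = 0}.
Proof.
move=> mpsi psi0 ipsi mg g0 mq q0 mB w0 Bw r0 W0 L0 Wball hL est rep.
set k := r `^ (- p) in hL *; set N := k * W / 2; set A := [set y | _] => AW.
have k0 : 0 < k by exact: powR_gt0.
have N0 : 0 < N by rewrite /N divr_gt0// mulr_gt0.
have mA : measurable A by exact: measurable_contact_set.
have mA' : measurable (~` A) by exact: measurableC.
have iA := integrable_sqr_on mpsi ipsi mA.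
have iA' := integrable_sqr_on mpsi ipsi mA'.
have poinc := small_set_poincare s0 mpsi ipsi mA r0 W0 Wball AW.
have md : measurable_fun setT (fun z => (energy_density s psi psi z)%:E).
  by apply/measurable_EFinP; exact: measurable_energy_density.
have d0 (z : 'rV[R]_n * 'rV[R]_n) : setT z -> (0 <= (energy_density s psi psi z)%:E)%E.
  by move=> _; rewrite lee_fin energy_density_ge0.
have mq' : measurable_fun setT (fun z => (q z)%:E) by exact/measurable_EFinP.
have q0' (z : 'rV[R]_n * 'rV[R]_n) : setT z -> (0 <= (q z)%:E)%E by rewrite lee_fin.
have est' : (\int[mu2]_z (energy_density s psi psi z)%:E + \int[mu2]_z (q z)%:E <=
    (L * \int[mu]_x psi x ^+ 2)%:E)%E.
  apply: le_trans est; rewrite le_eqVlt; apply/orP; left; apply/eqP.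
  by apply: etrans (esym (ge0_integralD _ measurableT d0 md q0' mq')) _.
have mgp : measurable_fun setT (fun y => g y * psi y) by exact: measurable_funM.
have gp0 y : 0 <= g y * psi y by rewrite mulr_ge0.
have repI : (w%:E * \int[mu]_x (g x * psi x)%:E <= \int[mu2]_z (q z)%:E)%E.
  have mB1 : measurable_fun setT (\1_B : 'rV[R]_n -> R) by exact: measurable_indic.
  have B0 x : 0 <= (\1_B x : R) by [].
  have E := integral_prodM mu mB1 mgp B0 gp0.
  have BE : (\int[mu]_x (\1_B x : R)%:E = w%:E)%E.
    by rewrite integral_indic// setIT; exact: Bw.
  rewrite BE in E; rewrite -E.
  apply: ge0_le_integral => //.
  - by move=> z _; rewrite lee_fin mulr_ge0.
  - apply/measurable_EFinP; apply: measurable_funM.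
      exact: (measurableT_comp mB1 measurable_fst).
    exact: (measurableT_comp mgp measurable_snd).
  - by move=> z _; rewrite lee_fin.
set D := (\int[mu2]_z (energy_density s psi psi z)%:E)%E in poinc est'.
set Q := (\int[mu2]_z (q z)%:E)%E in repI est'.
have D0 : (0 <= D)%E by exact: integral_ge0.
have Q0 : (0 <= Q)%E by exact: integral_ge0.
have Dfin : D \is a fin_num.
  by rewrite ge0_fin_numE//; apply: le_lt_trans (ltry _); apply: le_trans est'; exact: leeDl.
have Qfin : Q \is a fin_num.
  by rewrite ge0_fin_numE//; apply: le_lt_trans (ltry _); apply: le_trans est'; exact: leeDr.
have igp : mu.-integrable setT (EFin \o (fun y => g y * psi y)).
  apply/integrableP; split; first exact/measurable_EFinP.
  rewrite (eq_integral (fun x => (g x * psi x)%:E)); last first.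
    by move=> x _; rewrite /= ger0_norm.
  rewrite ltey; apply/eqP => gpoo; move: repI.
  by rewrite gpoo gt0_muley ?lte_fin// leye_eq => /eqP Qoo; move: Qfin; rewrite Qoo.
set a := \int[mu]_x (\1_A x * psi x ^+ 2) in poinc.
set b := \int[mu]_x (\1_(~` A) x * psi x ^+ 2) in poinc.
pose c := \int[mu]_x (g x * psi x).
have a0 : 0 <= a by apply: Rintegral_ge0 => x _; rewrite mulr_ge0 ?sqr_ge0.
have Eab : \int[mu]_x psi x ^+ 2 = a + b.
  apply: etrans (RintegralD measurableT iA iA'); apply: eq_Rintegral => x _.
  rewrite !indicE in_setC; case: (_ \in _); rewrite /= ?mul1r ?mul0r ?addr0 ?add0r//.
have hA : (L + 1) * a <= fine D + N * b.
  apply: le_trans (ler_wpM2r a0 hL) _.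
  by rewrite -lee_fin EFinD fineK.
have hB : fine D + w * c <= L * (a + b).
  have hc : w * c <= fine Q.
    by rewrite -lee_fin fineK// EFinM /c /Rintegral fineK//; exact: integrable_fin_num.
  apply: (@le_trans _ _ (fine D + fine Q)); first by rewrite lerD2l.
  by rewrite -lee_fin EFinD !fineK// -Eab.
pose h x := \1_A x * psi x ^+ 2 + w * (g x * psi x) - (L + N) * (\1_(~` A) x * psi x ^+ 2).
have i1 := integrableD measurableT iA (integrableZl measurableT w igp).
have i2 := integrableZl measurableT (L + N) iA'.
have ih : mu.-integrable setT (EFin \o h) by exact: (integrableB measurableT i1 i2).
have Ih : \int[mu]_x h x = a + w * c - (L + N) * b.
  apply: etrans (RintegralB measurableT i1 i2) _; congr (_ - _).
    apply: etrans (RintegralD measurableT iA (integrableZl measurableT w igp)) _.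
    by congr (_ + _); exact: (RintegralZl w measurableT igp).
  exact: (RintegralZl (L + N) measurableT iA').
have hpos x : 0 <= h x /\ (h x = 0 -> psi x = 0).
  have := psi0 x; rewrite le_eqVlt => /orP[/eqP px|px].
    by rewrite /h -px expr0n/= !mulr0 subr0 addr0.
  have wg : 0 <= w * (g x * psi x) by rewrite mulr_ge0// ltW.
  rewrite /h !indicE in_setC; have [xA|xA] := boolP (x \in A) => /=.
    rewrite mul1r mul0r mulr0 subr0; have p2 : 0 < psi x ^+ 2 by rewrite exprn_gt0.
    by split; lra.
  rewrite mul0r add0r mul1r expr2.
  have : (L + N) * psi x < w * g x.
    by rewrite ltNge; apply: contra xA => h'; rewrite inE; split.
  move=> hh.
  have h2 : (L + N) * psi x * psi x < w * g x * psi x by rewrite ltr_pM2r.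
  by split; lra.
have h0 : \int[mu]_x h x <= 0 by rewrite Ih; lra.
have := Rintegral_eq0_ae ih (fun x => (hpos x).1) h0.
by apply: filterS => x; exact: (hpos x).2.
Qed.
End defect_vanishes.

(** * Kernel gaps and balls of small radius *)

Section kernel_gap.
Context {R : realType} {n : nat} (s : R) (s0 : 0 < s).
Implicit Types (x y e : 'rV[R]_n) (l : R).
Local Notation K := (@frac_kernel R n s).
Local Notation alpha := ((n%:R + 2 * s) / 2).

Lemma alpha_gt0 : 0 < alpha :> R.
Proof. by rewrite divr_gt0// kernel_exponent_gt0. Qed.

Lemma kernel_dot x y : K x y = dot (x - y) (x - y) `^ (- alpha).
Proof.
rewrite kernelE -sqr_enorm -powR_mulrn ?enorm_ge0// -powRrM.
by congr (_ `^ _); field.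
Qed.

Lemma powRN_anti (a b : R) : 0 < a -> a <= b -> b `^ (- alpha) <= a `^ (- alpha).
Proof.
move=> a0 ab; have b0 := lt_le_trans a0 ab.
rewrite !powRN lef_pV2 ?posrE; try exact: powR_gt0.
by apply: (ge0_ler_powR (ltW alpha_gt0)); rewrite ?nnegrE ?(ltW a0) ?(ltW b0).
Qed.

Lemma powRN_anti_strict (a b : R) : 0 < a -> a < b -> b `^ (- alpha) < a `^ (- alpha).
Proof.
move=> a0 ab; have b0 := lt_trans a0 ab.
rewrite !powRN ltf_pV2 ?posrE; try exact: powR_gt0.
by apply: (gt0_ltr_powR alpha_gt0); rewrite ?nnegrE ?(ltW a0) ?(ltW b0).
Qed.

(** A form of convexity, seen by comparing [(c + m) / c] at [c := a] and [c := b]. *)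
Lemma powRN_increment (a b m : R) : 0 < a -> a <= b -> 0 <= m ->
  b `^ (- alpha) - (b + m) `^ (- alpha) <= a `^ (- alpha) - (a + m) `^ (- alpha).
Proof.
move=> a0 ab m0; have b0 := lt_le_trans a0 ab.
have split_ratio (c : R) : 0 < c ->
    (c + m) `^ (- alpha) = c `^ (- alpha) * (1 + m / c) `^ (- alpha).
  move=> c0; have h : 0 <= 1 + m / c by exact: addr_ge0 ler01 (divr_ge0 m0 (ltW c0)).
  rewrite -(powRM _ (ltW c0) h).
  by congr (_ `^ _); field; rewrite gt_eqF.
rewrite (split_ratio _ a0) (split_ratio _ b0).
rewrite -{1}(mulr1 (b `^ _)) -{1}(mulr1 (a `^ _)) -!mulrBr.
have ra : 1 + m / b <= 1 + m / a by rewrite lerD2l ler_wpM2l// lef_pV2 ?posrE.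
have rb : 1 <= 1 + m / b by rewrite lerDl divr_ge0// ltW.
apply: ler_pM.
- exact: powR_ge0.
- by have := powRN_anti ltr01 rb; rewrite powR1 subr_ge0.
- exact: powRN_anti.
- by rewrite lerD2l lerN2 powRN_anti// (lt_le_trans ltr01).
Qed.

(** A lower bound for [K x y - K (refl e l x) y] when [x] lies at distance at
    least [d0] and [y] at distance [d] below the hyperplane, and the two are at
    distance at most [D] from each other. *)
Definition gap (D d0 d : R) : R :=
  (D ^+ 2) `^ (- alpha) - (D ^+ 2 + 4 * d0 * d) `^ (- alpha).

Lemma gap_gt0 D d0 d : 0 < D -> 0 < d0 -> 0 < d -> 0 < gap D d0 d.
Proof.
move=> D0 d00 d1; rewrite subr_gt0 powRN_anti_strict ?exprn_gt0//.
by rewrite ltrDl !mulr_gt0.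
Qed.

Lemma gap_ge0 D d0 d : 0 < D -> 0 < d0 -> 0 <= d -> 0 <= gap D d0 d.
Proof.
move=> D0 d00 d1; rewrite subr_ge0 powRN_anti ?exprn_gt0//.
by rewrite lerDl; exact: mulr_ge0 (mulr_ge0 (ler0n _ _) (ltW d00)) d1.
Qed.

Lemma gap_le D d0 d d' : 0 < D -> 0 < d0 -> 0 <= d -> d <= d' ->
  gap D d0 d <= gap D d0 d'.
Proof.
move=> D0 d00 d1 dd'; rewrite lerD2l lerN2 powRN_anti//.
  apply: ltr_pwDl; first by rewrite exprn_gt0.
  exact: mulr_ge0 (mulr_ge0 (ler0n _ _) (ltW d00)) d1.
by rewrite lerD2l; exact: ler_wpM2l (mulr_ge0 (ler0n _ _) (ltW d00)) _ _ dd'.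
Qed.

Lemma kernel_gap e l D d0 x y : enorm e = 1 -> 0 < d0 -> x != y ->
  enorm (x - y) <= D -> d0 <= l - dot x e -> 0 <= l - dot y e ->
  gap D d0 (l - dot y e) <= K x y - K (refl e l x) y.
Proof.
move=> e1 d00 xy xyD dx dy; rewrite !kernel_dot dot_sub_refl//.
have xy0 : 0 < enorm (x - y) by rewrite enorm_gt0 subr_eq0.
have a0 : 0 < dot (x - y) (x - y) by rewrite -sqr_enorm exprn_gt0.
have aD : dot (x - y) (x - y) <= D ^+ 2.
  rewrite -sqr_enorm ler_sqr// nnegrE ?enorm_ge0//.
  exact: le_trans (enorm_ge0 _) xyD.
apply: le_trans (powRN_increment a0 aD (m := 4 * (l - dot x e) * (l - dot y e)) _).
  have d0y := mulr_ge0 (mulr_ge0 (ler0n R 4) (ltW d00)) dy.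
  rewrite lerD2l lerN2 powRN_anti//.
    apply: ltr_pwDl => //; exact: lt_le_trans aD.
  by rewrite lerD2l ler_wpM2r// ler_wpM2l.
exact: mulr_ge0 (mulr_ge0 (ler0n _ _) (le_trans (ltW d00) dx)) dy.
Qed.

End kernel_gap.

Section small_radius.
Context {R : realType} (n : nat) (s : R) (s0 : 0 < s).

Lemma volume_eball_ge (x : 'rV[R]_n) (r : R) : 0 < r ->
  (((2 * r / n.+1%:R) ^+ n)%:E <= volume n (eball x r))%E.
Proof.
move=> r0.
pose c := r / n.+1%:R; have c0 : 0 < c by rewrite divr_gt0.
pose b : 'rV[R]_n := const_mx c.
pose box := [set y : 'rV[R]_n | forall i, (x - b) ord0 i <= y ord0 i <= (x + b) ord0 i].
apply: (@le_trans _ _ (volume n box)).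
  rewrite volume_box; last by move=> i; rewrite !mxE; lra.
  rewrite lee_fin (eq_bigr (fun=> 2 * r / n.+1%:R)) ?prodr_const ?card_ord//.
  by move=> i _; rewrite !mxE /c; ring.
apply: le_measure; rewrite ?inE; [exact: measurable_box|exact: measurable_eball|].
move=> y yb; rewrite /eball /=; apply: le_lt_trans (enorm_le_mx_norm _) _.
apply: (@le_lt_trans _ _ (n%:R * c)).
  rewrite ler_wpM2l// /normr /= mx_normrE; apply: bigmax_le => [|[i j] _ /=]; first exact: ltW.
  by have := yb j; rewrite (ord1 i) !mxE ler_norml; lra.
by rewrite /c mulrA ltr_pdivrMr// mulrC ltr_pM2l// ltr_nat.
Qed.

(** The volume of the ball is of order [r ^+ n], so that the last product is of
    order [r `^ (- (2 * s))]. *)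
Lemma exists_small_radius (L : R) : 0 <= L -> exists r W : R,
  [/\ 0 < r, 0 < W, forall x : 'rV[R]_n, (W%:E <= volume n (eball x r))%E &
      L + 1 <= r `^ (- (n%:R + 2 * s)) * W / 4].
Proof.
move=> L0; pose c : R := (2 / n.+1%:R) ^+ n.
have c0 : 0 < c by rewrite exprn_gt0// divr_gt0.
pose b := c / (4 * (L + 1)).
have L1 : 0 < L + 1 by rewrite ltr_wpDl.
have b0 : 0 < b by rewrite divr_gt0// mulr_gt0.
pose r := b `^ ((2 * s)^-1); have r0 : 0 < r by exact: powR_gt0.
exists r, ((2 * r / n.+1%:R) ^+ n); split=> //.
- by rewrite exprn_gt0// divr_gt0// mulr_gt0.
- by move=> x; exact: volume_eball_ge.
have rs : r `^ (2 * s) = b.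
  by rewrite -powRrM mulVf ?powRr1 ?ltW// mulf_neq0// gt_eqF.
rewrite powRN powRD; last first.
  by rewrite (gt_eqF (kernel_exponent_gt0 s0)).
rewrite rs (powR_mulrn _ (ltW r0)) (_ : 2 * r / n.+1%:R = 2 / n.+1%:R * r); last by ring.
have E : c / b / 4 = L + 1 by rewrite /b; field; rewrite !gt_eqF.
have rn0 : r ^+ n != 0 by rewrite gt_eqF// exprn_gt0.
rewrite exprMn -/c -E le_eqVlt; apply/orP; left; apply/eqP.
by field; rewrite rn0 gt_eqF.
Qed.

End small_radius.

Lemma integrable_bounded_support d (T : measurableType d) (R : realType)
    (mu : {measure set T -> \bar R}) (D : set T) (C : R) (h : T -> R) :
  measurable D -> (mu D < +oo)%E -> measurable_fun setT h ->
  (forall x, `|h x| <= C) -> (forall x, ~ D x -> h x = 0) ->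
  mu.-integrable setT (EFin \o h).
Proof.
move=> mD Doo mh hC h0; apply/integrableP; split; first exact/measurable_EFinP.
apply: (@le_lt_trans _ _ (\int[mu]_x (`|C| * \1_D x)%:E)%E).
  apply: ge0_le_integral => //.
  - by apply/measurable_EFinP; exact: measurableT_comp.
  - by apply/measurable_EFinP; apply: measurable_funM => //; exact: measurable_indic.
  move=> x _; rewrite /= lee_fin indicE; have [xD|xD] := boolP (x \in D).
    by rewrite mulr1; apply: le_trans (hC x) _; exact: ler_norm.
  have nD : ~ D x by move=> Dx; move/negP: xD; apply; exact: mem_set.
  by rewrite (h0 _ nD) normr0 mulr0.
under eq_integral do rewrite EFinM.
rewrite (@ge0_integralZl_EFin _ _ _ mu _ measurableT (fun x => (\1_D x)%:E))//.
  by rewrite integral_indic// setIT lte_mul_pinfty// lee_fin.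
by apply/measurable_EFinP; exact: measurable_indic.
Qed.

(** * Moving the plane *)

Section moving_plane.
Context {R : realType} {n : nat} (s : R) (s0 : 0 < s).
Context (Omega : set 'rV[R]_n) (rO : regopen Omega) (M : R)
  (OM : forall x, Omega x -> enorm x <= M).
Context (U : 'rV[R]_n -> R) (MU : R) (Upos : forall x, Omega x -> 0 < U x)
  (Uout : forall x, ~ Omega x -> U x = 0) (UM : forall x, U x <= MU)
  (Ucont : forall x, Omega x -> {for x, continuous U}).
Implicit Types (x y e : 'rV[R]_n) (l : R).

Definition ordered_at e l : Prop := forall x, dot x e <= l -> U (refl e l x) <= U x.

Definition cap_inside e l : Prop :=
  forall x, Omega x -> l < dot x e -> Omega (refl e l x).

Lemma open_regopen : open Omega.
Proof. by rewrite -rO; exact: open_interior. Qed.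

Lemma U_ge0 x : 0 <= U x.
Proof. by have [/Upos/ltW//|/Uout ->] := pselect (Omega x). Qed.

Lemma U_gt0 x : 0 < U x -> Omega x.
Proof. by move=> Ux; apply: contrapT => /Uout Ux0; move: Ux; rewrite Ux0 ltxx. Qed.

Lemma U_near x (eps : R) : Omega x -> 0 < eps ->
  exists2 r : R, 0 < r & forall y, eball x r y -> `|U x - U y| < eps.
Proof.
move=> Ox eps0; have /cvgrPdist_lt/(_ _ eps0)/nbhs_eballP[r r0 rU] := Ucont Ox.
by exists r.
Qed.

Lemma measurable_U : measurable_fun setT U.
Proof.
have mO : measurable Omega := open_measurable_rV open_regopen.
apply: (measurability _ (RGenOInfty.measurableE R)) => _ [_ [a ->] <-].
rewrite setTI; have [a0|a0] := ltP a 0.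
  rewrite (_ : _ @^-1` _ = setT)//; apply/seteqP; split=> // x _ /=.
  by rewrite in_itv /= andbT (lt_le_trans a0)// U_ge0.
apply: open_measurable_rV; apply/open_eballP => x /=; rewrite in_itv /= andbT => aU.
have Ox : Omega x by apply: U_gt0; exact: le_lt_trans aU.
have d0 : 0 < U x - a by rewrite subr_gt0.
have [r r0 rU] := U_near Ox d0; exists r => // y /rU.
by rewrite /= in_itv /= andbT ltr_norml => /andP[_]; lra.
Qed.

(** If the plane at height [l] is not a plane of symmetry, the difference with
    the mirror image is bounded below near some point; regularity of [Omega] is
    what prevents the difference from living on the mirror image of the
    boundary only. *)
Lemma strict_order_near e l x1 : enorm e = 1 -> cap_inside e l ->
  dot x1 e <= l -> U (refl e l x1) < U x1 ->
  exists x0 (r kappa : R), [/\ 0 < r, 0 < kappa, dot x0 e < l &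
    forall x x', eball x0 r x -> eball (refl e l x0) r x' -> kappa <= U x - U x'].
Proof.
move=> e1 cap x1l Ux1; have oO := open_regopen.
have [[x0 [Ox0 x0l ncl]]|allcl] :=
    pselect (exists x0, [/\ Omega x0, dot x0 e < l & ~ closure Omega (refl e l x0)]).
  have U2 : 0 < U x0 / 2 by rewrite divr_gt0// Upos.
  have [r r0 rU] := U_near Ox0 U2.
  have [r' r'0 r'O] : exists2 r' : R, 0 < r' & eball (refl e l x0) r' `<=` ~` closure Omega.
    have oc : open (~` closure Omega) by rewrite openC; exact: closed_closure.
    exact: (open_eballP _).1 oc _ ncl.
  exists x0, (Num.min r r'), (U x0 / 2); split=> //; first by rewrite lt_min r0.
  move=> x x'; rewrite /eball /= !lt_min => /andP[xr _] /andP[_ xr'].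
  rewrite (Uout (x := x')); last by move=> Ox'; exact: (r'O _ xr' (subset_closure Ox')).
  by have := rU _ xr; rewrite ltr_norml => /andP[_]; lra.
have Ox1 : Omega x1 by apply: U_gt0; exact: le_lt_trans (U_ge0 _) Ux1.
have x1l' : dot x1 e < l.
  by rewrite lt_neqAle x1l andbT; apply/eqP => x1e; move: Ux1; rewrite refl_fix// ltxx.
have Orx1 : Omega (refl e l x1).
  rewrite -rO.
  have [r r0 rO'] : exists2 r : R, 0 < r & eball x1 r `<=` Omega `&` [set z | dot z e < l].
    apply: (open_eballP _).1 => //; apply: openI => //.
    by apply: open_sublevel; exact: continuous_dot.
  apply/nbhs_eballP; exists r => // y; rewrite /eball /= enorm_refl_swap// => yr.
  have [Oy yl] := rO' _ yr.
  by rewrite -(reflK l e1 y); apply: contrapT => ncl; apply: allcl; exists (refl e l y).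
have v0 : 0 < (U x1 - U (refl e l x1)) / 3 by rewrite divr_gt0// subr_gt0.
have [r r0 rU] := U_near Ox1 v0; have [r' r'0 r'U] := U_near Orx1 v0.
exists x1, (Num.min r r'), ((U x1 - U (refl e l x1)) / 3); split=> //.
  by rewrite lt_min r0.
move=> x x'; rewrite /eball /= !lt_min => /andP[xr _] /andP[_ xr'].
by have := rU _ xr; have := r'U _ xr'; rewrite !ltr_norml => /andP[? ?] /andP[? ?]; lra.
Qed.

(** Where the mirror image lies outside [Omega] there is nothing to compare;
    elsewhere [U] is continuous at the mirror image, which moves continuously
    with the hyperplane. *)
Lemma ordered_at_limit e l : enorm e = 1 -> cap_inside e l ->
  (forall eps : R, 0 < eps -> exists l', [/\ l <= l', l' < l + eps & ordered_at e l']) ->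
  ordered_at e l.
Proof.
move=> e1 cap lim x xl; have [Orx|/Uout ->] := pselect (Omega (refl e l x)); last exact: U_ge0.
move: xl; rewrite le_eqVlt => /orP[/eqP xl|xl]; first by rewrite refl_fix.
rewrite leNgt; apply/negP => Ux.
have d0 : 0 < U (refl e l x) - U x by rewrite subr_gt0.
have [r r0 rU] := U_near Orx d0.
have [l' [ll' l'r ord]] := lim (r / 2) (divr_gt0 r0 (ltr0n _ 2)).
have : eball (refl e l x) r (refl e l' x).
  rewrite /eball /= (refl_shift e l l') opprD addrA subrr add0r enormN enormZ e1 mulr1.
  by rewrite ger0_norm; lra.
move=> /rU; rewrite ltr_norml => /andP[_].
have := ord x (le_trans (ltW xl) ll'); lra.
Qed.

(** A point where the order fails lies in [Omega] together with its mirror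
    image; by continuity the order fails on a whole neighbourhood. *)
Lemma ordered_at_ae e l : enorm e = 1 -> cap_inside e l ->
  {ae volume n, forall x, mirror_defect e l U x = 0} -> ordered_at e l.
Proof.
move=> e1 cap [N [mN N0 defN]] x xl; rewrite leNgt; apply/negP => Ux.
have Orx : Omega (refl e l x) by apply: U_gt0; exact: le_lt_trans (U_ge0 _) Ux.
have xl' : dot x e < l.
  by rewrite lt_neqAle xl andbT; apply/eqP => xe; move: Ux; rewrite refl_fix// ltxx.
have Ox : Omega x.
  by rewrite -(reflK l e1 x); apply: cap => //; rewrite dot_refl//; lra.
have d0 : 0 < (U (refl e l x) - U x) / 2 by rewrite divr_gt0// subr_gt0.
have [r r0 rU] := U_near Orx d0; have [r' r'0 r'U] := U_near Ox d0.
pose V := eball x (Num.min r r') `&` [set z | dot z e < l].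
have oV : open V.
  by apply: openI; [exact: open_eball|apply: open_sublevel; exact: continuous_dot].
have Vx : V x by split=> //=; rewrite /eball /= subrr enorm0 lt_min r0.
have VN : V `<=` N.
  move=> y [yr /= yl]; apply: defN => /=; rewrite mirror_defect_below ?ltW// /mirror_diff opprB.
  move: yr; rewrite /eball /= lt_min => /andP[yr yr'].
  have : eball (refl e l x) r (refl e l y) by rewrite /eball /= enorm_refl.
  move=> /rU h1; have h2 := r'U _ yr'.
  have h3 : 0 < U (refl e l y) - U y.
    by move: h1 h2; rewrite !ltr_norml => /andP[? ?] /andP[? ?]; lra.
  by rewrite max_r ?(ltW h3)// => /eqP; rewrite gt_eqF.
have : (0 < volume n V)%E by apply: volume_open_gt0 => //; exists x.
rewrite lt_neqAle => /andP[/eqP V0 _]; apply: V0; apply: esym; apply/eqP.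
rewrite -measure_le0 -N0; apply: le_measure; rewrite ?inE//.
exact: open_measurable_rV.
Qed.

(** [Omega] is the set where [U] is positive. *)
Lemma ordered_eq_symmetric e l : enorm e = 1 ->
  (forall x, dot x e <= l -> U (refl e l x) = U x) -> symmetric_at Omega e l.
Proof.
move=> e1 sym x Ox; apply: U_gt0; have [xl|xl] := leP (dot x e) l.
  by rewrite sym// Upos.
by rewrite -sym ?reflK ?Upos// dot_refl//; lra.
Qed.

End moving_plane.

Section defect_energy.
Context {R : realType} {n : nat} (s : R) (s0 : 0 < s).
Context (Omega : set 'rV[R]_n) (rO : regopen Omega) (M : R)
  (OM : forall x, Omega x -> enorm x <= M).
Context (U : 'rV[R]_n -> R) (MU : R) (Upos : forall x, Omega x -> 0 < U x)
  (Uout : forall x, ~ Omega x -> U x = 0) (UM : forall x, U x <= MU)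
  (Ucont : forall x, Omega x -> {for x, continuous U}).
Implicit Types (x y e : 'rV[R]_n) (l : R).
Local Notation mu := (volume n : {sigma_finite_measure set 'rV[R]_n -> \bar R}).
Local Notation mu2 := (mu \x mu)%E.
Local Notation K := (@frac_kernel R n s).

Context (F : R -> R) (L c : R) (L0 : 0 <= L) (c0 : 0 < c)
  (FL : forall a b, `|F a - F b| <= L * `|a - b|)
  (fU : finite_energy s mu U)
  (weak : forall (phi : 'rV[R]_n -> R) (C : R), finite_energy s mu phi ->
    (forall x, `|phi x| <= C) -> (forall x, ~ Omega x -> phi x = 0) ->
    c / 2 * \int[mu2]_z energy_density s U phi z = \int[mu]_x (F (U x) * phi x)).

Let oO := open_regopen rO.
Let mO : measurable Omega := open_measurable_rV oO.
Let mU := measurable_U rO Upos Uout Ucont.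
Let Uge0 := U_ge0 Upos Uout.
Let Ugt0 := U_gt0 Uout.

Lemma volume_Omega_lty : (volume n Omega < +oo)%E.
Proof. exact: volume_bounded_lty mO OM. Qed.

(** A positive defect requires a positive value at the mirror image, which is
    thus in the cap of [Omega] above the hyperplane. *)
Lemma mirror_defect_support e l x : enorm e = 1 -> cap_inside Omega e l ->
  0 < mirror_defect e l U x ->
  [/\ Omega x, Omega (refl e l x), dot x e < l &
      mirror_defect e l U x = U (refl e l x) - U x].
Proof.
move=> e1 cap; have [xl|xl] := leP (dot x e) l; last by rewrite mirror_defect_above// ltxx.
rewrite mirror_defect_below// /mirror_diff opprB lt_max ltxx /= => Ux.
have Orx : Omega (refl e l x) by apply: Ugt0; have := Uge0 x; lra.
have xl' : dot x e < l.
  by rewrite lt_neqAle xl andbT; apply/eqP => xe; move: Ux; rewrite refl_fix// subrr ltxx.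
split=> //; last by rewrite max_r// ltW.
by rewrite -(reflK l e1 x); apply: cap => //; rewrite dot_refl//; lra.
Qed.

Lemma mirror_defect_out e l x : enorm e = 1 -> cap_inside Omega e l ->
  ~ Omega x -> mirror_defect e l U x = 0.
Proof.
move=> e1 cap Ox; have := mirror_defect_ge0 e l U x; rewrite le_eqVlt => /orP[/eqP//|].
by move=> /(mirror_defect_support e1 cap)[].
Qed.

Lemma mirror_defect_le e l x : mirror_defect e l U x <= MU.
Proof.
have MU0 : 0 <= MU by exact: le_trans (Uge0 0) (UM 0).
rewrite /mirror_defect; case: ifP => // _; rewrite ge_max MU0 /=.
by have := UM (refl e l x); have := Uge0 x; lra.
Qed.

Lemma continuous_F : continuous F.
Proof.
move=> a; apply/cvgrPdist_lt => eps eps0.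
have L1 : 0 < L + 1 by rewrite ltr_wpDl.
exists (eps / (L + 1)) => [|b /= ab]; first by rewrite /= divr_gt0.
apply: le_lt_trans (FL a b) _; rewrite ltr_pdivlMr// mulrC in ab.
by apply: le_lt_trans ab; rewrite ler_wpM2r// lerDl.
Qed.

Lemma measurable_FU : measurable_fun setT (F \o U).
Proof. exact: measurableT_comp (continuous_measurable_fun continuous_F) mU. Qed.

Lemma FU_bounded x : `|F (U x)| <= `|F 0| + L * MU.
Proof.
rewrite -(subrK (F 0) (F (U x))); apply: le_trans (ler_normD _ _) _.
rewrite addrC lerD2l; apply: le_trans (FL _ _) _.
by rewrite subr0 ger0_norm ?ler_wpM2l.
Qed.

(** The weak formulation tested with the defect and with its mirror image. *)
Lemma defect_energy_bound e l : enorm e = 1 -> cap_inside Omega e l ->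
  (\int[mu2]_z (energy_density s (mirror_defect e l U) (mirror_defect e l U) z +
      repulsion s e l U z)%:E <=
   (8 * L / c * \int[mu]_x mirror_defect e l U x ^+ 2)%:E)%E.
Proof.
move=> e1 cap; set psi := mirror_defect e l U.
have mrefl : mpres mu (refl e l) := volume_refl l e1.
have mpsi : measurable_fun setT psi := measurable_mirror_defect mrefl mU.
have fpsi : finite_energy s mu psi := finite_energy_mirror_defect s0 e1 mrefl mU fU.
have fpsir := finite_energy_refl e1 mrefl fpsi.
have psi0 x : 0 <= psi x := mirror_defect_ge0 e l U x.
have psiM x : `|psi x| <= MU by rewrite ger0_norm// mirror_defect_le.
have psiout x : ~ Omega x -> psi x = 0 by exact: mirror_defect_out.
have psiout' x : ~ Omega x -> psi (refl e l x) = 0.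
  move=> Ox; have := psi0 (refl e l x); rewrite le_eqVlt => /orP[/eqP//|].
  by move=> /(mirror_defect_support e1 cap)[_]; rewrite reflK.
have MU0 : 0 <= MU by exact: le_trans (normr_ge0 _) (psiM 0).
have bnd (a b A B : R) : `|a| <= A -> `|b| <= B -> `|a * b| <= A * B.
  by move=> aA bB; rewrite normrM ler_pM.
have FU := FU_bounded.
have i1 : mu.-integrable setT (EFin \o (fun x => (F \o U) x * psi x)).
  apply: (integrable_bounded_support mO volume_Omega_lty (C := (`|F 0| + L * MU) * MU)).
  - exact: measurable_funM measurable_FU mpsi.
  - by move=> x; exact: (bnd _ _ _ _ (FU x) (psiM x)).
  - by move=> x Ox; rewrite psiout// mulr0.
have i2 : mu.-integrable setT (EFin \o (fun x => (F \o U) (refl e l x) * psi x)).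
  apply: (integrable_bounded_support mO volume_Omega_lty (C := (`|F 0| + L * MU) * MU)).
  - exact: measurable_funM (measurableT_comp measurable_FU mrefl.1) mpsi.
  - by move=> x; exact: (bnd _ _ _ _ (FU (refl e l x)) (psiM x)).
  - by move=> x Ox; rewrite psiout// mulr0.
have i3 : mu.-integrable setT (EFin \o (fun x => psi x ^+ 2)).
  apply: (integrable_bounded_support mO volume_Omega_lty (C := MU * MU)).
  - exact: measurable_funX.
  - by move=> x; rewrite expr2; exact: (bnd _ _ _ _ (psiM x) (psiM x)).
  - by move=> x Ox; rewrite psiout// expr0n.
apply: (defect_estimate s0 e1 mrefl mU c0 fU measurable_FU i1 i2 i3).
- exact: (weak fpsi psiM psiout).
- exact: (weak fpsir (fun x => psiM (refl e l x)) psiout').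
move=> x; have := psi0 x; rewrite le_eqVlt => /orP[/eqP px|px].
  by rewrite -/psi -px expr0n /= !mulr0.
have [_ _ _ E] := mirror_defect_support e1 cap px.
rewrite -/psi expr2 mulrA ler_pM2r//; apply: le_trans (ler_norm _) _.
apply: le_trans (FL _ _) _; rewrite -E -/psi ger0_norm//.
Qed.

End defect_energy.

Section plane_step.
Context {R : realType} {n : nat} (s : R) (s0 : 0 < s).
Context (Omega : set 'rV[R]_n) (rO : regopen Omega) (M : R)
  (OM : forall x, Omega x -> enorm x <= M).
Context (U : 'rV[R]_n -> R) (MU : R) (Upos : forall x, Omega x -> 0 < U x)
  (Uout : forall x, ~ Omega x -> U x = 0) (UM : forall x, U x <= MU)
  (Ucont : forall x, Omega x -> {for x, continuous U}).
Implicit Types (x y e : 'rV[R]_n) (l : R).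
Local Notation mu := (volume n : {sigma_finite_measure set 'rV[R]_n -> \bar R}).
Local Notation mu2 := (mu \x mu)%E.
Local Notation gap := (@gap R n s).

Context (F : R -> R) (L c : R) (L0 : 0 <= L) (c0 : 0 < c)
  (FL : forall a b, `|F a - F b| <= L * `|a - b|)
  (fU : finite_energy s mu U)
  (weak : forall (phi : 'rV[R]_n -> R) (C : R), finite_energy s mu phi ->
    (forall x, `|phi x| <= C) -> (forall x, ~ Omega x -> phi x = 0) ->
    c / 2 * \int[mu2]_z energy_density s U phi z = \int[mu]_x (F (U x) * phi x)).

Let oO := open_regopen rO.
Let mO : measurable Omega := open_measurable_rV oO.
Let volO := volume_Omega_lty rO OM.
Let mU := measurable_U rO Upos Uout Ucont.
Let Uge0 := U_ge0 Upos Uout.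
Let Ugt0 := U_gt0 Uout.

Lemma measurable_gap (D d0 l : R) e :
  measurable_fun setT (fun y => gap D d0 (l - dot y e)).
Proof.
apply: measurable_funB => //; apply: (measurableT_comp (@measurable_powR R _)).
apply: measurable_funD => //; apply: measurable_funM => //; apply: measurable_funB => //.
by apply: continuous_measurable_rV; exact: continuous_dot.
Qed.

(** Points of [Omega] whose image under the plane at height [l_ k] stays in
    [Omega] although the limit image does not: the reflection in the former
    plane turns them into points of [Omega] moved out by a small translation. *)
Lemma escaping_points e l (l_ : nat -> R) : enorm e = 1 ->
  (forall eps : R, 0 < eps -> exists k0, forall k, (k0 <= k)%N -> `|l - l_ k| < eps) ->
  forall eps : R, 0 < eps -> exists k0, forall k, (k0 <= k)%N ->
  (volume n [set y | [/\ Omega y, Omega (refl e (l_ k) y) & ~ Omega (refl e l y)]] <= eps%:E)%E.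
Proof.
move=> e1 lim eps eps0.
pose E k := Omega `&` ((fun z => z + (2 * (l - l_ k)) *: e) @^-1` (~` Omega)).
have mE k : measurable (E k).
  apply: measurableI => //; apply: measurable_preimageT; first exact: measurable_addr.
  exact: measurableC.
have leave x : Omega x -> exists k, forall j, (k <= j)%N -> ~ E j x.
  move=> Ox; have [r r0 rO'] := (open_eballP _).1 oO x Ox.
  have [k0 k0P] := lim (r / 2) (divr_gt0 r0 (ltr0n _ 2)).
  exists k0 => j /k0P jr [_]; apply; apply: rO'.
  rewrite /eball /= opprD addrA subrr add0r enormN enormZ e1 mulr1 normrM.
  by rewrite ger0_norm//; lra.
have [k0 k0P] := eventually_left_measure mO volO mE (fun k => @subIsetl _ _ _)
  leave eps0.
exists k0 => k /k0P; apply: le_trans.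
have mk := volume_refl (l_ k) e1.
set C := [set y | _].
have mC : measurable C.
  have -> : C = Omega `&` (refl e (l_ k) @^-1` Omega `&` refl e l @^-1` (~` Omega)).
    by apply/seteqP; split=> [y [? ? ?]|y [? [? ?]]].
  apply: measurableI => //; apply: measurableI; apply: measurable_preimageT => //.
  - exact: mk.1.
  - exact: (volume_refl l e1).1.
  - exact: measurableC.
rewrite -(mk.2 C mC); apply: le_measure; rewrite ?inE//.
  by apply: measurable_preimageT => //; exact: mk.1.
move=> z [_]; rewrite reflK// => Oz nO; split=> //= Oz'; apply: nO.
rewrite (_ : refl e l _ = z + (2 * (l - l_ k)) *: e)//.
by rewrite (refl_shift e (l_ k) l) reflK.
Qed.

(** If the hyperplane at height [l] is not one of symmetry, then [U] exceeds its
    reflection by [kappa] near a point [x0] below it, also for slightly lower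
    hyperplanes.  The repulsion coming from this region bounds the defect at [y]
    by a quantity [g_ k y] that is positive below the hyperplane, except on a
    contact set [A k] where the defect is comparable with [g_ k].  As the contact
    sets shrink, [defect_vanishes] eventually applies. *)
Lemma plane_step e l (l_ : nat -> R) x1 : enorm e = 1 -> (forall k, l_ k < l) ->
  (forall eps : R, 0 < eps -> exists k0, forall k, (k0 <= k)%N -> `|l - l_ k| < eps) ->
  cap_inside Omega e l -> (forall k, cap_inside Omega e (l_ k)) ->
  ordered_at U e l -> dot x1 e <= l -> U (refl e l x1) < U x1 ->
  exists k, ordered_at U e (l_ k).
Proof.
move=> e1 ltl lim cap cap_ ord x1l Ux1.
have [x0 [r0 [kappa [r00 kappa0 x0l near]]]] :=
  strict_order_near rO Upos Uout Ucont e1 cap x1l Ux1.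
pose eta := (l - dot x0 e) / 2; have eta0 : 0 < eta by rewrite /eta; lra.
pose r1 := Num.min (r0 / 2) eta; have r10 : 0 < r1 by rewrite lt_min eta0 andbT; lra.
have [r1r r1eta] : r1 <= r0 / 2 /\ r1 <= eta by split; rewrite ge_min lexx ?orbT.
pose B := eball x0 r1; have mB : measurable B := measurable_eball x0 r1.
have Boo : (volume n B < +oo)%E.
  apply: (volume_bounded_lty (r := enorm x0 + r1)) => // x; rewrite /B /eball /= => xr.
  by have := ler_enormD (x - x0) x0; rewrite subrK (enorm_distC x); lra.
have B0 : (0 < volume n B)%E.
  by apply: volume_open_gt0; [exact: open_eball|exists x0; rewrite /B /eball /= subrr enorm0].
have Bfin : volume n B \is a fin_num by rewrite ge0_fin_numE.
pose w := fine (volume n B); have w0 : 0 < w by rewrite fine_gt0// B0.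
have Bw : mu B = w%:E by rewrite fineK.
pose D := `|M| + enorm x0 + r1 + 1.
have D0 : 0 < D by have := normr_ge0 M; have := enorm_ge0 x0; rewrite /D; lra.
pose d0 := eta / 2; have d00 : 0 < d0 by rewrite divr_gt0.
pose L' := 8 * L / c.
have L'0 : 0 <= L' by exact: divr_ge0 (mulr_ge0 (ler0n _ _) L0) (ltW c0).
have [r [W [r_gt0 W0 Wball hW]]] := exists_small_radius n s0 L'0.
pose a := L' + r `^ (- (n%:R + 2 * s)) * W / 2.
have a0 : 0 < a.
  rewrite /a ltr_wpDl// divr_gt0// mulr_gt0//; exact: powR_gt0.
pose g_ k y := if dot y e <= l_ k then kappa * gap D d0 (l_ k - dot y e) else 0.
have mg k : measurable_fun setT (g_ k).
  apply: measurable_fun_ifT => //; first exact: measurable_halfspace_bool.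
  by apply: measurable_funM => //; exact: measurable_gap.
have g0 k y : 0 <= g_ k y.
  rewrite /g_; case: ifPn => // yl; apply: mulr_ge0; first exact: ltW.
  by apply: gap_ge0 => //; rewrite subr_ge0.
pose psi_ k := mirror_defect e (l_ k) U.
have mrefl k : mpres mu (refl e (l_ k)) := volume_refl (l_ k) e1.
have mpsi k : measurable_fun setT (psi_ k) := measurable_mirror_defect (mrefl k) mU.
pose A k := [set y | 0 < psi_ k y /\ w * g_ k y <= a * psi_ k y].
have mA k : measurable (A k) by exact: measurable_contact_set.
(* At a point [y] with [refl e l y] in [Omega] the defect tends to zero by
   continuity of [U] while [g_ k y] stays bounded below; the other points are
   those of [escaping_points]. *)
have smallA : exists k2, forall k, (k2 <= k)%N -> (volume n (A k) <= (W / 2)%:E)%E.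
  have W4 : 0 < W / 4 by rewrite divr_gt0.
  have [kC kCP] := escaping_points e1 lim W4.
  pose A' k := A k `&` (refl e l @^-1` Omega).
  have mA' k : measurable (A' k).
    apply: measurableI => //; apply: measurable_preimageT => //.
    exact: (volume_refl l e1).1.
  have A'O k : A' k `<=` Omega.
    by move=> y [[py _] _]; have [] := mirror_defect_support Upos Uout e1 (cap_ k) py.
  have leave y : Omega y -> exists k, forall j, (k <= j)%N -> ~ A' j y.
    move=> Oy; have [Ory|nOry] := pselect (Omega (refl e l y)); last first.
      by exists 0%N => j _ [_ /nOry].
    have [ly|yl] := leP l (dot y e).
      exists 0%N => j _ [[+ _] _]; rewrite /psi_ mirror_defect_above ?ltxx//.
      exact: lt_le_trans (ltl j) ly.
    pose d := (l - dot y e) / 2; have dd : 0 < d by rewrite /d; lra.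
    have gap0 := gap_gt0 (n := n) s0 D0 d00 dd.
    pose eps := w * (kappa * gap D d0 d) / a.
    have eps0 : 0 < eps by rewrite divr_gt0// mulr_gt0// mulr_gt0.
    have [r' r'0 r'U] := U_near Ucont Ory eps0.
    have [k1 k1P] := lim _ dd.
    have [k2 k2P] := lim (r' / 2) (divr_gt0 r'0 (ltr0n _ 2)).
    exists (maxn k1 k2) => j; rewrite geq_max => /andP[/k1P j1 /k2P j2] [[py contact] _].
    have [_ _ yj E] := mirror_defect_support Upos Uout e1 (cap_ j) py.
    have : eball (refl e l y) r' (refl e (l_ j) y).
      rewrite /eball /= (refl_shift e l (l_ j)) opprD addrA subrr add0r enormN enormZ e1 mulr1.
      by rewrite normrM distrC ger0_norm//; lra.
    move=> /r'U; rewrite ltr_norml => /andP[h1 _].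
    have h2 := ord y (ltW yl).
    have h3 : psi_ j y < eps by rewrite /psi_ E; lra.
    have h4 : kappa * gap D d0 d <= g_ j y.
      rewrite /g_ (ltW yj); apply: ler_wpM2l; first exact: ltW.
      apply: gap_le => //; first exact: ltW.
      by move: j1; rewrite ltr_norml /d => /andP[_]; lra.
    have h5 : w * (kappa * gap D d0 d) <= a * psi_ j y.
      by apply: le_trans contact; rewrite ler_pM2l.
    by move: h3; rewrite /eps ltr_pdivlMr// mulrC ltNge h5.
  have [kA kAP] := eventually_left_measure mO volO mA' A'O leave W4.
  exists (maxn kA kC) => k; rewrite geq_max => /andP[/kAP hA /kCP hC].
  set C := [set y | [/\ _, _ & _]] in hC.
  have mC : measurable C.
    have -> : C = Omega `&` (refl e (l_ k) @^-1` Omega `&` refl e l @^-1` (~` Omega)).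
      by apply/seteqP; split=> [y [? ? ?]|y [? [? ?]]].
    apply: measurableI => //; apply: measurableI; apply: measurable_preimageT => //.
    - exact: (volume_refl (l_ k) e1).1.
    - exact: (volume_refl l e1).1.
    - exact: measurableC.
  apply: (@le_trans _ _ (volume n (A' k `|` C))).
    apply: le_measure; rewrite ?inE//; first exact: measurableU.
    move=> y Ay; have [Ory|nOry] := pselect (Omega (refl e l y)); first by left.
    have [py _] := Ay.
    by have [? ? _ _] := mirror_defect_support Upos Uout e1 (cap_ k) py; right; split.
  apply: (le_trans (measureU2 (volume n) (mA' k) mC)).
  rewrite (_ : (W / 2)%:E = (W / 4)%:E + (W / 4)%:E)%E; first exact: leeD.
  by rewrite -EFinD; congr EFin; field.
have [k2 k2P] := smallA.
have dr : 0 < Num.min d0 (r0 / 8) by rewrite lt_min d00 divr_gt0.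
have [k1 k1P] := lim _ dr.
pose k := maxn k1 k2; exists k.
have {}k1P : `|l - l_ k| < Num.min d0 (r0 / 8) by apply: k1P; exact: leq_maxl.
have {}k2P := k2P k (leq_maxr _ _).
have [lk1 lk2] : `|l - l_ k| < d0 /\ `|l - l_ k| < r0 / 8.
  by move: k1P; rewrite lt_min => /andP.
apply: (ordered_at_ae Upos Uout Ucont e1 (cap_ k)).
have psi0 x : 0 <= psi_ k x := mirror_defect_ge0 e (l_ k) U x.
have ipsi : mu.-integrable setT (EFin \o (fun x => psi_ k x ^+ 2)).
  have psiM x : psi_ k x <= MU := mirror_defect_le Upos Uout UM e (l_ k) x.
  apply: (integrable_bounded_support mO volO (C := MU * MU)).
  - exact: measurable_funX.
  - move=> x; rewrite (ger0_norm (sqr_ge0 _)) expr2.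
    exact: (ler_pM (psi0 x) (psi0 x) (psiM x) (psiM x)).
  - by move=> x Ox; rewrite /psi_ (mirror_defect_out Upos Uout e1 (cap_ k) Ox) expr0n.
have mq : measurable_fun setT (repulsion s e (l_ k) U) := measurable_repulsion s (mrefl k) mU.
have q0 z : 0 <= repulsion s e (l_ k) U z := repulsion_ge0 s0 (l_ k) e1 U z.
apply: (defect_vanishes s0 (mpsi k) psi0 ipsi (mg k) (g0 k) mq q0 mB w0 Bw r_gt0 W0 L'0
  Wball hW) => //.
  exact: (defect_energy_bound s0 rO OM Upos Uout UM Ucont L0 c0 FL fU weak e1 (cap_ k)).
move=> [x y] /=; rewrite indicE; have [xB|xB] := boolP (x \in B); last by rewrite mul0r.
rewrite mul1r; have := psi0 y; rewrite le_eqVlt => /orP[/eqP <-|py]; first by rewrite mulr0.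
have [Oy _ yl Ey] := mirror_defect_support Upos Uout e1 (cap_ k) py.
rewrite inE in xB.
have xl : d0 <= l_ k - dot x e.
  have := normr_dot (x0 - x) e; rewrite e1 mulr1 dotDl dotNl ler_norml => /andP[h _].
  move: lk1 xB; rewrite /B /eball /= ltr_norml => /andP[_ h2] h3.
  by move: r1eta h h2 h3; rewrite /d0 /eta; lra.
have vx : kappa <= mirror_diff e (l_ k) U x.
  apply: near; first by move: xB; rewrite /B /eball /=; lra.
  apply: le_lt_trans (ler_edistD (refl e l x) _ _) _.
  rewrite enorm_refl// (refl_shift e l (l_ k)) opprD addrA subrr add0r enormN enormZ e1 mulr1.
  by rewrite normrM distrC ger0_norm//; move: xB; rewrite /B /eball /=; lra.
have xy : x != y.
  apply/eqP => xy; move: vx; rewrite xy => vx.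
  by move: py; rewrite /psi_ Ey; move: vx; rewrite /mirror_diff; lra.
have xyD : enorm (x - y) <= D.
  have h1 := ler_enormD (x - x0) (x0 - y); rewrite addrA subrK in h1.
  have h2 := ler_enormD x0 (- y); rewrite enormN in h2.
  have h3 := OM Oy; have h4 := ler_norm M.
  move: xB; rewrite /B /eball /= enorm_distC => h5.
  by rewrite /D; lra.
have ly : 0 <= l_ k - dot y e by rewrite subr_ge0 ltW.
have kgap := kernel_gap s0 e1 d00 xy xyD xl ly.
have gap0 := gap_ge0 (n := n) s0 D0 d00 ly.
rewrite /repulsion /= (ltW yl) (_ : dot x e <= l_ k); last by rewrite -subr_ge0 (le_trans (ltW d00)).
rewrite /= /g_ (ltW yl) mulrA; apply: ler_wpM2r; first exact: psi0.
rewrite mulrC; apply: ler_pM => //; first exact: ltW.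
by rewrite le_max vx.
Qed.

End plane_step.

(** * The plane at the critical height *)

Section power_difference_quotient.
Context {R : realType} (alpha : R).

Lemma powR_continuous_pos (c a : R) : 0 < a -> {for a, continuous (fun x : R => x `^ c)}.
Proof.
move=> a0; apply/differentiable_continuous/derivable1_diffP.
by apply: ex_derive; exact: is_derive1_powR.
Qed.

Lemma powRN_mvt (a b : R) : 0 < a -> 0 < b ->
  exists2 xi : R, Num.min a b <= xi <= Num.max a b &
    a `^ (- alpha) - b `^ (- alpha) = alpha * xi `^ (- alpha - 1) * (b - a).
Proof.
move=> a0 b0.
have main (u w : R) : 0 < u -> u <= w -> exists2 xi : R, u <= xi <= w &
    w `^ (- alpha) - u `^ (- alpha) = - alpha * xi `^ (- alpha - 1) * (w - u).
  move=> u0 uw.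
  have der x : u <= x -> is_derive x 1 (fun x => x `^ (- alpha)) (- alpha * x `^ (- alpha - 1)).
    by move=> ux; exact: is_derive1_powR (lt_le_trans u0 ux).
  have [x xuw||xi xiuw E] := @MVT_segment R (fun x => x `^ (- alpha))
    (fun x => - alpha * x `^ (- alpha - 1)) u w uw.
  - by apply: der; move: xuw; rewrite in_itv /= => /andP[/ltW].
  - apply: derivable_within_continuous => x; rewrite in_itv /= => /andP[ux _].
    have := der x ux; move=> dx.
    by apply: ex_derive.
  by exists xi; [move: xiuw; rewrite in_itv|exact: E].
have [ab|/ltW ba] := leP a b.
  have [xi xiab E] := main a b a0 ab; exists xi => //.
  by rewrite -opprB E; ring.
have [xi xiab E] := main b a b0 ba; exists xi => //.
by rewrite E; ring.
Qed.

Lemma dist_between (r a b c d : R) : `|d - a| < r -> `|d - b| < r ->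
  Num.min a b <= c <= Num.max a b -> `|d - c| < r.
Proof.
rewrite !ltr_norml => /andP[a1 a2] /andP[b1 b2] /andP[].
by rewrite ge_min le_max => /orP[ac|bc] /orP[ca|cb]; apply/andP; split; lra.
Qed.

End power_difference_quotient.

Lemma Rintegral_scaledB d (T : measurableType d) (R : realType)
    (mu : {measure set T -> \bar R}) (a : R) (f g h : T -> R) :
  (forall x, h x = a * (f x - g x)) ->
  mu.-integrable setT (EFin \o f) -> mu.-integrable setT (EFin \o g) ->
  mu.-integrable setT (EFin \o h) /\
  \int[mu]_x h x = a * (\int[mu]_x f x - \int[mu]_x g x).
Proof.
move=> hE intf intg.
have -> : h = fun x => a * (f x - g x) by apply/funext.
have intB : mu.-integrable setT (EFin \o (fun x => f x - g x)).
  exact: (eq_integrable measurableT _ _ (fun x _ => erefl) (integrableB measurableT intf intg)).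
split; last by rewrite RintegralZl// RintegralB.
exact: (eq_integrable measurableT _ _ (fun x _ => erefl) (integrableZl measurableT a intB)).
Qed.

Section critical_plane.
Context {R : realType} {n : nat} (s : R) (s0 : 0 < s).
Context (Omega : set 'rV[R]_n) (rO : regopen Omega) (O0 : Omega !=set0) (M : R)
  (OM : forall x, Omega x -> enorm x <= M).
Context (U : 'rV[R]_n -> R) (MU : R) (Upos : forall x, Omega x -> 0 < U x)
  (Uout : forall x, ~ Omega x -> U x = 0) (UM : forall x, U x <= MU)
  (Ucont : forall x, Omega x -> {for x, continuous U}).
Implicit Types (x y q e : 'rV[R]_n) (l t : R).
Local Notation mu := (volume n : {sigma_finite_measure set 'rV[R]_n -> \bar R}).
Local Notation K := (@frac_kernel R n s).
Local Notation alpha := ((n%:R + 2 * s) / 2).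

Let oO := open_regopen rO.
Let mO : measurable Omega := open_measurable_rV oO.
Let volO := volume_Omega_lty rO OM.
Let mU := measurable_U rO Upos Uout Ucont.
Let Uge0 := U_ge0 Upos Uout.
Let Ugt0 := U_gt0 Uout.

(** Pairing each point with its mirror image gives a nonnegative integrand, which
    vanishes almost everywhere; it is positive on the region provided by
    [strict_order_near] unless [U] is symmetric. *)
Lemma odd_weight_symmetric e l (W : 'rV[R]_n -> R) : enorm e = 1 ->
  cap_inside Omega e l -> ordered_at U e l ->
  measurable_fun setT W -> (forall y, W (refl e l y) = - W y) ->
  (forall y, Omega y -> dot y e < l -> 0 < W y) ->
  mu.-integrable setT (EFin \o (fun y => U y * W y)) ->
  \int[mu]_y (U y * W y) = 0 ->
  forall x, dot x e <= l -> U (refl e l x) = U x.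
Proof.
move=> e1 cap ord mW Wodd Wpos iUW IUW x1 x1l; apply/eqP; rewrite eq_le ord//=.
rewrite leNgt; apply/negP => Ux1.
have mrefl : mpres mu (refl e l) := volume_refl l e1.
have i1 := integrable_mpres mrefl iUW.
have i2 := integrableD measurableT iUW i1.
have I2 : \int[mu]_y (U y * W y + U (refl e l y) * W (refl e l y)) = 0.
  apply: etrans (RintegralD measurableT iUW i1) _.
  have mUW : measurable_fun setT (fun y => U y * W y) by exact: measurable_funM.
  have E := Rintegral_mpres mrefl mUW.
  by apply: etrans (congr2 +%R IUW (etrans E IUW)) _; rewrite addr0.
have pos y : 0 <= U y * W y + U (refl e l y) * W (refl e l y).
  rewrite Wodd mulrN -mulrBl.
  have below z : dot z e <= l -> 0 <= (U z - U (refl e l z)) * W z.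
    rewrite le_eqVlt => /orP[/eqP zl|zl]; first by rewrite refl_fix// subrr mul0r.
    have := ord z (ltW zl); rewrite le_eqVlt => /orP[/eqP ->|Uz].
      by rewrite subrr mul0r.
    have Oz : Omega z by apply: Ugt0; exact: le_lt_trans (Uge0 _) Uz.
    by rewrite mulr_ge0 ?subr_ge0 ?(ltW Uz) ?(ltW (Wpos _ Oz zl)).
  have [yl|yl] := leP (dot y e) l; first exact: below.
  have ryl : dot (refl e l y) e <= l by rewrite dot_refl//; lra.
  by have := below _ ryl; rewrite reflK// Wodd mulrN -mulNr opprB.
have I2' : \int[mu]_y (U y * W y + U (refl e l y) * W (refl e l y)) <= 0 by rewrite I2.
have [N [mN N0 hN]] := Rintegral_eq0_ae i2 pos I2'.
have [x0 [r [kappa [r0 kappa0 x0l near]]]] :=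
  strict_order_near rO Upos Uout Ucont e1 cap x1l Ux1.
pose V := eball x0 r `&` [set z | dot z e < l].
have oV : open V.
  by apply: openI; [exact: open_eball|apply: open_sublevel; exact: continuous_dot].
have VN : V `<=` N.
  move=> y [yr /= yl]; apply: hN => /=; apply/eqP; rewrite gt_eqF// Wodd mulrN -mulrBl.
  have v0 : kappa <= U y - U (refl e l y).
    by apply: near => //; rewrite /eball /= enorm_refl.
  have Oy : Omega y by apply: Ugt0; have := Uge0 (refl e l y); lra.
  by apply: mulr_gt0; [exact: lt_le_trans v0|exact: Wpos].
have V0 : (0 < volume n V)%E.
  by apply: volume_open_gt0 => //; exists x0; split=> //=; rewrite /eball /= subrr enorm0.
have : (volume n V <= volume n N)%E.
  by apply: le_measure; rewrite ?inE//; exact: open_measurable_rV.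
by rewrite N0 leNgt V0.
Qed.

Lemma integrable_U_bounded (C : R) (W : 'rV[R]_n -> R) : measurable_fun setT W ->
  (forall y, Omega y -> `|W y| <= C) ->
  mu.-integrable setT (EFin \o (fun y => U y * W y)).
Proof.
move=> mW WC.
apply: (integrable_bounded_support mO volO (C := MU * `|C|)).
- exact: measurable_funM.
- move=> y; have [Oy|nOy] := pselect (Omega y).
    rewrite normrM; apply: ler_pM => //.
      by rewrite ger0_norm ?Uge0 ?UM.
    exact: le_trans (WC _ Oy) (ler_norm _).
  rewrite (Uout nOy) mul0r normr0 mulr_ge0//; exact: le_trans (Uge0 0) (UM 0).
- by move=> y nOy; rewrite (Uout nOy) mul0r.
Qed.

Context (t : R) (t0 : 0 < t) (e : 'rV[R]_n) (e1 : enorm e = 1) (l : R).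
Local Notation Gamma_t := (outer_parallel Omega t).

Definition potential x : R := \int[mu]_y (U y * K x y).

Lemma parallel_far q y : Gamma_t q -> Omega y -> t <= enorm (q - y).
Proof. by move=> Gq Oy; rewrite -[t]Gq; exact: edist_le. Qed.

Lemma parallel_neq q y : Gamma_t q -> Omega y -> q != y.
Proof.
move=> Gq Oy; apply/eqP => qy; have := parallel_far Gq Oy.
by rewrite qy subrr enorm0 leNgt t0.
Qed.

Lemma parallel_dot_ge q y : Gamma_t q -> Omega y -> t ^+ 2 <= dot (q - y) (q - y).
Proof.
move=> Gq Oy; rewrite -sqr_enorm ler_sqr ?nnegrE ?enorm_ge0 ?(ltW t0)//.
exact: parallel_far.
Qed.

Lemma parallel_kernel_le q y : Gamma_t q -> Omega y -> K q y <= (t ^+ 2) `^ (- alpha).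
Proof.
move=> Gq Oy; rewrite kernel_dot; apply: powRN_anti => //; first by rewrite exprn_gt0.
exact: parallel_dot_ge.
Qed.

Lemma measurable_kernel_at q : measurable_fun setT (K q).
Proof.
exact: (@measurable_frac_kernel _ _ s _ _ (fun=> q) id (measurable_cst _) (@measurable_id _ _ setT)).
Qed.

Lemma integrable_U_kernel q : Gamma_t q ->
  mu.-integrable setT (EFin \o (fun y => U y * K q y)).
Proof.
move=> Gq; apply: (integrable_U_bounded (C := (t ^+ 2) `^ (- alpha))).
  exact: measurable_kernel_at.
by move=> y Oy; rewrite ger0_norm ?kernel_ge0// parallel_kernel_le.
Qed.

(** The ends of the chord are mirror images of each other, and a point below the
    hyperplane is closer to the lower end; the difference of the two kernels is
    thus an odd weight, positive below the hyperplane. *)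
Lemma chord_symmetric q (d : R) : cap_inside Omega e l -> ordered_at U e l ->
  0 < d -> Gamma_t q -> Gamma_t (q + d *: e) -> dot q e + d / 2 = l ->
  potential q = potential (q + d *: e) ->
  forall x, dot x e <= l -> U (refl e l x) = U x.
Proof.
move=> cap ord d0 Gq Gp hl pot.
have rq : refl e l q = q + d *: e.
  rewrite (refl_shift e (dot q e) l q) (refl_fix (erefl (dot q e))) -hl; congr (_ + _ *: _).
  by move: (dot q e) => a; field.
have ql : 0 < l - dot q e by rewrite -hl addrC addKr divr_gt0.
have iq := integrable_U_kernel Gq; have ip := integrable_U_kernel Gp.
pose W y := K q y - K (q + d *: e) y.
have mW : measurable_fun setT W by apply: measurable_funB; exact: measurable_kernel_at.
have EW y : U y * W y = 1 * (U y * K q y - U y * K (q + d *: e) y) by rewrite mul1r /W mulrBr.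
have [iW IW] := Rintegral_scaledB EW iq ip.
have {}IW : \int[mu]_y (U y * W y) = 1 * (potential q - potential (q + d *: e)) := IW.
apply: (odd_weight_symmetric e1 cap ord mW).
- by move=> y; rewrite /W -rq (kernel_refl s l q y e1) -(kernel_refl_swap s l q y e1) opprB.
- move=> y Oy yl; rewrite subr_gt0 -rq; apply: (ltr_kernel_refl s0 e1 (parallel_neq Gq Oy)).
  by move: yl; rewrite -(subr_gt0 _ l); exact: mulr_gt0.
- exact: iW.
by rewrite IW pot subrr mulr0.
Qed.

(** Chords shrinking to a point of the critical plane: the difference quotients
    of the potential converge to its derivative along [e]. *)
Lemma tangent_symmetric q (q_ : nat -> 'rV[R]_n) (d_ : nat -> R) :
  cap_inside Omega e l -> ordered_at U e l ->
  Gamma_t q -> dot q e = l ->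
  (forall k, [/\ 0 < d_ k, Gamma_t (q_ k), Gamma_t (q_ k + d_ k *: e),
    enorm (q - q_ k) < k.+1%:R^-1 & `|d_ k| < k.+1%:R^-1]) ->
  (forall k, potential (q_ k) = potential (q_ k + d_ k *: e)) ->
  forall x, dot x e <= l -> U (refl e l x) = U x.
Proof.
move=> cap ord Gq ql seqP pot.
(* [- W] is the derivative of [K x y] in [x] along [e], taken at [q]. *)
pose W y : R := 2 * alpha * (l - dot y e) * dot (q - y) (q - y) `^ (- alpha - 1).
pose D k y : R := (K (q_ k) y - K (q_ k + d_ k *: e) y) / d_ k.
have mdotq (x : 'rV[R]_n) : measurable_fun setT (fun y => dot (x - y) (x - y)).
  apply: continuous_measurable_rV => y.
  rewrite (_ : (fun y => _) = (fun y => enorm (x - y) * enorm (x - y))); last first.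
    by apply/funext => z; rewrite -expr2 sqr_enorm.
  by apply: (@cvgM _ _ (nbhs y)); exact: continuous_enorm_dist.
have mW : measurable_fun setT W.
  apply: measurable_funM.
    apply: measurable_funM => //; apply: measurable_funB => //.
    by apply: continuous_measurable_rV; exact: continuous_dot.
  exact: (measurableT_comp (@measurable_powR R _) (mdotq q)).
have mD k : measurable_fun setT (D k).
  by apply: measurable_funM => //; apply: measurable_funB; exact: measurable_kernel_at.
have MVT k y : Omega y -> exists2 xi : R,
    Num.min (dot (q_ k - y) (q_ k - y))
      (dot (q_ k + d_ k *: e - y) (q_ k + d_ k *: e - y)) <= xi <=
    Num.max (dot (q_ k - y) (q_ k - y))
      (dot (q_ k + d_ k *: e - y) (q_ k + d_ k *: e - y)) &
    D k y = alpha * xi `^ (- alpha - 1) * (2 * dot (q_ k - y) e + d_ k).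
  move=> Oy; have [dk Gqk Gpk _ _] := seqP k.
  have t2 : 0 < t ^+ 2 by rewrite exprn_gt0.
  have a0 := lt_le_trans t2 (parallel_dot_ge Gqk Oy).
  have b0 := lt_le_trans t2 (parallel_dot_ge Gpk Oy).
  have [xi xib E] := powRN_mvt alpha a0 b0; exists xi => //.
  rewrite /D !kernel_dot E.
  have -> : dot (q_ k + d_ k *: e - y) (q_ k + d_ k *: e - y) -
      dot (q_ k - y) (q_ k - y) = d_ k * (2 * dot (q_ k - y) e + d_ k).
    by rewrite !dotE -(sqr_enorm e) e1 (dotC e) (dotC e) (dotC y); ring.
  by rewrite mulrCA mulrC mulKf// gt_eqF.
have cq : q_ @ \oo --> q.
  move=> A /nbhs_eballP[r r0 rA].
  have [k _ kP] := near_infty_natSinv_lt (PosNum r0); exists k => // j kj.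
  by apply: rA; have [_ _ _ h _] := seqP j; exact: lt_trans h (kP _ kj).
have cd : d_ @ \oo --> (0 : R).
  apply/cvgrPdist_lt => r r0.
  have [k _ kP] := near_infty_natSinv_lt (PosNum r0); exists k => // j kj.
  rewrite /= sub0r normrN.
  by have [_ _ _ _ h] := seqP j; exact: lt_trans h (kP _ kj).
have cp : (fun k => q_ k + d_ k *: e) @ \oo --> q.
  move=> A /nbhs_eballP[r r0 rA]; have r2 : 0 < r / 2 by rewrite divr_gt0.
  have [k _ kP] := near_infty_natSinv_lt (PosNum r2); exists k => // j kj.
  apply: rA; rewrite /eball /= opprD addrA; apply: le_lt_trans (ler_enormD _ _) _.
  rewrite enormN enormZ e1 mulr1 [ltRHS]splitr; have [_ _ _ h1 h2] := seqP j.
  by apply: ltrD; [exact: lt_trans h1 (kP _ kj)|exact: lt_trans h2 (kP _ kj)].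
have ccont (y : 'rV[R]_n) : continuous (fun x : 'rV[R]_n => dot (x - y) (x - y)).
  move=> x; rewrite (_ : (fun x => _) = (fun x => enorm (y - x) * enorm (y - x))); last first.
    by apply/funext => z; rewrite -expr2 enorm_distC sqr_enorm.
  by apply: (@cvgM _ _ (nbhs x)); exact: continuous_enorm_dist.
have Dlim y : Omega y -> (D ^~ y) @ \oo --> W y.
  move=> Oy; set tau := dot (q - y) (q - y).
  have tau0 : 0 < tau.
    by apply: lt_le_trans (parallel_dot_ge Gq Oy); rewrite exprn_gt0.
  have [xi xiP] := choice (fun k => (fun h => let: ex_intro2 a b c := h in
     ex_intro (fun a => _ /\ _) a (conj b c)) (MVT k y Oy)).
  have cA : (fun k => dot (q_ k - y) (q_ k - y)) @ \oo --> tau.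
    exact: (continuous_cvg _ (ccont y q) cq).
  have cB : (fun k => dot (q_ k + d_ k *: e - y) (q_ k + d_ k *: e - y)) @ \oo --> tau.
    exact: (continuous_cvg _ (ccont y q) cp).
  have cxi : xi @ \oo --> tau.
    apply/cvgrPdist_lt => r r0; near=> k.
    have h1 : `|tau - dot (q_ k - y) (q_ k - y)| < r.
      by near: k; move/cvgrPdist_lt : cA; exact.
    have h2 : `|tau - dot (q_ k + d_ k *: e - y) (q_ k + d_ k *: e - y)| < r.
      by near: k; move/cvgrPdist_lt : cB; exact.
    by have [h3 _] := xiP k; exact: dist_between h1 h2 h3.
  have cb : (fun k => 2 * dot (q_ k - y) e + d_ k) @ \oo --> 2 * (l - dot y e) + 0.
    apply: cvgD => //; apply: cvgM; first exact: cvg_cst.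
    rewrite -ql -dotNl -dotDl.
    apply: (continuous_cvg _ (_ : {for q, continuous (fun x : 'rV[R]_n => dot (x - y) e)}) cq).
    rewrite (_ : (fun x => _) = (fun x => dot x e + dot (- y) e)); last first.
      by apply/funext => z; rewrite dotDl.
    apply: (@cvgD _ _ _ (nbhs q)); first exact: continuous_dot.
    exact: cvg_cst.
  have -> : D ^~ y = fun k => alpha * xi k `^ (- alpha - 1) * (2 * dot (q_ k - y) e + d_ k).
    by apply/funext => k; have [_ ->] := xiP k.
  have -> : W y = alpha * tau `^ (- alpha - 1) * (2 * (l - dot y e) + 0).
    by rewrite /W -/tau addr0; ring.
  apply: cvgM => //; apply: cvgM; first exact: cvg_cst.
  exact: (continuous_cvg _ (powR_continuous_pos (c := - alpha - 1) tau0) cxi).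
pose C := alpha * (t ^+ 2) `^ (- alpha - 1) * (2 * (`|M| + (M + t + 1)) + 1).
have Dbound k y : Omega y -> `|D k y| <= C.
  move=> Oy; have [xi /andP[xi1 _] ->] := MVT k y Oy.
  have [dk Gqk Gpk _ dk1] := seqP k.
  have t2 : 0 < t ^+ 2 by rewrite exprn_gt0.
  have txi : t ^+ 2 <= xi.
    by apply: le_trans xi1; rewrite le_min !parallel_dot_ge.
  have al0 := alpha_gt0 (n := n) s0.
  have xi0 : 0 <= xi `^ (- alpha - 1) := powR_ge0 _ _.
  rewrite normrM (ger0_norm (mulr_ge0 (ltW al0) xi0)).
  apply: ler_pM => //; first exact: mulr_ge0 (ltW al0) xi0.
    apply: ler_wpM2l; first exact: ltW.
    rewrite -opprD !powRN lef_pV2 ?posrE ?powR_gt0//; last exact: lt_le_trans txi.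
    apply: ge0_ler_powR; rewrite ?nnegrE ?(ltW t2) ?(le_trans (ltW t2) txi)//.
    by rewrite addr_ge0// ltW.
  apply: le_trans (ler_normD _ _) _; apply: lerD; last first.
    by apply: le_trans (ltW dk1) _; rewrite invf_le1 ?ler1n.
  rewrite normrM ger0_norm// ler_wpM2l//; apply: le_trans (normr_dot _ _) _.
  rewrite e1 mulr1; apply: le_trans (ler_enormD _ _) _; rewrite enormN addrC lerD//.
    exact: le_trans (OM Oy) (ler_norm _).
  exact: (parallel_bounded O0 OM Gqk).
have iUW : mu.-integrable setT (EFin \o (fun y => U y * W y)).
  apply: (integrable_U_bounded (C := C)) => // y Oy.
  have cn : (fun k => `|D k y|) @ \oo --> `|W y| by apply: cvg_norm; exact: Dlim.
  by apply: (cvgr_to_le cn); apply: nearW => k; exact: Dbound.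
have iUD k : mu.-integrable setT (EFin \o (fun y => U y * D k y)).
  by apply: (integrable_U_bounded (C := C)) => // y; exact: Dbound.
have IUD k : (\int[mu]_y (U y * D k y)%:E = 0)%E.
  have [dk Gqk Gpk _ _] := seqP k.
  have iq := integrable_U_kernel Gqk; have ip := integrable_U_kernel Gpk.
  have ED y : U y * D k y = (d_ k)^-1 * (U y * K (q_ k) y - U y * K (q_ k + d_ k *: e) y).
    by rewrite /D -mulrBr mulrA mulrC.
  have [_ E] := Rintegral_scaledB ED iq ip.
  have {}E : \int[mu]_y (U y * D k y) =
    (d_ k)^-1 * (potential (q_ k) - potential (q_ k + d_ k *: e)) := E.
  rewrite pot subrr mulr0 in E.
  by rewrite -[LHS]fineK ?(integrable_fin_num measurableT (iUD k))// -/(Rintegral _ _ _) E.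
apply: (odd_weight_symmetric e1 cap ord mW _ _ iUW).
- move=> y; rewrite /W dot_refl// -!sqr_enorm.
  rewrite -(enorm_refl_swap l q y e1) (refl_fix ql).
  by rewrite (_ : l - (2 * l - dot y e) = - (l - dot y e)); ring.
- move=> y Oy yl; rewrite /W; apply: mulr_gt0; last first.
    by apply: powR_gt0; apply: lt_le_trans (parallel_dot_ge Gq Oy); rewrite exprn_gt0.
  by rewrite mulr_gt0 ?subr_gt0// mulr_gt0// alpha_gt0.
have ibound : mu.-integrable setT (fun y => (MU * C * \1_Omega y)%:E).
  apply: (integrable_bounded_support mO volO (C := `|MU * C|)).
  - by apply: measurable_funM => //; exact: measurable_indic.
  - by move=> y; rewrite normrM indicE; case: (_ \in _); rewrite ?normr1 ?normr0 ?mulr1 ?mulr0.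
  - by move=> y nOy; rewrite indicE memNset// mulr0.
have cvgUD y : (fun k => (U y * D k y)%:E) @ \oo --> (U y * W y)%:E.
  apply: cvg_EFin; first exact: nearW.
  have [Oy|nOy] := pselect (Omega y).
    by apply: cvgM; [exact: cvg_cst|exact: Dlim].
  by apply: cvg_near_cst; apply: nearW => k; rewrite /= (Uout nOy) !mul0r.
have boundUD y k : (`|(U y * D k y)%:E| <= (MU * C * \1_Omega y)%:E)%E.
  rewrite lee_fin indicE; have [Oy|nOy] := pselect (Omega y).
    rewrite mem_set// mulr1 normrM (ger0_norm (Uge0 y)).
    by apply: ler_pM; [exact: Uge0|exact: normr_ge0|exact: UM|exact: Dbound].
  by rewrite memNset// (Uout nOy) mul0r normr0 mulr0.
have [_ _] := @dominated_convergence _ _ _ mu setT measurableT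
  (fun k y => (U y * D k y)%:E) (fun y => (U y * W y)%:E)
  (fun y => (MU * C * \1_Omega y)%:E)
  (fun k => measurable_int mu (iUD k)) (measurable_int mu iUW)
  (aeW _ (fun y _ => cvgUD y)) ibound (aeW _ (fun y k _ => boundUD y k)).
rewrite (_ : [sequence _]_k = cst 0%E); last by apply/funext => k; exact: IUD.
by move=> /cvg_lim E0; rewrite /Rintegral -E0// lim_cst.
Unshelve. all: by end_near. Qed.

End critical_plane.

(** * Positivity of the normalising constant *)

Section gamma_function.
Context {R : realType} (a : R) (a0 : 0 < a).
Local Notation mu := (@lebesgue_measure R).
Local Notation g := (fun t : R => t `^ (a - 1) * expR (- t)).

Lemma measurable_Gamma_density (D : set R) : measurable_fun D g.
Proof.
apply: measurable_funTS; apply: measurable_funM; first exact: (@measurable_powR R (a - 1)).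
by apply: measurableT_comp => //; exact: measurable_funN.
Qed.

Lemma Gamma_density_ge0 t : 0 <= g t.
Proof. by rewrite mulr_ge0 ?powR_ge0 ?expR_ge0. Qed.

Lemma integral_power_near0 : (\int[mu]_(t in `]0%R, 1%R]) (t `^ (a - 1))%:E <= (a^-1)%:E)%E.
Proof.
(* The left ends start at [1 / 2] to keep the intervals nondegenerate. *)
pose A (k : nat) : set (measurableTypeR R) := `[k.+2%:R^-1 : R, 1]%classic.
have A0 k t : A k t -> 0 < t.
  by rewrite /A /= in_itv /= => /andP[kt _]; apply: lt_le_trans kt; rewrite invr_gt0.
have mA k : measurable (A k) by exact: measurable_itv.
have ndA : nondecreasing_seq A.
  move=> j k jk; apply/subsetPset => t; rewrite /A /= !in_itv /= => /andP[h ->].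
  by rewrite andbT (le_trans _ h)// lef_pV2 ?posrE// ler_nat.
have -> : `]0, 1]%classic = \bigcup_k A k.
  apply/seteqP; split=> [t|t [k _ Akt]]; last first.
    by have t0 := A0 _ _ Akt; move: Akt; rewrite /A /= !in_itv /= t0 => /andP[].
  rewrite /= in_itv /= => /andP[t0 t1].
  have [k _ kP] := near_infty_natSinv_lt (PosNum t0); exists k => //.
  rewrite /A /= in_itv /= t1 andbT; have := kP k.+1 (leqnSn k); exact: ltW.
have mp k : measurable_fun (A k) (fun t : measurableTypeR R => (t `^ (a - 1))%:E).
  apply/measurable_EFinP; apply: measurable_funTS.
  exact: (@measurable_powR R (a - 1)).
have cvgA := @ge0_nondecreasing_set_cvg_integral _ (measurableTypeR R) R A
  (fun t => (t `^ (a - 1))%:E) mu ndA mA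
  mp
  (fun k t _ => powR_ge0 t (a - 1)).
rewrite -(cvg_lim _ cvgA)//; apply: lime_le; first by apply/cvg_ex; eexists; exact: cvgA.
apply: nearW => k.
have dpow (t : R) : 0 < t -> is_derive t 1 (fun x => a^-1 * x `^ a) (t `^ (a - 1)).
  move=> t0; have := is_deriveZ (a^-1) (is_derive1_powR a t0).
  by rewrite /GRing.scale /= mulrA mulVf ?mul1r// gt_eqF.
have cpow (c t : R) : 0 < t -> {for t, continuous (fun x : R => x `^ c)}.
  exact: powR_continuous_pos.
have k0 : 0 < k.+2%:R^-1 :> R by rewrite invr_gt0.
have k1 : k.+2%:R^-1 < 1 :> R by rewrite invf_lt1// ltr1n.
rewrite (@continuous_FTC2 _ _ (fun x => a^-1 * x `^ a) _ _ k1).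
- rewrite powR1 mulr1 -EFinB lee_fin gerBl mulr_ge0 ?powR_ge0// invr_ge0 ltW//.
- apply: continuous_in_subspaceT => t; rewrite inE => /A0; exact: cpow.
- split=> [t||].
  + rewrite in_itv /= => /andP[kt _]; have := dpow t (lt_trans k0 kt) => ?.
    by apply: ex_derive.
  + apply: cvg_at_right_filter; apply: cvgM; [exact: cvg_cst|exact: cpow].
  + apply: cvg_at_left_filter; apply: cvgM; [exact: cvg_cst|exact: cpow].
- move=> t; rewrite in_itv /= => /andP[kt _]; rewrite derive1E.
  by have := dpow t (lt_trans k0 kt) => ?; rewrite derive_val.
Qed.

(** With [b := a + 1], the bound [ln t <= t / (2 * b) + ln (2 * b)] shows that
    the power is at most a multiple of [expR (t / 2)]. *)
Lemma Gamma_density_near_infty : exists2 C : R, 0 <= C &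
  forall t, 1 <= t -> g t <= C * exponential_pdf 2^-1 t.
Proof.
pose b := a + 1; have b0 : 0 < b by rewrite addr_gt0.
exists (2 * expR (b * ln (2 * b))); first by rewrite mulr_ge0 ?expR_ge0.
move=> t t1; have t0 : 0 < t := lt_le_trans ltr01 t1.
rewrite /exponential_pdf patchE mem_set; last by rewrite /= in_itv /= andbT ltW.
rewrite mulrACA divff// mul1r -expRD /powR (gt_eqF t0) -expRD ler_expR.
have b2 : 0 < 2 * b by rewrite mulr_gt0.
have h1 : ln t <= t / (2 * b) + ln (2 * b).
  rewrite -lerBlDr -ln_div ?posrE//; apply/ltW/ln_sublinear; exact: divr_gt0.
have h2 : (a - 1) * ln t <= b * ln t by rewrite ler_wpM2r ?ln_ge0// /b; lra.
have h3 : b * ln t <= t / 2 + b * ln (2 * b).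
  have -> : t / 2 = b * (t / (2 * b)) by field; rewrite gt_eqF.
  by rewrite -mulrDr ler_pM2l.
lra.
Qed.

Lemma Gamma_integral_lty : (\int[mu]_(t in `]0%R, +oo[) (g t)%:E < +oo)%E.
Proof.
have [C C0 gC] := Gamma_density_near_infty.
have -> : `]0, +oo[%classic = `]0, 1]%classic `|` `]1, +oo[%classic :> set R.
  apply/seteqP; split=> t; rewrite /= !in_itv /= !andbT.
    by move=> t0; rewrite t0; have [t1|t1] := leP t 1; [left|right].
  by case=> [/andP[]//|]; exact: lt_trans.
have mg (D : set R) : measurable_fun D (EFin \o g).
  by apply/measurable_EFinP; exact: measurable_Gamma_density.
rewrite ge0_integral_setU//=; last 3 first.
- exact: mg.
- by move=> t _; rewrite lee_fin Gamma_density_ge0.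
- apply/disj_setPS => t /= []; rewrite !in_itv /= andbT => /andP[_ t1].
  by rewrite ltNge t1.
apply: lte_add_pinfty.
  apply: (@le_lt_trans _ _ (a^-1)%:E); last exact: ltry.
  apply: le_trans integral_power_near0; apply: ge0_le_integral => //.
  - by move=> t _; rewrite lee_fin Gamma_density_ge0.
  - exact: mg.
  - apply/measurable_EFinP; apply: measurable_funTS.
    exact: (@measurable_powR R (a - 1)).
  move=> t /=; rewrite in_itv /= => /andP[t0 _]; rewrite lee_fin ler_piMr ?powR_ge0//.
  by rewrite -expR0 ler_expR oppr_le0 ltW.
have r0 : 0 < 2^-1 :> R by rewrite invr_gt0.
have iexp := integrable_exponential_pdf r0.
have : (\int[mu]_t (C%:E * (exponential_pdf 2^-1 t)%:E) < +oo)%E.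
  rewrite ge0_integralZl_EFin//.
  - by rewrite integral_exponential_pdf ?invr_gt0// mule1 ltry.
  - by move=> t _; rewrite lee_fin exponential_pdf_ge0.
  - exact: (measurable_int _ iexp).
apply: le_lt_trans.
apply: (@le_trans _ _ (\int[mu]_(t in `]1%R, +oo[) (C%:E * (exponential_pdf 2^-1 t)%:E))%E).
  apply: ge0_le_integral => //.
  - by move=> t _; rewrite lee_fin Gamma_density_ge0.
  - exact: mg.
  - apply: measurable_funTS; apply: measurable_funeM.
    exact: (measurable_int _ iexp).
  move=> t /=; rewrite in_itv /= andbT => t1; rewrite -EFinM lee_fin.
  by apply: gC; exact: ltW.
apply: ge0_subset_integral => //.
- by apply: measurable_funeM; exact: (measurable_int _ iexp).
- by move=> t _; rewrite -EFinM lee_fin mulr_ge0// exponential_pdf_ge0.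
Qed.

Lemma Gamma_gt0 : 0 < Gamma a.
Proof.
have I0 : (0 < \int[mu]_(t in `]0%R, +oo[) (g t)%:E)%E.
  pose m : R := Num.min 1 (2 `^ (a - 1)) * expR (- 2).
  have m0 : 0 < m by rewrite mulr_gt0 ?expR_gt0// lt_min ltr01 powR_gt0.
  apply: (@lt_le_trans _ _ (\int[mu]_(t in `[1%R, 2%R]) m%:E)%E).
    rewrite integral_cst//= lebesgue_measure_itv /= lte_fin ltr1n /= -EFinB -EFinM lte_fin.
    by rewrite mulr_gt0// subr_gt0 ltr1n.
  apply: (@le_trans _ _ (\int[mu]_(t in `[1%R, 2%R]) (g t)%:E)%E).
    apply: ge0_le_integral => //.
    - by move=> t _; rewrite lee_fin ltW.
    - by apply/measurable_EFinP; exact: measurable_Gamma_density.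
    move=> t /=; rewrite in_itv /= => /andP[t1 t2]; rewrite lee_fin.
    have t0 : 0 < t := lt_le_trans ltr01 t1.
    apply: ler_pM; [by rewrite le_min ler01 powR_ge0|exact: expR_ge0| |]; last first.
      by rewrite ler_expR lerN2.
    have [a1|a1] := leP 0 (a - 1); rewrite ge_min; apply/orP; [left|right].
      by rewrite -[leLHS](powRr0 t); apply: ler_powR.
    have c0 : 0 <= 1 - a by lra.
    rewrite -(opprB 1 a) !powRN lef_pV2 ?posrE; [|exact: powR_gt0|exact: powR_gt0].
    by apply: (ge0_ler_powR c0) => //; rewrite ?nnegrE ltW.
  apply: ge0_subset_integral => //.
  - by apply/measurable_EFinP; exact: measurable_Gamma_density.
  - by move=> t _; rewrite lee_fin Gamma_density_ge0.
  by move=> t /=; rewrite !in_itv /= andbT => /andP[t1 _]; exact: lt_le_trans t1.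
by apply: fine_gt0; rewrite I0 Gamma_integral_lty.
Qed.

End gamma_function.

Lemma c_ns_gt0 {R : realType} (n : nat) (s : R) : 0 < s -> s < 1 -> 0 < c_ns n s.
Proof.
move=> s0 s1; have G1 : 0 < n%:R / 2 + s by rewrite ltr_wpDl// divr_ge0.
have G2 : 0 < 2 - s by lra.
have s10 : 0 < 1 - s by rewrite subr_gt0.
by rewrite divr_gt0 ?Gamma_gt0// !mulr_gt0 ?Gamma_gt0// powR_gt0// pi_gt0.
Qed.

(** * Reduction to a continuous representative *)

Lemma ae_double_integral d (T : measurableType d) (R : realType)
    (mu : {measure set T -> \bar R}) (f g : T -> T -> R) (P : T -> Prop) :
  {ae mu, forall x, P x} -> (forall x y, P x -> P y -> f x y = g x y) ->
  (\int[mu]_y \int[mu]_x (f x y)%:E = \int[mu]_y \int[mu]_x (g x y)%:E)%E /\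
  \int[mu]_y \int[mu]_x f x y = \int[mu]_y \int[mu]_x g x y.
Proof.
move=> aeP fg; split.
  apply: ae_eq_integral_any; apply: (filterS _ aeP) => y Py _.
  apply: ae_eq_integral_any; apply: (filterS _ aeP) => x Px _.
  by rewrite fg.
apply: ae_eq_Rintegral_any; apply: (filterS _ aeP) => y Py _.
apply: ae_eq_Rintegral_any; apply: (filterS _ aeP) => x Px _.
by rewrite fg.
Qed.

(** The inner integrals need only be finite for almost every [y], and those that
    are not are replaced by [0] in the real-valued iterated integral. *)
Lemma Rintegral_prod d1 d2 (T1 : measurableType d1) (T2 : measurableType d2) (R : realType)
    (m1 : {sigma_finite_measure set T1 -> \bar R})
    (m2 : {sigma_finite_measure set T2 -> \bar R}) (h : T1 * T2 -> R) :
  (m1 \x m2)%E.-integrable setT (EFin \o h) ->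
  \int[(m1 \x m2)%E]_z h z = \int[m2]_y \int[m1]_x h (x, y).
Proof.
move=> ih; rewrite /Rintegral; congr fine.
rewrite -(integral21_prod_meas1 ih); apply: ae_eq_integral_any.
apply: filterS (ae_integrable2 ih) => y iy _.
by rewrite fineK//; exact: (integrable_fin_num measurableT iy).
Qed.

Lemma Lfun_infty_bounded d (T : measurableType d) (R : realType)
    (mu : {measure set T -> \bar R}) (u : T -> R) : (0 < mu setT)%E ->
  u \in Lfun mu +oo%E -> exists M : R, {ae mu, forall x, `|u x| <= M}.
Proof.
move=> mu0; rewrite inE => /andP[_]; rewrite inE /= /finite_norm unlock /= mu0.
move=> /(ess_supr_bounded (f := fun x => `|u x|)) [C uC]; exists C.
by apply: filterS uC.
Qed.

Lemma bounded_Lfun2 d (T : measurableType d) (R : realType)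
    (mu : {measure set T -> \bar R}) (D : set T) (C : R) (h : T -> R) :
  measurable D -> (mu D < +oo)%E -> measurable_fun setT h ->
  (forall x, `|h x| <= C) -> (forall x, ~ D x -> h x = 0) -> h \in Lfun mu 2%:E.
Proof.
move=> mD Doo mh hC h0.
have /integrableP[_ ih] : mu.-integrable setT (EFin \o (fun x => h x ^+ 2)).
  apply: (integrable_bounded_support mD Doo (C := C ^+ 2)).
  - exact: measurable_funX.
  - by move=> x; rewrite normrX; apply: lerXn2r; rewrite ?nnegrE// (le_trans _ (hC x)).
  - by move=> x /h0 ->; rewrite expr0n.
rewrite inE; apply/andP; split; rewrite inE //= /finite_norm unlock; apply: poweR_lty.
apply: le_lt_trans ih; rewrite le_eqVlt; apply/orP; left; apply/eqP.
by apply: eq_integral => x _; rewrite /= powR_mulrn// normrX.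
Qed.

Section representative.
Context {R : realType} {n : nat} (s : R) (s0 : 0 < s).
Context (Omega : set 'rV[R]_n) (rO : regopen Omega) (O0 : Omega !=set0) (M : R)
  (OM : forall x, Omega x -> enorm x <= M).
Context (u v : 'rV[R]_n -> R) (u0 : forall x, ~ Omega x -> u x = 0)
  (vcont : {within Omega, continuous v})
  (uv : {ae (volume n : {measure set 'rV[R]_n -> \bar R}), forall x, Omega x -> u x = v x})
  (vpos : forall x, Omega x -> 0 < v x).
Implicit Types (x y : 'rV[R]_n) (phi : 'rV[R]_n -> R).
Local Notation mu := (volume n : {sigma_finite_measure set 'rV[R]_n -> \bar R}).
Local Notation mu2 := (mu \x mu)%E.
Local Notation K := (@frac_kernel R n s).

Let oO := open_regopen rO.
Let mO : measurable Omega := open_measurable_rV oO.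
Let volO := volume_Omega_lty rO OM.

Definition extension x : R := if x \in Omega then v x else 0.
Local Notation U := extension.

Lemma extension_in x : Omega x -> U x = v x.
Proof. by move=> Ox; rewrite /U mem_set. Qed.

Lemma extension_out x : ~ Omega x -> U x = 0.
Proof. by move=> Ox; rewrite /U memNset. Qed.

Lemma extension_pos x : Omega x -> 0 < U x.
Proof. by move=> Ox; rewrite extension_in// vpos. Qed.

Lemma extension_cont x : Omega x -> {for x, continuous U}.
Proof.
move=> Ox; have vx : {for x, continuous v}.
  by move: vcont; rewrite continuous_open_subspace// => /(_ x (mem_set Ox)).
rewrite /prop_for /continuous_at extension_in//; apply: cvg_trans vx.
have nO : \forall y \near x, Omega y by exact: open_nbhs_nbhs (conj oO Ox).
have h : {near x, v =1 U} by apply: (filterS _ nO) => y /extension_in.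
exact: (near_eq_cvg h).
Qed.

Lemma extension_ae : {ae mu, forall x, u x = U x}.
Proof.
apply: filterS uv => x uvx; have [Ox|nOx] := pselect (Omega x).
  by rewrite extension_in// uvx.
by rewrite extension_out// u0.
Qed.

Let mU := measurable_U rO extension_pos extension_out extension_cont.

(** By continuity, the essential bound of [u] holds everywhere. *)
Lemma extension_bounded : u \in Lfun (volume n) +oo%E ->
  exists2 MU : R, 0 < MU & forall x, U x <= MU.
Proof.
have V0 : (0 < volume n Omega)%E by exact: volume_open_gt0.
have V1 : (0 < volume n [set: 'rV[R]_n])%E.
  by apply: lt_le_trans V0 _; apply: le_measure; rewrite ?inE.
move=> /(Lfun_infty_bounded V1)[C uC].
exists (Num.max 1 C); first by rewrite lt_max ltr01.
move=> x; rewrite le_max; apply/orP; right; rewrite leNgt; apply/negP => CU.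
have C0 : 0 <= C.
  have [//|C0] := leP 0 C; have := uC => -[N [mN N0 hN]].
  have : (volume n Omega <= volume n N)%E.
    apply: le_measure; rewrite ?inE// => y _; apply: hN => /= yC.
    by have := le_trans (normr_ge0 _) yC; rewrite leNgt C0.
  by rewrite N0 leNgt V0.
have Ox : Omega x.
  by apply: contrapT => /extension_out Ux0; move: CU; rewrite Ux0 ltNge C0.
have d0 : 0 < U x - C by rewrite subr_gt0.
have /cvgrPdist_lt/(_ _ d0)/nbhs_eballP[r r0 rU] := extension_cont Ox.
have [N [mN N0 hN]] := ae_conj extension_ae uC.
have : (volume n (eball x r) <= volume n N)%E.
  apply: le_measure; rewrite ?inE//; first exact: measurable_eball.
  move=> y /rU yr; apply: hN => /= -[-> Uy].
  have := ler_norm (U y); move: yr; rewrite /= ltr_norml => /andP[_]; lra.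
rewrite N0 leNgt volume_open_gt0//; first exact: open_eball.
by exists x; rewrite /eball /= subrr enorm0.
Qed.

Lemma extension_finite_energy : Hs s u -> finite_energy s mu U.
Proof.
move=> [_ fu]; split; first exact: mU.
have m2 : measurable_fun setT (EFin \o energy_density s U U).
  by apply/measurable_EFinP; exact: measurable_energy_density.
have E := fubini_tonelli2 (m1 := mu) (m2 := mu) _ m2 (fun z => energy_density_ge0 s U z).
apply: le_lt_trans fu; rewrite le_eqVlt; apply/orP; left; apply/eqP.
apply: etrans E _; rewrite /fubini_G /=.
have ed x y : u x = U x -> u y = U y ->
    energy_density s U U (x, y) = `|u x - u y| ^+ 2 * K x y.
  by move=> ux uy; rewrite /energy_density /= -ux -uy real_normK ?num_real// expr2.
by have [-> _] := ae_double_integral extension_ae ed.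
Qed.

Lemma test_function_Hs0 phi (C : R) : finite_energy s mu phi ->
  (forall x, `|phi x| <= C) -> (forall x, ~ Omega x -> phi x = 0) -> Hs0 s Omega phi.
Proof.
move=> [mphi fphi] phiC phi0; split; last exact: aeW.
split; first exact: (bounded_Lfun2 mO volO mphi phiC phi0).
have m2 : measurable_fun setT (EFin \o energy_density s phi phi).
  by apply/measurable_EFinP; exact: measurable_energy_density.
have E := fubini_tonelli2 (m1 := mu) (m2 := mu) _ m2 (fun z => energy_density_ge0 s phi z).
apply: le_lt_trans fphi; rewrite le_eqVlt; apply/orP; left; apply/eqP.
apply: etrans (esym E); apply: eq_integral => y _; apply: eq_integral => x _.
by rewrite /= /energy_density /= real_normK ?num_real// expr2.
Qed.

Lemma energy_extension phi : finite_energy s mu U -> finite_energy s mu phi ->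
  energy s u phi = c_ns n s / 2 * \int[mu2]_z energy_density s U phi z.
Proof.
move=> fU fphi; congr (_ * _); rewrite (Rintegral_prod (energy_density_integrable fU fphi)).
have ed x y : u x = U x -> u y = U y ->
    (u x - u y) * (phi x - phi y) * K x y = energy_density s U phi (x, y).
  by move=> -> ->.
by have [_ ->] := ae_double_integral extension_ae ed.
Qed.

(** The nonlinearity enters through its values on the range of [U] only, which
    allows a truncated one. *)
Lemma weak_extension (f F : R -> R) MU : (forall x, U x <= MU) ->
  (forall b, 0 <= b -> b <= MU -> F b = f b) -> weak_solution s f Omega u ->
  forall phi C, finite_energy s mu phi -> (forall x, `|phi x| <= C) ->
    (forall x, ~ Omega x -> phi x = 0) ->
  c_ns n s / 2 * \int[mu2]_z energy_density s U phi z = \int[mu]_x (F (U x) * phi x).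
Proof.
move=> UMU Ff [[Hsu _] wu] phi C fphi phiC phi0.
rewrite -energy_extension//; last exact: extension_finite_energy.
rewrite (wu _ (test_function_Hs0 fphi phiC phi0)) Rintegral_mkcond.
apply: ae_eq_Rintegral_any; apply: (filterS _ extension_ae) => x uUx _.
rewrite patchE; case: ifPn => [/set_mem Ox|/negP nOx].
  by rewrite uUx Ff// ltW// extension_pos.
by rewrite phi0 ?mulr0// => Ox; apply: nOx; exact: mem_set.
Qed.

Lemma nonlocal_derivative_potential MU t q : (forall x, U x <= MU) -> 0 < t ->
  outer_parallel Omega t q ->
  nonlocal_normal_derivative s Omega u q = - (c_ns n s * potential s U q).
Proof.
move=> UMU t0 Gq.
have nOq : ~ Omega q by move=> /(parallel_neq t0 Gq)/eqP.
have iUK := integrable_U_kernel s0 rO OM extension_pos extension_out UMU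
  extension_cont t0 Gq.
rewrite -mulrN; congr (_ * _); rewrite /potential Rintegral_mkcond -mulN1r.
apply: etrans (RintegralZl (-1) measurableT iUK).
apply: ae_eq_Rintegral_any; apply: (filterS _ extension_ae) => y uUy _.
rewrite mulN1r patchE; case: ifPn => [/set_mem Oy|/negP nOy].
  by rewrite (u0 nOq) sub0r uUy mulNr.
by rewrite extension_out ?mul0r ?oppr0// => Oy; apply: nOy; exact: mem_set.
Qed.

End representative.

Section truncation.
Context {R : realType}.

Definition clamp (a b : R) : R := Num.max 0 (Num.min b a).

Lemma clamp_id a b : 0 <= b -> b <= a -> clamp a b = b.
Proof. by move=> b0 ba; rewrite /clamp min_l// max_r. Qed.

Lemma clamp_itv a b : 0 <= a -> 0 <= clamp a b <= a.
Proof. by move=> a0; rewrite /clamp le_max lexx ge_max a0 ge_min lexx orbT. Qed.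

Lemma clamp_lipschitz a b b' : `|clamp a b - clamp a b'| <= `|b - b'|.
Proof.
rewrite /clamp; have := ler_norm (b - b'); have := ler_norm (b' - b); rewrite distrC.
move: `|b - b'| => d h1 h2; rewrite ler_norml.
have [?|?] := leP b a; have [?|?] := leP b' a;
  have [?|?] := leP 0 b; have [?|?] := leP 0 b'; have [?|?] := leP 0 a;
  by apply/andP; split; lra.
Qed.

(** A function Lipschitz on [0, a] becomes globally Lipschitz after composition
    with [clamp a], and keeps its values on [0, a]. *)
Lemma truncation_lipschitz (f : R -> R) a : 0 < a -> [lipschitz f x | x in `[0, a]] ->
  exists2 L : R, 0 <= L & forall b b',
    `|f (clamp a b) - f (clamp a b')| <= L * `|b - b'|.
Proof.
move=> a0 [N [_ NL]].
pose L := Num.max 0 (N + 1).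
have L0 : 0 <= L by rewrite /L le_max lexx.
have /NL fL : N < L by rewrite /L lt_max ltrDl ltr01 orbT.
exists L => // b b'.
have itv c : `[0, a]%classic (clamp a c) by rewrite /= in_itv /=; exact/clamp_itv/ltW.
have := fL (clamp a b, clamp a b') (conj (itv b) (itv b')); rewrite /=.
move=> /le_trans; apply; apply: ler_wpM2l => //; exact: clamp_lipschitz.
Qed.

End truncation.

(** * Symmetry in every direction *)

Section symmetry_in_every_direction.
Context {R : realType} {n : nat} (s : R) (s0 : 0 < s).
Context (Omega : set 'rV[R]_n) (rO : regopen Omega) (O0 : Omega !=set0) (M : R)
  (OM : forall x, Omega x -> enorm x <= M).
Context (U : 'rV[R]_n -> R) (MU : R) (Upos : forall x, Omega x -> 0 < U x)
  (Uout : forall x, ~ Omega x -> U x = 0) (UM : forall x, U x <= MU)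
  (Ucont : forall x, Omega x -> {for x, continuous U}).
Local Notation mu := (volume n : {sigma_finite_measure set 'rV[R]_n -> \bar R}).
Local Notation mu2 := (mu \x mu)%E.
Context (F : R -> R) (L c : R) (L0 : 0 <= L) (c0 : 0 < c)
  (FL : forall a b, `|F a - F b| <= L * `|a - b|)
  (fU : finite_energy s mu U)
  (weak : forall (phi : 'rV[R]_n -> R) (C : R), finite_energy s mu phi ->
    (forall x, `|phi x| <= C) -> (forall x, ~ Omega x -> phi x = 0) ->
    c / 2 * \int[mu2]_z energy_density s U phi z = \int[mu]_x (F (U x) * phi x)).
Context (t : R) (t0 : 0 < t) (tr : (t%:E < reach (closure Omega))%E)
  (pot : forall p q, outer_parallel Omega t p -> outer_parallel Omega t q ->
    potential s U p = potential s U q).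
Implicit Types (x y q e : 'rV[R]_n) (l : R).

Section direction.
Context (e : 'rV[R]_n) (e1 : enorm e = 1).
Local Notation crit := (critical_height Omega t e).

Let cap l : crit <= l -> cap_inside Omega e l.
Proof. by move=> hl x; exact: (cap_reflected O0 OM t0 e1 rO tr hl). Qed.

Lemma ordered_far l : M < l -> ordered_at U e l.
Proof.
move=> Ml x xl; rewrite (Uout (x := refl e l x)); first exact: (U_ge0 Upos Uout).
move=> Orx; have := cauchy_schwarz (refl e l x) e; have := OM Orx.
by rewrite e1 mulr1 dot_refl//; lra.
Qed.

Lemma critical_plane_symmetric : ordered_at U e crit ->
  forall x, dot x e <= crit -> U (refl e crit x) = U x.
Proof.
move=> ord; have capc := cap (lexx crit).
have [q [d [q_ [d_ [[Gq Gp d0 hl] seqP]]]]] := critical_chord O0 OM t0 e1.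
move: d0; rewrite le_eqVlt => /orP[/eqP d0|d0].
  apply: (tangent_symmetric s0 rO O0 OM Upos Uout UM Ucont t0 e1 capc ord Gq (q_ := q_) (d_ := d_)).
  - by rewrite -[RHS]hl -d0 mul0r addr0.
  - by move=> k; have := seqP k; rewrite -d0 sub0r normrN.
  - by move=> k; have [_ h1 h2 _ _] := seqP k; exact: pot.
exact: (chord_symmetric s0 rO OM Upos Uout UM Ucont t0 e1 capc ord d0 Gq Gp hl (pot Gq Gp)).
Qed.

(** [l0] is the lowest height down to which all hyperplanes are ordered.  If it
    is above the critical height and not one of symmetry, [plane_step] applied to
    unordered hyperplanes converging to it from below gives a contradiction. *)
Lemma direction_symmetric : exists2 l, crit <= l & symmetric_at Omega e l.
Proof.
pose S := [set l | crit <= l /\ forall m, l <= m -> ordered_at U e m].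
have S1 : S (Num.max crit (M + 1)).
  split=> [|m]; first by rewrite le_max lexx.
  by rewrite ge_max => /andP[_ hm]; apply: ordered_far; lra.
have infS : has_inf S by split; [exists (Num.max crit (M + 1))|exists crit => l []].
pose l0 := inf S.
have cl0 : crit <= l0 by apply: lb_le_inf; [exact: infS.1|move=> l []].
have above m : l0 < m -> ordered_at U e m.
  move=> l0m; have d0 : 0 < m - l0 by rewrite subr_gt0.
  have [l [_ Sl]] := inf_adherent d0 infS; rewrite addrC subrK => lm.
  exact: Sl (ltW lm).
have ord0 : ordered_at U e l0.
  apply: (ordered_at_limit Upos Uout Ucont e1 (cap cl0)) => eps eps0.
  have e2 : 0 < eps / 2 by rewrite divr_gt0.
  by exists (l0 + eps / 2); split; [lra|lra|apply: above; lra].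
have {}above m : l0 <= m -> ordered_at U e m.
  by rewrite le_eqVlt => /orP[/eqP <-//|]; exact: above.
exists l0 => //; apply: (ordered_eq_symmetric Upos Uout e1).
have [E|crit_lt] := eqVneq l0 crit.
  by move: ord0; rewrite E; exact: critical_plane_symmetric.
have {crit_lt}cl1 : crit < l0 by rewrite lt_neqAle eq_sym crit_lt.
move=> x xl; apply/eqP; rewrite eq_le ord0//= leNgt; apply/negP => Ux.
have violated (k : nat) : exists l, [/\ crit < l, l < l0, `|l0 - l| < k.+1%:R^-1 &
    ~ ordered_at U e l].
  have : 0 < k.+1%:R^-1 :> R by rewrite invr_gt0.
  move: (k.+1%:R^-1) => kappa kappa0; pose p := Num.max crit (l0 - kappa).
  have [p1 p2 p3] : [/\ crit <= p, l0 - kappa <= p & p < l0].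
    by rewrite /p !le_max !lexx orbT gt_max cl1 ltrBlDr ltrDl.
  apply: contrapT => noviol.
  have : l0 <= (p + l0) / 2.
    apply: ge_inf => //; first by exists crit => l [].
    split=> [|m hm]; first by lra.
    apply: contrapT => nord; have [l0m|ml0] := leP l0 m; first exact: nord (above _ l0m).
    apply: noviol; exists m; split=> //; first by lra.
    by rewrite ger0_norm; lra.
  by lra.
have [l_ l_P] := choice violated.
have lim (eps : R) : 0 < eps -> exists k0, forall k, (k0 <= k)%N -> `|l0 - l_ k| < eps.
  move=> eps0; have [k0 _ k0P] := near_infty_natSinv_lt (PosNum eps0).
  by exists k0 => k /k0P; have [_ _ + _] := l_P k; exact: lt_trans.
have capl k : cap_inside Omega e (l_ k) by have [/ltW/cap] := l_P k.
have lt_l k : l_ k < l0 by have [] := l_P k.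
have [k ordk] := plane_step s0 rO OM Upos Uout UM Ucont L0 c0 FL fU weak e1 lt_l lim
  (cap cl0) capl ord0 xl Ux.
by have [_ _ _] := l_P k.
Qed.

End direction.

Lemma domain_ball : (0 < n)%N -> exists (x0 : 'rV[R]_n) (r : R), 0 < r /\ Omega = eball x0 r.
Proof.
move=> n0; apply: (symmetric_ball n0 O0 (open_regopen rO) OM) => e e1.
have [l critl syml] := direction_symmetric e1; exists l => // l' x ll' Ox lx.
exact: (cap_reflected O0 OM t0 e1 rO tr (le_trans critl ll')).
Qed.

End symmetry_in_every_direction.

(** * Balls from the overdetermined condition *)

Lemma bounded_set_enorm (R : realType) n (A : set 'rV[R]_n) : bounded_set A ->
  exists M : R, forall x, A x -> enorm x <= M.
Proof.
move=> [N [_ NA]]; exists (n%:R * (N + 1)) => x Ax.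
apply: le_trans (enorm_le_mx_norm x) _; rewrite ler_wpM2l//.
by apply: NA Ax; rewrite ltrDl.
Qed.

Theorem theorem1p2 (R : realType) (n : nat) (s : R) (Omega : set 'rV[R]_n)
    (t : R) (f : R -> R)
    (n_ge1 : (1 <= n)%N) (s_gt0 : 0 < s) (s_lt1 : s < 1)
    (Omega_nonempty : Omega !=set0)
    (Omega_regular_open : regopen Omega)
    (Omega_bounded : bounded_set Omega)
    (Omega_reach : (0 < reach (closure Omega))%E)
    (t_gt0 : 0 < t) (t_lt_reach : (t%:E < reach (closure Omega))%E)
    (f_locally_lipschitz :
      forall M : R, 0 < M -> [lipschitz f x | x in `[0, M]]) :
  (exists (u : 'rV[R]_n -> R) (c_flat : R),
    [/\ u \in Lfun (volume n) +oo%E,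
        weak_solution s f Omega u,
        (forall x, ~ Omega x -> u x = 0),
        positive_in Omega u &
        forall x, outer_parallel Omega t x ->
          nonlocal_normal_derivative s Omega u x = c_flat]) ->
  exists (x0 : 'rV[R]_n) (r : R), 0 < r /\ Omega = eball x0 r.
Proof.
move=> [u [c_flat [u_bounded u_weak u0 [v [vcont uv vpos]] u_flat]]].
have [M OM] := bounded_set_enorm Omega_bounded.
have [MU MU0 UM] := extension_bounded Omega_regular_open Omega_nonempty u0 vcont uv u_bounded.
have Ucont x Ox := extension_cont Omega_regular_open vcont (x := x) Ox.
have [L L0 FL] := truncation_lipschitz MU0 (f_locally_lipschitz _ MU0).
have fU := extension_finite_energy Omega_regular_open u0 vcont uv vpos u_weak.1.1.
have c0 := c_ns_gt0 n s_gt0 s_lt1.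
have weak := weak_extension (F := fun b => f (clamp MU b)) Omega_regular_open OM u0 vcont
  uv vpos UM (fun b b0 bM => congr1 f (clamp_id b0 bM)) u_weak.
have potE x (Gx : outer_parallel Omega t x) := nonlocal_derivative_potential s_gt0
  Omega_regular_open OM u0 vcont uv vpos UM t_gt0 Gx.
have pot p q : outer_parallel Omega t p -> outer_parallel Omega t q ->
    potential s (extension Omega v) p = potential s (extension Omega v) q.
  move=> Gp Gq; have := u_flat _ Gp; rewrite -(u_flat _ Gq) (potE _ Gp) (potE _ Gq).
  by move/oppr_inj; apply: mulfI; rewrite gt_eqF.
exact: (@domain_ball _ _ s s_gt0 Omega Omega_regular_open Omega_nonempty M OM
  (extension Omega v) MU (extension_pos vpos) (@extension_out _ _ Omega v) UM Ucont
  (fun b => f (clamp MU b)) L (c_ns n s) L0 c0 FL fU weak t t_gt0 t_lt_reach pot n_ge1).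
Qed.
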